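(* Let $\Omega$ be a bounded, smooth domain of $\mathbb{R}^N$, $N\geq1$. Let $x\in\Omega$ be fixed and, for each $p>N$, let $u_p\in\mathcal{M}_p(x)$ be the positive function such that $s_p(x)=(\|\nabla u_p\|_p)^{-1}$. Then every sequence $\{u_{p_n}\}_{n\in\mathbb{N}}$, with $p_n\to\infty$, admits a subsequence $\{u_{p_{n_j}}\}_{j\in\mathbb{N}}$ converging uniformly to a nonnegative function $u_\infty\in W^{1,\infty}(\Omega)\cap C_0(\overline\Omega)$ such that $$u_\infty(x)=\|u_\infty\|_\infty=1\quad\text{and}\quad\|\nabla u_\infty\|_\infty=(d_\Omega(x))^{-1}.$$ Moreover, $$\lim_{p\to\infty}s_p(y)=d_\Omega(y)\quad\text{for all } y\in\overline\Omega.$$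
   Context: For $N<p\le\infty$, $\|\cdot\|_p$ is the standard norm of $L^p(\Omega)$. For $p>N$, each $v\in W_0^{1,p}(\Omega)$ is identified with its continuous representative on $\overline\Omega$, which vanishes on $\partial\Omega$. $C_0(\overline\Omega)$ is the space of continuous functions on $\overline\Omega$ vanishing on $\partial\Omega$. $d_\Omega(x):=\inf_{y\in\partial\Omega}|x-y|$ for $x\in\overline\Omega$. For $p>N$, the function $s_p:\overline\Omega\to[0,\infty)$ is defined by $s_p(x):=\sup\{|v(x)|/\|\nabla v\|_p: v\in W_0^{1,p}(\Omega)\setminus\{0\}\}$ if $x\in\Omega$, and $s_p(x):=0$ if $x\in\partial\Omega$. For $x\in\Omega$, $\mathcal{M}_p(x):=\{v\in W_0^{1,p}(\Omega): |v(x)|=\|v\|_\infty=1\}$. For each $x\in\Omega$ and $p>N$ there is exactly one positive function $u_p\in\mathcal{M}_p(x)$ with $s_p(x)=(\|\nabla u_p\|_p)^{-1}$. *)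

(* Defs.v *)
From HB Require Import structures.
From mathcomp Require Import all_boot all_order all_algebra.
From mathcomp Require Import all_classical all_reals all_analysis.

Set Implicit Arguments.
Unset Strict Implicit.
Unset Printing Implicit Defensive.

Import Order.TTheory GRing.Theory Num.Theory.
Import numFieldNormedType.Exports.

Local Open Scope classical_set_scope.
Local Open Scope ring_scope.

Definition rV_display : measure_display. Proof. exact. Qed.

(* The sigma-algebra generated by the coordinates, i.e. the Borel one. *)
Section measurable_rV.
Context {R : realType} (n : nat).

Let coord (i : 'I_n) (v : 'rV[R]_n) : measurableTypeR R := v ord0 i.

Let rV_set0 : g_sigma_preimage coord set0.
Proof. exact: sigma_algebra0. Qed.

Let rV_setC A : g_sigma_preimage coord A -> g_sigma_preimage coord (~` A).
Proof. exact: sigma_algebraC. Qed.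

Let rV_bigcup (F : _^nat) : (forall i, g_sigma_preimage coord (F i)) ->
  g_sigma_preimage coord (\bigcup_i (F i)).
Proof. exact: sigma_algebra_bigcup. Qed.

HB.instance Definition _ := @isMeasurable.Build rV_display
  'rV[R]_n (g_sigma_preimage coord) rV_set0 rV_setC rV_bigcup.

Lemma measurable_coord (i : 'I_n) :
  measurable_fun [set: 'rV[R]_n] (fun v => v ord0 i : measurableTypeR R).
Proof.
move=> _ Y mY; rewrite setTI; apply: sub_sigma_algebra => /=.
rewrite -bigcup_seq/=; exists i => /=; first by rewrite mem_index_enum.
by exists Y => //; rewrite setTI.
Qed.

Lemma measurable_fun_rV d (T : measurableType d) (f : T -> 'rV[R]_n) :
  (forall i, measurable_fun setT (fun t => f t ord0 i : measurableTypeR R)) ->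
  measurable_fun setT f.
Proof.
move=> mf _ A mA; rewrite setTI.
suff : g_sigma_preimage coord `<=` [set B | measurable (f @^-1` B)] by apply.
apply: smallest_sub.
  split => /=.
  - by rewrite preimage_set0.
  - by move=> B mB; rewrite setTD preimage_setC; exact: measurableC.
  - by move=> F mF; rewrite preimage_bigcup; exact: bigcupT_measurable.
rewrite -bigcup_seq => B [i _ [C mC <-]] /=.
by rewrite setTI; have := mf i measurableT C mC; rewrite setTI.
Qed.

End measurable_rV.

Section lebesgue_rV.
Context {R : realType}.

Definition rV_cons n (p : measurableTypeR R * 'rV[R]_n) : 'rV[R]_n.+1 :=
  \row_i (if unlift ord0 i is Some j then p.2 ord0 j else p.1).

Definition rV_uncons n (v : 'rV[R]_n.+1) : measurableTypeR R * 'rV[R]_n :=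
  (v ord0 ord0, \row_i v ord0 (lift ord0 i)).

Lemma rV_consK n : cancel (@rV_cons n) (@rV_uncons n).
Proof.
move=> [a v]; rewrite /rV_uncons mxE unlift_none; congr (_, _).
by apply/rowP => i; rewrite !mxE liftK.
Qed.

Lemma measurable_rV_cons n : measurable_fun setT (@rV_cons n).
Proof.
apply: measurable_fun_rV => i.
under eq_fun do rewrite mxE.
case: unliftP => [j _|_]; last exact: measurable_fst.
exact: (measurableT_comp (@measurable_coord R n j) measurable_snd).
Qed.

Lemma measurable_rV_uncons n : measurable_fun setT (@rV_uncons n).
Proof.
apply: measurable_fun_pair; first exact: (@measurable_coord R n.+1 ord0).
apply: measurable_fun_rV => i; under eq_fun do rewrite mxE.
exact: measurable_coord.
Qed.

Section step.
Variables (n : nat) (mu : {sigma_finite_measure set 'rV[R]_n -> \bar R}).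

Definition lebesgue_step : set 'rV[R]_n.+1 -> \bar R :=
  pushforward (lebesgue_measure \x mu)%E (@rV_cons n).

Let step0 : lebesgue_step set0 = 0%E.
Proof. by rewrite /lebesgue_step /pushforward preimage_set0 measure0. Qed.

Let step_ge0 A : (0 <= lebesgue_step A)%E.
Proof. by rewrite /lebesgue_step /pushforward; apply: measure_ge0. Qed.

Let step_sigma_additive : semi_sigma_additive lebesgue_step.
Proof.
move=> F mF tF mUF; rewrite /lebesgue_step /pushforward preimage_bigcup.
have mpre A : measurable A -> measurable (@rV_cons n @^-1` A).
  by move=> mA; rewrite -[X in measurable X]setTI; exact: measurable_rV_cons.
apply: measure_semi_sigma_additive.
- by move=> k; exact: mpre.
- apply/trivIsetP => /= i j _ _ ij; rewrite -preimage_setI.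
  by move/trivIsetP : tF => /(_ _ _ _ _ ij) ->//; rewrite preimage_set0.
- by rewrite -preimage_bigcup; exact: mpre.
Qed.

HB.instance Definition _ := isMeasure.Build _ _ _
  lebesgue_step step0 step_ge0 step_sigma_additive.

Let step_sigma_finite : sigma_finite setT lebesgue_step.
Proof.
have /sigma_finiteP[F [FT ndF Foo]] := sigma_finiteT (@lebesgue_measure R).
have /sigma_finiteP[G [GT ndG Goo]] := sigma_finiteT mu.
exists (fun k => @rV_uncons n @^-1` (F k `*` G k)).
  rewrite -preimage_bigcup predeqE => v; split => // _.
  have [i _ Fi] : (\bigcup_k F k) (rV_uncons v).1 by rewrite -FT.
  have [j _ Gj] : (\bigcup_k G k) (rV_uncons v).2 by rewrite -GT.
  exists (maxn i j) => //; split.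
  - by move: Fi; exact/subsetPset/ndF/leq_maxl.
  - by move: Gj; exact/subsetPset/ndG/leq_maxr.
move=> k; have [mF Fk] := Foo k; have [mG Gk] := Goo k; split.
  rewrite -[X in measurable X]setTI; apply: measurable_rV_uncons => //.
  exact: measurableX.
rewrite /lebesgue_step /pushforward -comp_preimage.
rewrite (_ : _ \o _ = id); last by apply/funext => p /=; rewrite rV_consK.
rewrite preimage_id product_measure1E//.
by rewrite lte_mul_pinfty// ge0_fin_numE.
Qed.

HB.instance Definition _ := Measure_isSigmaFinite.Build _ _ _
  lebesgue_step step_sigma_finite.

End step.

(* [R^0] is a point of mass 1, and [R^(n+1)] is [R * R^n]. *)
Fixpoint leb n : {sigma_finite_measure set 'rV[R]_n -> \bar R} :=
  if n is m.+1 then lebesgue_step (leb m) else dirac (0 : 'rV[R]_0).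

Lemma measurable_box n (B : 'I_n -> set (measurableTypeR R)) :
  (forall i, measurable (B i)) ->
  measurable [set v : 'rV[R]_n | forall i, B i (v ord0 i)].
Proof.
move=> mB; rewrite (_ : [set _ | _] =
    \bigcap_(i in [set: 'I_n]) [set v : 'rV[R]_n | B i (v ord0 i)]); last first.
  by apply/seteqP; split => v /= Bv i; have := Bv i; [move=> + _|apply].
apply: (@fin_bigcap_measurable _ 'rV[R]_n); first exact: finite_finset.
move=> i _; by have := @measurable_coord R n i measurableT _ (mB i); rewrite setTI.
Qed.

Lemma leb_box n (B : 'I_n -> set (measurableTypeR R)) :
  (forall i, measurable (B i)) ->
  leb n [set v | forall i, B i (v ord0 i)] =
  (\big[*%E/1%E]_(i < n) lebesgue_measure (B i))%E.
Proof.
elim: n B => [|n IHn] B mB.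
  by rewrite big_ord0 /= diracE mem_set// => -[].
rewrite big_ord_recl -(IHn (fun i => B (lift ord0 i)))// -product_measure1E//.
  rewrite /= /lebesgue_step /pushforward; congr (_ _).
  apply/seteqP; split => -[a v] /=.
    move=> Bv; split; first by have := Bv ord0; rewrite mxE unlift_none.
    by move=> i; have := Bv (lift ord0 i); rewrite mxE liftK.
  by move=> [Ba Bv] i; rewrite mxE; case: unliftP => [j ->|->].
by apply: (@measurable_box n (fun i => B (lift ord0 i))).
Qed.

End lebesgue_rV.

Section domains.
Context {R : realType}.

(* The Euclidean norm; the library's norm on ['rV[R]_n] is the sup norm. *)
Definition enorm n (v : 'rV[R]_n) : R := Num.sqrt (\sum_i v ord0 i ^+ 2).

Definition partial n (i : 'I_n) (f : 'rV[R]_n -> R) : 'rV[R]_n -> R :=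
  fun x => 'D_(delta_mx ord0 i) f x.

Definition iter_partial n (s : seq 'I_n) (f : 'rV[R]_n -> R) : 'rV[R]_n -> R :=
  foldr (@partial n) f s.

Definition smooth n (f : 'rV[R]_n -> R) : Prop :=
  forall s : seq 'I_n, continuous (iter_partial s f) /\
    forall (i : 'I_n) x, derivable (iter_partial s f) x (delta_mx ord0 i).

Definition boundary n (A : set 'rV[R]_n) : set 'rV[R]_n :=
  closure A `\` interior A.

(* Near each boundary point, A is one side of the graph of a smooth function:
   after possibly exchanging coordinates and reflecting, it is
   {x | x_N > gamma (x_1, ..., x_(N-1))}. *)
Definition smooth_boundary n (A : set 'rV[R]_n) : Prop :=
  forall z, boundary A z ->
  exists (i : 'I_n) (reflect : bool) (gamma : 'rV[R]_n.-1 -> R),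
    smooth gamma /\
    \forall x \near z, A x <-> gamma (col' i x) < (-1) ^+ reflect * x ord0 i.

Definition smooth_bounded_domain n (A : set 'rV[R]_n) : Prop :=
  [/\ open A, connected A, A !=set0, bounded_set A & smooth_boundary A].

Definition bdist n (A : set 'rV[R]_n) (x : 'rV[R]_n) : R :=
  inf [set enorm (x - y) | y in boundary A].

End domains.

Section sobolev.
Context {R : realType} {n : nat}.
Variable Omega : set 'rV[R]_n.
Implicit Types (p : \bar R) (f v : 'rV[R]_n -> R) (g : 'rV[R]_n -> 'rV[R]_n).

Definition LpN p f : \bar R := 'N[@leb R n]_p[EFin \o (f \_ Omega)]%E.

Definition inLp p f : Prop := measurable_fun Omega f /\ (LpN p f < +oo)%E.

Definition inL1loc f : Prop := measurable_fun Omega f /\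
  forall K, compact K -> K `<=` Omega -> (@leb R n).-integrable K (EFin \o f).

Definition test_fun (phi : 'rV[R]_n -> R) : Prop :=
  let supp := closure [set x | phi x != 0] in
  [/\ smooth phi, compact supp & supp `<=` Omega].

Definition weak_gradient v g : Prop :=
  inL1loc v /\ forall i : 'I_n, inL1loc (fun x => g x ord0 i) /\
    forall phi, test_fun phi ->
      \int[@leb R n]_(x in Omega) (v x * partial i phi x) =
      - \int[@leb R n]_(x in Omega) (g x ord0 i * phi x).

(* Some weak gradient of v; it is unique only almost everywhere in Omega. *)
Definition grad v : 'rV[R]_n -> 'rV[R]_n :=
  xget (fun=> 0) [set g | weak_gradient v g].

Definition gradN p v : \bar R := LpN p (fun x => enorm (grad v x)).

Definition W1p p v : Prop :=
  [/\ inLp p v, weak_gradient v (grad v) &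
      forall i : 'I_n, inLp p (fun x => grad v x ord0 i)].

(* Closure of the test functions in W^{1,p}, for finite p. *)
Definition W1p0 (p : R) v : Prop := W1p p%:E v /\
  exists phi : nat -> 'rV[R]_n -> R,
    [/\ forall k, test_fun (phi k),
        LpN p%:E (fun x => phi k x - v x) @[k --> \oo] --> 0%E &
        forall i : 'I_n, LpN p%:E (fun x => partial i (phi k) x - grad v x ord0 i)
          @[k --> \oo] --> 0%E].

(* Only the values on [closure Omega] are relevant. *)
Definition C0 v : Prop :=
  {within closure Omega, continuous v} /\
  forall y, boundary Omega y -> v y = 0.

(* For p > n, the elements of W^{1,p}_0, taken as their continuous
   representatives on [closure Omega]. *)
Definition W1p0_cont (p : R) v : Prop := W1p0 p v /\ C0 v.

(* An element of [W1p0_cont] is nonzero when it is nonzero at some point of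
   Omega.  The supremum is taken in [\bar R]. *)
Definition sp (p : R) (x : 'rV[R]_n) : \bar R :=
  if x \in Omega then
    ereal_sup [set (`|v x| / fine (gradN p%:E v))%:E |
               v in [set v | W1p0_cont p v /\ exists2 y, Omega y & v y != 0]]
  else 0%E.

Definition Mp (p : R) (x : 'rV[R]_n) : set ('rV[R]_n -> R) :=
  [set v | [/\ W1p0_cont p v, `|v x| = 1 & LpN +oo v = 1%E]].

End sobolev.

(* Main.v *)
(** On a cube average, Hölder bounds the mean of |grad v| by
    ||grad v||_p e^(-N/p); moving and shrinking the cube gives Morrey's estimate
    |v(a) - v(b)| <= ||grad v||_p (|a - b| e^(-N/p) + 2 sqrt N e^(1-N/p) / (1-N/p))
    for every e > 0.  Its constant tends to |a - b| + 2 sqrt N e as p -> oo, which,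
    with b on the boundary, yields limsup s_p <= d_Omega; smooth approximations of
    the cone d_Omega(x) - |z - x| give the liminf.  Hence ||grad u_p||_p tends to
    1 / d_Omega(x), the u_p are asymptotically equicontinuous, and an Ascoli
    argument produces u_oo.  To identify its gradient without weak compactness,
    take test functions close to u_oo, with gradient bounds in more and more L^q,
    that nearly minimize the Dirichlet energy: by the parallelogram law their
    gradients converge in L^1, and the limit is a weak gradient G with
    |G| <= 1 / d_Omega(x) by Fatou.  Conversely the averaging estimate shows that
    |G| <= K implies |u_oo(x)| <= K d_Omega(x), so 1 <= K d_Omega(x). *)
Require Import Defs.
From HB Require Import structures.
From mathcomp Require Import all_boot all_order all_algebra.
From mathcomp Require Import all_classical all_reals all_analysis.
From mathcomp Require Import measurable_realfun ring lra.

Set Implicit Arguments.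
Unset Strict Implicit.
Unset Printing Implicit Defensive.

Import Order.TTheory GRing.Theory Num.Theory.
Import numFieldNormedType.Exports.

Local Open Scope classical_set_scope.
Local Open Scope ring_scope.

(** The scale e stays free because taking e comparable to |a - b| puts a constant larger than 1 in
    front of |a - b| and would give only s_p <= C d_Omega; with p sent to infinity before e is sent
    to 0 the coefficient is exactly 1. The factor sqrt N is the Euclidean diameter of the unit cube,
    which bounds the speed of its points under dilation.

    Why near-minimizers: uniform convergence of approximants says nothing about strong convergence
    of their gradients. The classes over which the energy is minimized are stable under midpoints
    and decreasing, so the energy of a midpoint cannot drop much and the parallelogram law leaves
    little for the difference.

    In the converse estimate the approximants F_j need not satisfy |grad F_j| <= K; only the excess
    of |grad F_j| over K tends to 0 in L^1. At a fixed scale its cube average vanishes as j grows,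
    while the ends of the path, which shrink with the scale, are controlled by a bound in L^(N+1)
    uniform in j. Hence j goes to infinity before the scale goes to 0. *)

Section borel_rV.
Context {R : realType} {n : nat}.
Implicit Types (x y : 'rV[R]_n).

(** * Borel sets of R^n and rational boxes *)

Lemma rV_ballP x (e : R) y : 0 < e ->
  ball x e y <-> forall i, `|x ord0 i - y ord0 i| < e.
Proof.
move=> e0; split.
  by move=> [_ h] i; have := h ord0 i.
by move=> h; split=> // i j; rewrite (ord1 i); exact: h.
Qed.

Definition obox (a b : 'rV[R]_n) : set 'rV[R]_n :=
  [set v | forall i, `]a ord0 i, b ord0 i[%classic (v ord0 i)].

Lemma measurable_obox a b : measurable (obox a b).
Proof.
apply: (@measurable_box R n (fun i => `]a ord0 i, b ord0 i[%classic)) => i.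
exact: measurable_itv.
Qed.

Lemma obox_ball x (e : R) : 0 < e ->
  obox (x - const_mx e) (x + const_mx e) = ball x e.
Proof.
move=> e0; apply/seteqP; split => v.
  move=> h; apply/rV_ballP => // i; have := h i.
  by rewrite /= in_itv /= !mxE ltr_distlC.
move/(rV_ballP _ _ e0) => h i; have := h i.
by rewrite /= in_itv /= !mxE ltr_distlC.
Qed.

Definition rbox (c : 'rV[rat]_n * nat) : set 'rV[R]_n :=
  ball (map_mx ratr c.1 : 'rV[R]_n) (c.2.+1%:R^-1).

Definition cbox (a b : 'rV[R]_n) : set 'rV[R]_n :=
  [set v | forall i, a ord0 i <= v ord0 i <= b ord0 i].

Definition crbox (c : 'rV[rat]_n * nat) : set 'rV[R]_n :=
  cbox (map_mx ratr c.1 - const_mx c.2.+1%:R^-1) (map_mx ratr c.1 + const_mx c.2.+1%:R^-1).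

Lemma rboxE c :
  rbox c = obox (map_mx ratr c.1 - const_mx c.2.+1%:R^-1)
                (map_mx ratr c.1 + const_mx c.2.+1%:R^-1).
Proof. by rewrite obox_ball. Qed.

Lemma rbox_sub_crbox c : rbox c `<=` crbox c.
Proof.
by rewrite rboxE => v h i; have := h i; rewrite /= in_itv /= => /andP[/ltW-> /ltW->].
Qed.

(** Rational boxes are a countable base. Asking that the closed box lie in [A] puts each piece of
    the cover in a compact subset of [A], where a locally integrable function is integrable. *)
Lemma open_bigcup_rbox (A : set 'rV[R]_n) : open A ->
  A = \bigcup_(c in [set c | crbox c `<=` A]) rbox c.
Proof.
move=> oA; apply/seteqP; split; last first.
  by move=> v [c /= cA /rbox_sub_crbox cv]; exact: cA.
move=> x Ax; have /nbhs_ballP[e e0 eA] : nbhs x A by exact: open_nbhs_nbhs.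
(* Half of [e]: the centre is within [k.+1%:R^-1] of [x], and the box reaches as far again. *)
have [k ke] : exists k : nat, k.+1%:R^-1 < e / 2.
  have e20 : 0 < e / 2 by rewrite divr_gt0.
  by have [k _ /(_ k (leqnn k))] := near_infty_natSinv_lt (PosNum e20); exists k.
have k0 : 0 < (k.+1%:R^-1 : R) by [].
have /choice[q qP] (i : 'I_n) : exists q : rat, `|ratr q - x ord0 i| < k.+1%:R^-1.
  have : x ord0 i - k.+1%:R^-1 < x ord0 i + k.+1%:R^-1.
    by rewrite ltrD2l gtrN.
  move=> /rat_in_itvoo[q]; rewrite in_itv /= => /andP[h1 h2]; exists q.
  by rewrite distrC ltr_distlC h1 h2.
pose c := (\row_i q i, k) : 'rV[rat]_n * nat.
have cx : rbox c x by apply/rV_ballP => // i; rewrite !mxE.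
exists c => //= y cy; apply: eA; apply/rV_ballP => // i.
have := cy i; have := qP i; rewrite !mxE /= !ltr_norml.
move: ke; move: (k.+1%:R^-1 : R) => r ke /andP[h3 h4] /andP[h1 h2].
by apply/andP; split; lra.
Qed.

Lemma measurable_rbox c : measurable (rbox c).
Proof. by rewrite /rbox -obox_ball//; exact: measurable_obox. Qed.

Lemma open_measurable_rV (A : set 'rV[R]_n) : open A -> measurable A.
Proof.
move=> /open_bigcup_rbox ->; rewrite bigcup_mkcond.
apply: countable_bigcupT_measurable => [|c]; first exact: countableP.
by case: ifP => // _; exact: measurable_rbox.
Qed.

End borel_rV.

Section borel_fun.
Context {R : realType} {n : nat}.

Lemma continuous_in_measurable (D : set 'rV[R]_n) (f : 'rV[R]_n -> R) :
  open D -> {in D, continuous f} -> measurable_fun D f.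
Proof.
move=> oD cf mD; apply: (measurability _ (RGenOpens.measurableE R)) => //.
move=> _ [_ [a [b ->] <-]]; apply: open_measurable_rV.
rewrite openE => x [Dx fx]; rewrite /interior.
apply: filterI; first exact: open_nbhs_nbhs.
apply: (cf x (mem_set Dx)); apply: open_nbhs_nbhs; split=> //.
Qed.

Lemma continuous_measurable_rV (f : 'rV[R]_n -> R) :
  continuous f -> measurable_fun setT f.
Proof. by move=> cf; apply: (continuous_in_measurable openT) => x _; exact: cf. Qed.

Lemma measurable_affine (a : 'rV[R]_n) (s : R) :
  measurable_fun setT (fun h : 'rV[R]_n => a + s *: h).
Proof.
apply: measurable_fun_rV => i; under eq_fun do rewrite !mxE.
apply: measurable_funD => //; apply: measurable_funM => //.
exact: measurable_coord.
Qed.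

End borel_fun.

Lemma measurable_abs d (T : measurableType d) (R : realType) (D : set T) (f : T -> R) :
  measurable_fun D f -> measurable_fun D (fun x => `|f x|).
Proof. by move=> mf; exact: (@measurable_comp _ _ _ _ _ _ setT (@Num.norm R R)). Qed.

(** * Affine changes of variables in Lebesgue integrals *)

Section affine_change.
Context {R : realType}.
Local Open Scope ereal_scope.

(** Uniqueness of Lebesgue measure: [s] times its image under t -> a + s t gives half-open intervals
    their length. *)
Lemma ge0_integral_affine1 (a s : R) (f : R -> \bar R) : (0 < s)%R ->
  measurable_fun [set: measurableTypeR R] f -> (forall t, 0 <= f t) ->
  \int[@lebesgue_measure R]_t f t =
  s%:E * \int[@lebesgue_measure R]_t f (a + s * t)%R.
Proof.
move=> s0 mf f0.
pose phi (t : measurableTypeR R) : measurableTypeR R := (a + s * t)%R.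
have mphi : measurable_fun setT phi.
  by apply: measurable_funD => //; apply: measurable_funM.
pose sn : {nonneg R} := NngNum (ltW s0).
pose m' := mscale sn (pushforward (@lebesgue_measure R) phi).
transitivity (\int[m' mphi]_t f t).
  apply: eq_measure_integral => A mA _.
  apply: (lebesgue_measure_unique (mu := mscale sn (pushforward (@lebesgue_measure R) phi))) => //.
  move=> _ [[b c]] _ <-.
  change (lebesgue_measure `]b, c]%classic =
          s%:E * lebesgue_measure (phi @^-1` `]b, c]%classic)).
  have -> : phi @^-1` `]b, c] = `]((b - a) / s)%R, ((c - a) / s)%R]%classic.
    apply/seteqP; split => t /=; rewrite !in_itv /= /phi ltr_pdivrMr// ler_pdivlMr//;
    by rewrite (mulrC t) ltrBlDl lerBrDl.
  rewrite !lebesgue_measure_itv /= !lte_fin ltr_pM2r ?invr_gt0// ltrD2r.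
  case: ifP => _; last by rewrite mule0.
  by rewrite -!EFinB -EFinM; congr EFin; field; rewrite gt_eqF.
rewrite ge0_integral_mscale//; congr (_ * _).
by rewrite ge0_integral_pushforward.
Qed.

Lemma integral_lebS n (f : 'rV[R]_n.+1 -> \bar R) :
  measurable_fun setT f -> (forall x, 0 <= f x) ->
  \int[leb n.+1]_x f x =
  \int[@lebesgue_measure R]_t \int[leb n]_v f (rV_cons (t, v)).
Proof.
move=> mf f0; rewrite [LHS]ge0_integral_pushforward//; last exact: measurable_rV_cons.
rewrite preimage_setT fubini_tonelli1//.
  by apply: measurableT_comp => //; exact: measurable_rV_cons.
by move=> x; exact: f0.
Qed.

(** Tonelli's theorem peels off one coordinate at a time, each contributing a factor [s]; with s = 1
    this is translation invariance. *)
Lemma ge0_integral_affine n (a : 'rV[R]_n) (s : R) (f : 'rV[R]_n -> \bar R) :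
  (0 < s)%R -> measurable_fun setT f -> (forall x, 0 <= f x) ->
  \int[leb n]_x f x = (s ^+ n)%:E * \int[leb n]_x f (a + s *: x)%R.
Proof.
move=> s0; elim: n a f => [|n IHn] a f mf f0.
  rewrite expr0 mul1e !integral_dirac//=.
    rewrite !diracT !mul1e; congr f; apply/rowP; case => //.
  by apply: measurableT_comp => //; exact: measurable_affine.
pose faff (x : 'rV[R]_n.+1) := f (a + s *: x)%R.
have maff : measurable_fun setT faff.
  by apply: measurableT_comp => //; exact: measurable_affine.
have faff0 x : 0 <= faff x by exact: f0.
rewrite -[X in _ * X]/(\int[leb n.+1]_x faff x) !integral_lebS//.
pose a' : 'rV[R]_n := (\row_i a ord0 (lift ord0 i))%R.
have E t v : faff (rV_cons (t, v)) = f (rV_cons ((a ord0 ord0 + s * t)%R, a' + s *: v))%R.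
  congr f; apply/rowP => i; rewrite !mxE; case: unliftP => [j ->|->] //=.
  by rewrite !mxE.
have mcons (g : 'rV[R]_n.+1 -> \bar R) : measurable_fun setT g ->
    measurable_fun setT (g \o @rV_cons R n).
  by move=> mg; apply: measurableT_comp => //; exact: measurable_rV_cons.
have mft t : measurable_fun setT (fun v => f (rV_cons (t, v))).
  exact: (measurableT_comp (mcons _ mf)).
pose F t := \int[leb n]_v f (rV_cons (t, v)).
have mF : measurable_fun setT F.
  apply: (measurable_fun_fubini_tonelli_F (f \o @rV_cons R n)); first exact: mcons.
  by move=> x; exact: f0.
have F0 t : 0 <= F t by apply: integral_ge0.
rewrite (@ge0_integral_affine1 (a ord0 ord0) s F)//.
rewrite exprS EFinM -muleA; congr (_ * _).
rewrite -ge0_integralZl//.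
- apply: eq_integral => t _; rewrite /F (IHn a')//.
  by congr (_ * _); apply: eq_integral => v _; rewrite E.
- apply: (measurable_fun_fubini_tonelli_F (faff \o @rV_cons R n)); first exact: mcons.
  by move=> x; exact: f0.
- by move=> t _; apply: integral_ge0 => v _; exact: f0.
- by rewrite lee_fin exprn_ge0// ltW.
Qed.

End affine_change.

(** * Lebesgue measure of boxes and Dynkin's lemma for boxes *)

Section leb_facts.
Context {R : realType} {n : nat}.
Implicit Types (a b x y : 'rV[R]_n).

Lemma coord_le_norm x i : `|x ord0 i| <= `|x|.
Proof.
rewrite [leRHS]/Num.norm /= mx_normrE; apply/bigmax_geP; right => /=.
by exists (ord0, i).
Qed.

Lemma norm_le_coord x (M : R) : 0 <= M -> (forall i, `|x ord0 i| <= M) -> `|x| <= M.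
Proof.
move=> M0 h; rewrite [leLHS]/Num.norm /= mx_normrE; apply/bigmax_leP; split=> //.
by move=> [j i] _ /=; rewrite (ord1 j).
Qed.

Lemma bounded_setP (A : set 'rV[R]_n) : bounded_set A ->
  exists2 M : R, 0 < M & forall x, A x -> `|x| < M.
Proof. by move=> /ex_strict_bound_gt0[M M0 h]; exists M. Qed.

Lemma leb_obox a b : (forall i, a ord0 i <= b ord0 i) ->
  leb n (obox a b) = (\prod_(i < n) (b ord0 i - a ord0 i))%:E.
Proof.
move=> ab; rewrite (@leb_box R n (fun i => `]a ord0 i, b ord0 i[%classic)); last first.
  by move=> i; exact: measurable_itv.
rewrite -prodEFin; apply: eq_bigr => i _; rewrite lebesgue_measure_itv /= lte_fin.
have := ab i; rewrite le_eqVlt => /predU1P[->|->] //.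
by rewrite ltxx subrr.
Qed.

Lemma leb_obox_lty a b : (leb n (obox a b) < +oo)%E.
Proof.
have [ab|] := pselect (forall i, a ord0 i <= b ord0 i).
  by rewrite leb_obox// ltry.
move/existsNP => [i /negP]; rewrite -ltNge => ba.
suff -> : obox a b = set0 by rewrite measure0.
rewrite -subset0 => v /(_ i) /=; rewrite in_itv /= => /andP[h1 h2].
by have := lt_trans ba (lt_trans h1 h2); rewrite ltxx.
Qed.

Lemma bounded_sub_obox (A : set 'rV[R]_n) : bounded_set A ->
  exists M : R, A `<=` obox (const_mx (- M)) (const_mx M).
Proof.
move=> /bounded_setP[M M0 AM]; exists M => x /AM xM i.
rewrite /= in_itv /= !mxE -ltr_norml.
exact: le_lt_trans (coord_le_norm x i) xM.
Qed.

Lemma bounded_leb_lty (A : set 'rV[R]_n) : measurable A -> bounded_set A ->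
  (leb n A < +oo)%E.
Proof.
move=> mA /bounded_sub_obox[M AM].
apply: le_lt_trans (leb_obox_lty (const_mx (- M)) (const_mx M)).
by apply: le_measure => //; rewrite inE//; exact: measurable_obox.
Qed.

Lemma open_leb_gt0 (A : set 'rV[R]_n) : open A -> A !=set0 -> (0 < leb n A)%E.
Proof.
move=> oA [x Ax]; have /nbhs_ballP[e /= e0 eA] : nbhs x A by exact: open_nbhs_nbhs.
have : (leb n (ball x e) <= leb n A)%E.
  apply: le_measure => //; rewrite inE; last exact: open_measurable_rV.
  by apply: open_measurable_rV; exact: ball_open.
apply: lt_le_trans; rewrite -obox_ball// leb_obox; last first.
  by move=> i; rewrite !mxE; lra.
rewrite lte_fin prodr_gt0// => i _; rewrite !mxE; lra.
Qed.

(** The cube [a + s *: ucube] has [a] as a corner, not as its centre; what matters to the averages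
    is that [ucube] has measure 1 and that its points have norm at most 1. *)
Definition ucube : set 'rV[R]_n := [set v | forall i, `[0, 1]%classic (v ord0 i)].

Lemma measurable_ucube : measurable ucube.
Proof.
by apply: (@measurable_box R n (fun=> `[0, 1]%classic)) => i; exact: measurable_itv.
Qed.

Lemma leb_ucube : leb n ucube = 1%E.
Proof.
rewrite (@leb_box R n (fun=> `[0, 1]%classic)); last first.
  by move=> i; exact: measurable_itv.
by rewrite big1// => i _; rewrite lebesgue_measure_itv /= lte_fin ltr01 sube0.
Qed.

Lemma leb_ucube_lty : (leb n ucube < +oo)%E.
Proof. by rewrite leb_ucube ltry. Qed.

Lemma leb_ucube_le1 : (leb n ucube <= 1%:E)%E.
Proof. by rewrite leb_ucube. Qed.

Lemma ucube_norm x : ucube x -> `|x| <= 1.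
Proof.
move=> h; apply: norm_le_coord => // i; have := h i.
by rewrite /= in_itv /= => /andP[? ?]; rewrite ger0_norm.
Qed.

Lemma oboxI a b a' b' : obox a b `&` obox a' b' =
  obox (\row_i Num.max (a ord0 i) (a' ord0 i)) (\row_i Num.min (b ord0 i) (b' ord0 i)).
Proof.
apply/seteqP; split => v /=.
  move=> [h h'] i; have := h i; have := h' i; rewrite /= !in_itv /= !mxE.
  by move=> /andP[? ?] /andP[? ?]; rewrite gt_max lt_min; apply/and3P; split=> //; apply/andP.
move=> h; split=> i; have := h i; rewrite /= !in_itv /= !mxE gt_max lt_min.
  by move=> /andP[/andP[-> _] /andP[-> _]].
by move=> /andP[/andP[_ ->] /andP[_ ->]].
Qed.

Definition oboxes : set (set 'rV[R]_n) := [set A | exists a b, A = obox a b].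

(** Open sets are countable unions of rational boxes, and coordinate preimages of open sets are
    open. Boxes thus generate, as Dynkin's lemma requires. *)
Lemma measurable_oboxes : @measurable _ 'rV[R]_n = <<s oboxes >>.
Proof.
apply/seteqP; split; last first.
  apply: smallest_sub; first exact: sigma_algebra_measurable.
  by move=> _ [a [b ->]]; exact: measurable_obox.
have open_s (A : set 'rV[R]_n) : open A -> <<s oboxes >> A.
  move=> /open_bigcup_rbox ->.
  pose T := g_sigma_algebraType oboxes.
  rewrite bigcup_mkcond.
  apply: (@countable_bigcupT_measurable _ T); first exact: countableP.
  move=> c; case: ifP => // _; apply: sub_sigma_algebra; rewrite rboxE.
  by eexists; eexists.
apply: smallest_sub; first exact: smallest_sigma_algebra.
rewrite -bigcup_seq => B [i _ [C mC <-]] /=; rewrite setTI.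
have mC' := mC; rewrite (RGenOpens.measurableE R) in mC'.
pose coord (v : 'rV[R]_n) : R := v ord0 i.
suff : <<s @RGenOpens.G R >> `<=` [set D | <<s oboxes >> (coord @^-1` D)] by move=> /(_ _ mC').
apply: smallest_sub.
  split => /=.
  - by rewrite preimage_set0; exact: (@measurable0 _ (g_sigma_algebraType oboxes)).
  - move=> D mD; rewrite setTD preimage_setC.
    exact: (@measurableC _ (g_sigma_algebraType oboxes)).
  - move=> F mF; rewrite preimage_bigcup.
    exact: (@bigcupT_measurable _ (g_sigma_algebraType oboxes)).
move=> _ [a [b ->]] /=; apply: open_s; apply: open_comp.
  by move=> v _; exact: coord_continuous.
exact: (@interval_open R (BRight a) (BLeft b)).
Qed.

Lemma setI_closed_oboxes : setI_closed oboxes.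
Proof. by move=> _ _ [a [b ->]] [a' [b' ->]]; rewrite oboxI; do 2 eexists. Qed.

(* Dynkin's lemma, applied to the sets on which [f] has integral [0]. *)
Lemma integral_oboxes_ae0 (c d : 'rV[R]_n) (f : 'rV[R]_n -> R) :
  (leb n).-integrable (obox c d) (EFin \o f) ->
  (forall a b, (\int[leb n]_(x in obox a b `&` obox c d) (f x)%:E = 0)%E) ->
  {ae leb n, forall x, obox c d x -> f x = 0}.
Proof.
move=> intf f0; set D := obox c d in intf f0 *.
have mD : measurable D by exact: measurable_obox.
have intfE E : measurable E -> (leb n).-integrable (E `&` D) (EFin \o f).
  move=> mE; apply: integrableS intf => //; exact: measurableI.
have fD : (\int[leb n]_(x in D) (f x)%:E = 0)%E by rewrite -(f0 c d) setIid.
have h E : measurable E -> (\int[leb n]_(x in E `&` D) (f x)%:E = 0)%E.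
  rewrite measurable_oboxes.
  apply: (@dynkin_induction _ _ oboxes (fun E => \int[leb n]_(x in E `&` D) (f x)%:E = 0)%E).
  - exact: measurable_oboxes.
  - exact: setI_closed_oboxes.
  - by rewrite setTI.
  - by move=> _ [a [b ->]]; exact: f0.
  - move=> S mS S0; have := fD.
    rewrite -{1}(setIT D) -(setvU S) setIUr integral_setU.
    + by rewrite setIC => <-; rewrite (setIC D S) S0 adde0.
    + by apply: measurableI => //; exact: measurableC.
    + exact: measurableI.
    + rewrite -setIUr setvU setIT; exact: measurable_int intf.
    + by apply/disj_setPS => x [[_ +] [_ +]].
  - move=> F mF tF F0; rewrite setI_bigcupl integral_bigcup.
    + by rewrite eseries0.
    + exact: trivIset_setIr.
    + by move=> k; exact: measurableI.
    + rewrite -setI_bigcupl; apply: intfE; exact: bigcupT_measurable.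
have [||] := @integral_ae_eq _ _ _ (leb n) D mD (cst 0%E) (EFin \o f) intf.
- by [].
- by move=> E ED mE; rewrite integral0 -(h E mE) setIidl.
move=> N [mN N0 hN]; exists N; split=> // x /= nx; apply: hN => /= hx; apply: nx.
by move=> Dx; apply: EFin_inj; exact: hx.
Qed.

End leb_facts.

(** * Directional derivatives as derivatives of one real variable *)

Section slices.
Context {R : realType} {V : normedModType R}.
Implicit Types (f : V -> R) (x v w : V).

(** Both sides have the same difference quotient; the one-variable chain rule and mean value theorem
    thereby apply to directional derivatives. *)
Lemma is_derive_slice f x v (df : R) :
  is_derive x v f df <-> is_derive (0 : R) 1 (fun t : R => f (x + t *: v)) df.
Proof.
have E : (fun h : R => h^-1 *: ((f \o shift x) (h *: v) - f x)) =
    (fun h : R => h^-1 *: (((fun t : R => f (x + t *: v)) \o shift 0) (h *: (1 : R))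
       - f (x + (0 : R) *: v))).
  apply/funext => h /=; rewrite scale0r !addr0; congr (_ *: (f _ - _)).
  by rewrite addrC [h%:A]mulr1.
split=> -[h1 h2]; split.
- by rewrite /derivable -E.
- by rewrite /derive -E.
- by rewrite /derivable E.
- by rewrite /derive E.
Qed.

Lemma is_derive_slice_at f x v (df : R) (t : R) :
  is_derive (x + t *: v) v f df ->
  is_derive t 1 (fun t : R => f (x + t *: v)) df.
Proof.
move=> /is_derive_slice h.
have -> : (fun t : R => f (x + t *: v)) =
   (fun s : R => f (x + t *: v + s *: v)) \o (fun s => s - t).
  by apply/funext => s /=; congr f; rewrite -addrA -scalerDl (addrC t) subrK.
rewrite -[df]mulr1.
apply: is_derive1_comp; rewrite ?subrr//.
by rewrite -[X in is_derive _ _ _ X]subr0; apply: is_deriveB.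
Qed.

Lemma is_derive_scale f x v (df c : R) :
  is_derive x v f df -> is_derive x (c *: v) f (c * df).
Proof.
move=> /is_derive_slice h; apply/is_derive_slice.
have -> : (fun t : R => f (x + t *: (c *: v))) =
   (fun s : R => f (x + s *: v)) \o (fun s => s * c).
  by apply/funext => s /=; rewrite scalerA.
rewrite mulrC; apply: is_derive1_comp; rewrite ?mul0r//.
rewrite (_ : (fun s => s * c) = c *: (@id R)); last first.
  by apply/funext => s; rewrite mulrC.
by rewrite -[X in is_derive _ _ _ X]mulr1; apply: is_deriveZ.
Qed.

(* The mean value theorem moves the [u]-difference quotient to [x]. *)
Lemma is_derive_add f x u w (du dw : V -> R) :
  {for x, continuous du} -> (forall y, is_derive y u f (du y)) ->
  is_derive x w f (dw x) -> is_derive x (u + w) f (du x + dw x).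
Proof.
move=> cdu hu hw.
suff h : h^-1 *: ((f \o shift x) (h *: (u + w)) - f x) @[h --> 0^'] --> du x + dw x.
  by split; [apply/cvg_ex; exists (du x + dw x)|exact: cvg_lim h].
have [/cvg_ex[l hl] ll] := hw.
have {ll} El : dw x = l by rewrite -ll; exact: cvg_lim hl.
rewrite El.
(* Splits the increment along h (u + w) into one along [w] from [x] and one along [u] from x + h
   w. *)
have -> : (fun h : R => h^-1 *: ((f \o shift x) (h *: (u + w)) - f x)) =
  (fun h : R => h^-1 *: (f (x + h *: w + h *: u) - f (x + h *: w))) \+
  (fun h => h^-1 *: ((f \o shift x) (h *: w) - f x)).
  apply/funext => h /=; rewrite -scalerDr; congr (_ *: _).
  rewrite (addrC (h *: w) x) addrA. rewrite subrK; congr (f _ - _).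
  by rewrite scalerDr addrC (addrC (h *: u)) addrA.
apply: cvgD => //.
apply/cvgrPdist_le => /= e e0.
have /cvgrPdist_le/(_ _ e0) := cdu.
move=> /nbhs_ballP[d /= d0 hd].
(* With this [M], the point x + h w + c u stays within [d] of [x] when |c| <= |h| < d / M; the added
   1 makes it positive. *)
pose M := `|u| + `|w| + 1.
have M0 : 0 < M by rewrite ltr_wpDl// addr_ge0.
near=> h.
have h0 : h != 0 by near: h; exact: nbhs_dnbhs_neq.
have hd' : `|h| < d / M.
  near: h; apply/nbhs_ballP; exists (d / M); first exact: divr_gt0.
  by move=> y /=; rewrite /ball /= sub0r normrN.
pose g (s : R) := f (x + h *: w + s *: u).
have dg (s : R) : is_derive s 1 g (du (x + h *: w + s *: u)).
  exact: is_derive_slice_at.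
have cg : continuous g.
  move=> s; apply: differentiable_continuous; apply/derivable1_diffP.
  by have [] := dg s.
have [c ch Eg] : exists2 c : R, `|c| <= `|h| &
    g h - g 0 = du (x + h *: w + c *: u) * h.
  have [h_ge0|h_lt0] := leP 0 h.
    have [c] := @MVT_segment R g (fun s => du (x + h *: w + s *: u)) 0 h h_ge0
      (fun s _ => dg s) (continuous_subspaceT cg).
    rewrite in_itv /= => /andP[c0 ch] E; exists c; last by rewrite E subr0.
    by rewrite !ger0_norm.
  have [c] := @MVT_segment R g (fun s => du (x + h *: w + s *: u)) h 0 (ltW h_lt0)
    (fun s _ => dg s) (continuous_subspaceT cg).
  rewrite in_itv /= => /andP[ch c0] E; exists c.
    by rewrite ler0_norm// ltr0_norm// lerN2.
  by rewrite -opprB E sub0r mulrN opprK.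
have -> : f (x + h *: w + h *: u) - f (x + h *: w) = g h - g 0.
  by rewrite /g scale0r addr0.
rewrite Eg [X in _ - X]mulrC mulfK//.
apply: hd; rewrite -ball_normE /= -addrA opprD addrA subrr sub0r normrN.
apply: le_lt_trans (ler_normD _ _) _; rewrite !normrZ.
apply: (@le_lt_trans _ _ (`|h| * M)); last by rewrite -ltr_pdivlMr.
rewrite /M 2!mulrDr mulr1 addrC -addrA lerD ?ler_wpM2r//.
by rewrite lerDl.
Unshelve. all: by end_near. Qed.

End slices.

(** * Closure properties of C^k functions *)

Section smooth_closure.
Context {R : realType} {n : nat}.
Implicit Types (f g : 'rV[R]_n -> R) (k : nat).

Local Notation e_ i := (delta_mx ord0 i : 'rV[R]_n).

(** [smooth] speaks of all iterated partials at once; unfolding one derivative at a time turns sums,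
    products, inverses and compositions into inductions on the order [k]. *)
Fixpoint ck k f : Prop := continuous f /\
  if k is k'.+1 then
    (forall (i : 'I_n) x, derivable f x (e_ i)) /\ forall i, ck k' (partial i f)
  else True.

Lemma ck_continuous k f : ck k f -> continuous f.
Proof. by case: k => [|k] []. Qed.

Lemma ck_is_derive k f i x : ck k.+1 f -> is_derive x (e_ i) f (partial i f x).
Proof. by move=> [_ [df _]]; exact: derivableP. Qed.

Lemma ck_partial k f i : ck k.+1 f -> ck k (partial i f).
Proof. by case=> _ [_]; apply. Qed.

Lemma ckW k f : ck k.+1 f -> ck k f.
Proof.
elim: k f => [|k IHk] f; first by case.
move=> [cf [df pf]]; split=> //; split=> // i; exact: IHk.
Qed.

(** [foldr] applies the last index of the list first, so peeling with [rcons] matches the recursion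
    of [ck]. *)
Lemma smoothP f : smooth f <-> forall k, ck k f.
Proof.
split.
  move=> sf k; elim: k f sf => [|k IHk] f sf; first by split=> //; exact: (sf [::]).1.
  split; first exact: (sf [::]).1.
  split; first exact: (sf [::]).2.
  by move=> i; apply: IHk => s; have := sf (rcons s i); rewrite /iter_partial foldr_rcons.
move=> cf s; elim/last_ind: s f cf => [|s i IHs] f cf.
  by split; [exact: (cf 0).1|exact: (cf 1).2.1].
rewrite /iter_partial foldr_rcons; apply: IHs => k; exact: (ck_partial i (cf k.+1)).
Qed.

Lemma ckS k f (df : 'I_n -> 'rV[R]_n -> R) : continuous f ->
  (forall i x, is_derive x (e_ i) f (df i x)) -> (forall i, ck k (df i)) -> ck k.+1 f.
Proof.
move=> cf h hdf; split=> //; split=> [i x|i]; first by have [] := h i x.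
rewrite (_ : partial i f = df i)//; apply/funext => x.
by have [_] := h i x.
Qed.

Lemma ck_cst k (c : R) : ck k (fun=> c).
Proof.
elim: k c => [|k IHk] c; first by split=> //; exact: cst_continuous.
have h (i : 'I_n) x : is_derive x (e_ i) (fun=> c) 0 by exact: is_derive_cst.
by apply: (@ckS _ _ (fun _ _ => 0) _ h (fun=> IHk 0)); exact: cst_continuous.
Qed.

Lemma ck_coord k (j : 'I_n) : ck k (fun x => x ord0 j).
Proof.
case: k => [|k]; first by split=> // x; exact: coord_continuous.
apply: (@ckS _ _ (fun i _ => (i == j)%:R)); first by move=> x; exact: coord_continuous.
  move=> i x; apply/is_derive_slice.
  rewrite (_ : (fun _ => _) = cst (x ord0 j) + (i == j)%:R *: (@id R)); last first.
    by apply/funext => t; rewrite !mxE eqxx /= mulrC (eq_sym j) !fctE.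
  rewrite -[X in is_derive _ _ _ X]add0r -[X in is_derive _ _ _ (_ + X)]mulr1.
  by apply: is_deriveD; apply: is_deriveZ.
by move=> i; exact: ck_cst.
Qed.

Lemma ckD k f g : ck k f -> ck k g -> ck k (fun x => f x + g x).
Proof.
elim: k f g => [|k IHk] f g cf cg.
  by split=> // x; exact: (continuousD (cf.1 x) (cg.1 x)).
apply: (@ckS _ _ (fun i x => partial i f x + partial i g x)).
- by move=> x; exact: (continuousD (cf.1 x) (cg.1 x)).
- by move=> i x; exact: (is_deriveD (ck_is_derive i x cf) (ck_is_derive i x cg)).
- by move=> i; apply: IHk; exact: ck_partial.
Qed.

Lemma ckM k f g : ck k f -> ck k g -> ck k (fun x => f x * g x).
Proof.
elim: k f g => [|k IHk] f g cf cg.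
  by split=> // x; exact: (continuousM (cf.1 x) (cg.1 x)).
apply: (@ckS _ _ (fun i x => f x * partial i g x + g x * partial i f x)).
- by move=> x; exact: (continuousM (cf.1 x) (cg.1 x)).
- by move=> i x; exact: (is_deriveM (ck_is_derive i x cf) (ck_is_derive i x cg)).
- by move=> i; apply: ckD; apply: IHk; (exact: ckW || exact: ck_partial).
Qed.

Lemma ckZ k (c : R) f : ck k f -> ck k (fun x => c * f x).
Proof. by apply: ckM; exact: ck_cst. Qed.

Lemma ckB k f g : ck k f -> ck k g -> ck k (fun x => f x - g x).
Proof.
move=> cf /(ckZ (-1)) cg.
rewrite (_ : (fun x => _) = (fun x => f x + -1 * g x)); first exact: ckD.
by apply/funext => x; rewrite mulN1r.
Qed.

Lemma ck_sum k (I : Type) (s : seq I) (f : I -> 'rV[R]_n -> R) :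
  (forall i, ck k (f i)) -> ck k (fun x => \sum_(i <- s) f i x).
Proof.
move=> cf; elim: s => [|i s IHs].
  by under eq_fun do rewrite big_nil; exact: ck_cst.
by under eq_fun do rewrite big_cons; exact: ckD.
Qed.

Lemma ck_prod k (I : Type) (s : seq I) (f : I -> 'rV[R]_n -> R) :
  (forall i, ck k (f i)) -> ck k (fun x => \prod_(i <- s) f i x).
Proof.
move=> cf; elim: s => [|i s IHs].
  by under eq_fun do rewrite big_nil; exact: ck_cst.
by under eq_fun do rewrite big_cons; exact: ckM.
Qed.

Lemma is_derive_comp (h : R -> R) (dh df : R) f x v :
  is_derive x v f df -> is_derive (f x) 1 h dh -> is_derive x v (h \o f) (dh * df).
Proof.
move=> /is_derive_slice hf hh; apply/is_derive_slice.
apply: (@is_derive1_comp _ h (fun t => f (x + t *: v))) => //.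
by rewrite scale0r addr0.
Qed.

(** The derivative is a product of copies of 1 / f and a partial of [f], so regularity of 1 / f one
    order below suffices. *)
Lemma ckV k f : (forall x, f x != 0) -> ck k f -> ck k (fun x => (f x)^-1).
Proof.
move=> f0; elim: k f f0 => [|k IHk] f f0 cf.
  by split=> // x; exact: (continuousV (f0 x) (cf.1 x)).
have ckVf := IHk _ f0 (ckW cf).
apply: (@ckS _ _ (fun i x => -1 * ((f x)^-1 * (f x)^-1 * partial i f x))).
- by move=> x; exact: (continuousV (f0 x) (cf.1 x)).
- move=> i x; have [df Ef] := ck_is_derive i x cf; apply: DeriveDef.
    exact: derivableV.
  by rewrite deriveV// Ef -exprVn expr2 mulN1r /GRing.scale /= mulNr.
- by move=> i; apply: ckZ; apply: ckM; [exact: ckM|exact: (ck_partial i cf)].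
Qed.

Lemma ck_sqrt k f : (forall x, 0 < f x) -> ck k f -> ck k (fun x => Num.sqrt (f x)).
Proof.
move=> f0; elim: k f f0 => [|k IHk] f f0 cf.
  split=> // x; apply: (@continuous_comp _ _ _ f Num.sqrt); first exact: (cf.1 x).
  exact: sqrt_continuous.
have s0 x : 2 * Num.sqrt (f x) != 0 by rewrite mulf_neq0// gt_eqF// sqrtr_gt0.
apply: (@ckS _ _ (fun i x => (2 * Num.sqrt (f x))^-1 * partial i f x)).
- move=> x; apply: (@continuous_comp _ _ _ f Num.sqrt); first exact: (cf.1 x).
  exact: sqrt_continuous.
- move=> i x; apply: is_derive_comp; first exact: (ck_is_derive i x cf).
  exact: is_derive1_sqrt.
- move=> i; apply: ckM; last exact: (ck_partial i cf).
  by apply: ckV => //; apply: ckZ; apply: IHk => //; exact: ckW.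
Qed.

End smooth_closure.

(** * The flat function exp (-1 / t) *)

Section flat.
Context {R : realType}.

(* [flat 0] is the usual flat function; the factors [t ^- m] make the family
   closed under derivation. *)
Definition flat (m : nat) (t : R) : R :=
  if 0 < t then t ^- m * expR (- t^-1) else 0.

(** The exponential series gives exp (1 / t) >= t^-(m + 2) / (m + 2)!. Quadratic decay, whatever
    [m], is what makes the derivative at 0 vanish. *)
Lemma flat_bound m : exists2 C : R, 0 <= C & forall t, `|flat m t| <= C * t ^+ 2.
Proof.
exists (m.+2`!%:R) => // t; rewrite /flat; case: ifPn => [t0|_]; last first.
  by rewrite normr0 mulr_ge0// sqr_ge0.
rewrite ger0_norm; last by rewrite mulr_ge0 ?expR_ge0// invr_ge0 exprn_ge0// ltW.
have s0 : 0 <= t^-1 by rewrite invr_ge0 ltW.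
have := @expR_ge1Dxn R t^-1 m.+1 s0 => h.
have {}h : t^-1 ^+ m.+2 / m.+2`!%:R <= expR t^-1.
  by apply: le_trans h; rewrite lerDr.
rewrite expRN ler_pdivrMr ?expR_gt0//.
have F0 : 0 < m.+2`!%:R :> R by rewrite ltr0n fact_gt0.
rewrite ler_pdivrMr// in h.
rewrite -exprVn -ler_pdivrMl; last by rewrite mulr_gt0// exprn_gt0.
rewrite invfM -mulrA -exprVn -exprD addnC addn2 ler_pdivrMl//.
by rewrite mulrC.
Qed.

Lemma flat_derive m (t : R) : is_derive t 1 (flat m) (flat m.+2 t - m%:R * flat m.+1 t).
Proof.
have [t0|t0|<-] := ltgtP 0 t.
- have near_flat : \forall s \near t, s ^- m * expR (- s^-1) = flat m s.
    near=> s; rewrite /flat ifT//; near: s; exact: lt_nbhsr.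
  apply: (near_eq_is_derive near_flat).
  have tn0 : t != 0 by rewrite gt_eqF.
  have dV : is_derive t 1 (fun s : R => s^-1) (- t ^- 2).
    by split; [exact: derivableV|rewrite deriveV// derive_id [LHS]mulr1].
  have d1 : is_derive t 1 (fun s : R => expR (- s^-1)) (expR (- t^-1) * t ^- 2).
    apply: (@is_derive1_comp _ expR (fun s => - s^-1)).
    by rewrite -[X in is_derive _ _ _ X]opprK; apply: is_deriveN.
  have d2 : is_derive t 1 (fun s : R => s ^- m) (- (m%:R * t ^- m.+1)).
    have -> : (fun s : R => s ^- m) = (fun s : R => s^-1) ^+ m.
      by rewrite exprfctE; apply/funext => s; rewrite exprVn.
    have -> : - (m%:R * t ^- m.+1) = (m%:R * (t^-1) ^+ m.-1) *: (- t ^- 2).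
      rewrite /GRing.scale /= mulrN; congr (- _).
      case: (m) => [|j] /=; first by rewrite !mul0r.
      by rewrite -mulrA -!exprVn -exprD addn2.
    exact: is_deriveX.
  rewrite (_ : flat m.+2 t - _ = t ^- m *: (expR (- t^-1) * t ^- 2) +
    expR (- t^-1) *: (- (m%:R * t ^- m.+1))); first exact: is_deriveM.
  rewrite /flat t0 /GRing.scale /=.
  have -> : t ^- m.+2 = t ^- m * t ^- 2 by rewrite -!exprVn -exprD addn2.
  by move: (t ^- m) (t ^- 2) (t ^- m.+1) (expR _) => *; ring.
- have near_flat : \forall s \near t, 0 = flat m s.
    near=> s; rewrite /flat ifN//; rewrite -leNgt ltW//; near: s; exact: lt_nbhsl.
  apply: (near_eq_is_derive near_flat).
  rewrite /flat !ifN -?leNgt ?ltW// mulr0 subr0; exact: is_derive_cst.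
rewrite {2 3}/flat ltxx mulr0 subr0.
suff h : h^-1 *: ((flat m \o shift 0) (h *: (1:R)) - flat m 0) @[h --> 0^'] --> (0:R).
  by split; [apply/cvg_ex; exists 0|exact: cvg_lim h].
have [C C0 hC] := flat_bound m.
apply/cvgrPdist_le => /= e e0.
have C1 : 0 < C + 1 by rewrite ltr_wpDl.
near=> h.
have h0 : h != 0 by near: h; exact: nbhs_dnbhs_neq.
have hd : `|h| < e / (C + 1).
  near: h; apply/nbhs_ballP; exists (e / (C + 1)); first exact: divr_gt0.
  by move=> y /=; rewrite /ball /= sub0r normrN.
rewrite sub0r normrN addr0 [h%:A]mulr1 {2}/flat ltxx subr0 normrM normfV.
rewrite ler_pdivrMl ?normr_gt0//.
apply: le_trans (hC h) _; rewrite -(real_normK (num_real h)) expr2 mulrA.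
rewrite [leRHS]mulrC ler_wpM2r//.
rewrite ltr_pdivlMr// in hd; apply: le_trans (ltW hd).
by rewrite mulrC ler_wpM2l// lerDl.
Unshelve. all: by end_near. Qed.

Lemma flat_continuous m : continuous (flat m).
Proof.
move=> t; apply: differentiable_continuous; apply/derivable1_diffP.
by have [] := flat_derive m t.
Qed.

Lemma ck_flat n k m (f : 'rV[R]_n -> R) : ck k f -> ck k (fun x => flat m (f x)).
Proof.
elim: k m f => [|k IHk] m f cf.
  split=> // x; apply: (@continuous_comp _ _ _ f (flat m)); first exact: (cf.1 x).
  exact: flat_continuous.
apply: (@ckS _ _ _ _ (fun i x => (flat m.+2 (f x) - m%:R * flat m.+1 (f x)) * partial i f x)).
- move=> x; apply: (@continuous_comp _ _ _ f (flat m)); first exact: (cf.1 x).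
  exact: flat_continuous.
- move=> i x; apply: is_derive_comp; first exact: (ck_is_derive i x cf).
  exact: flat_derive.
- move=> i; apply: ckM; last exact: (ck_partial i cf).
  by apply: ckB; [|apply: ckZ]; apply: IHk; exact: ckW.
Qed.

End flat.

(** * The Euclidean norm *)

Section enorm_facts.
Context {R : realType} {n : nat}.
Implicit Types (x y u w : 'rV[R]_n).

Lemma enorm_ge0 x : 0 <= enorm x. Proof. exact: sqrtr_ge0. Qed.

Lemma enorm_sqr x : enorm x ^+ 2 = \sum_i x ord0 i ^+ 2.
Proof. by rewrite sqr_sqrtr// sumr_ge0// => i _; exact: sqr_ge0. Qed.

Lemma enorm0 : enorm (0 : 'rV[R]_n) = 0.
Proof. by rewrite /enorm big1 ?sqrtr0// => i _; rewrite mxE expr0n. Qed.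

Lemma enormZ (c : R) x : enorm (c *: x) = `|c| * enorm x.
Proof.
rewrite /enorm -sqrtr_sqr -sqrtrM ?sqr_ge0// mulr_sumr; congr Num.sqrt.
by apply: eq_bigr => i _; rewrite mxE exprMn.
Qed.

Lemma enormN x : enorm (- x) = enorm x.
Proof. by rewrite -scaleN1r enormZ normrN1 mul1r. Qed.

Lemma enormC x y : enorm (x - y) = enorm (y - x).
Proof. by rewrite -enormN opprB. Qed.

Lemma coord_le_enorm x i : `|x ord0 i| <= enorm x.
Proof.
rewrite -sqrtr_sqr ler_wsqrtr// (bigD1 i)//= lerDl sumr_ge0// => j _.
exact: sqr_ge0.
Qed.

Lemma enorm_eq0 x : enorm x = 0 -> x = 0.
Proof.
move=> x0; apply/rowP => i; rewrite mxE; apply/eqP; rewrite -normr_le0 -x0.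
exact: coord_le_enorm.
Qed.

(** Termwise, |u_i w_i| <= ((b / a) u_i^2 + (a / b) w_i^2) / 2 with a = |u| and b = |w|; these
    weights make the right sides sum to a b. *)
Lemma cauchy_schwarz u w : `|\sum_i u ord0 i * w ord0 i| <= enorm u * enorm w.
Proof.
have [u0|u0] := eqVneq (enorm u) 0.
  rewrite (enorm_eq0 u0) big1 ?normr0 ?mulr_ge0 ?enorm_ge0// => i _.
  by rewrite mxE mul0r.
have [w0|w0] := eqVneq (enorm w) 0.
  rewrite (enorm_eq0 w0) big1 ?normr0 ?mulr_ge0 ?enorm_ge0// => i _.
  by rewrite mxE mulr0.
have a0 : 0 < enorm u by rewrite lt_neqAle eq_sym u0 enorm_ge0.
have b0 : 0 < enorm w by rewrite lt_neqAle eq_sym w0 enorm_ge0.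
apply: le_trans (ler_norm_sum _ _ _) _.
set a := enorm u in a0 *; set b := enorm w in b0 *.
have -> : a * b = \sum_i (b / a * u ord0 i ^+ 2 + a / b * w ord0 i ^+ 2) / 2.
  rewrite -mulr_suml big_split /= -!mulr_sumr -!enorm_sqr -/a -/b.
  by field; rewrite !gt_eqF.
apply: ler_sum => i _; rewrite normrM.
rewrite -(real_normK (num_real (u ord0 i))) -(real_normK (num_real (w ord0 i))).
move: `|u _ _| `|w _ _| => s t.
rewrite ler_pdivlMr// -subr_ge0.
have -> : b / a * s ^+ 2 + a / b * t ^+ 2 - s * t * 2 = (b * s - a * t) ^+ 2 / (a * b).
  by field; rewrite !gt_eqF.
by rewrite divr_ge0 ?sqr_ge0// mulr_ge0// ltW.
Qed.

Lemma enormD x y : enorm (x + y) <= enorm x + enorm y.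
Proof.
rewrite -(@ler_pXn2r _ 2)// ?nnegrE ?enorm_ge0 ?addr_ge0 ?enorm_ge0//.
rewrite sqrrD !enorm_sqr.
have -> : \sum_i (x + y) ord0 i ^+ 2 =
    \sum_i x ord0 i ^+ 2 + (\sum_i x ord0 i * y ord0 i) *+ 2 + \sum_i y ord0 i ^+ 2.
  rewrite -sumrMnl -!big_split /=; apply: eq_bigr => i _.
  by rewrite mxE sqrrD.
rewrite lerD2r lerD2l lerMn2r /=; exact: le_trans (ler_norm _) (cauchy_schwarz _ _).
Qed.

Lemma enorm_le_sum x : enorm x <= \sum_i `|x ord0 i|.
Proof.
rewrite -[leRHS]ger0_norm ?sumr_ge0// -sqrtr_sqr ler_wsqrtr//.
rewrite expr2 mulr_suml ler_sum// => i _.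
rewrite -(real_normK (num_real _)) expr2 ler_wpM2l//.
by rewrite (bigD1 i)//= lerDl sumr_ge0.
Qed.

Lemma norm_le_enorm x : `|x| <= enorm x.
Proof.
rewrite [leLHS]/Num.norm /= mx_normrE; apply/bigmax_leP; split; first exact: enorm_ge0.
by move=> [j i] _ /=; rewrite (ord1 j) coord_le_enorm.
Qed.

Lemma enorm_le_norm x : enorm x <= Num.sqrt n%:R * `|x|.
Proof.
rewrite -[`|x|]ger0_norm// -sqrtr_sqr -sqrtrM// ler_wsqrtr//.
have -> : n%:R * `|x| ^+ 2 = \sum_(i < n) `|x| ^+ 2.
  by rewrite sumr_const card_ord mulr_natl.
apply: ler_sum => i _; rewrite -(real_normK (num_real (x ord0 i))).
rewrite ler_sqr ?nnegrE// [leRHS]/Num.norm /= mx_normrE.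
by apply/bigmax_geP; right => /=; exists (ord0, i).
Qed.

Lemma enorm_continuous : continuous (@enorm R n).
Proof.
move=> x; apply: (@continuous_comp _ _ _ (fun v : 'rV[R]_n => \sum_i v ord0 i ^+ 2) Num.sqrt).
  apply: (ck_continuous (k := 0)); apply: ck_sum => i.
  by under eq_fun do rewrite expr2; apply: ckM; exact: ck_coord.
exact: sqrt_continuous.
Qed.

End enorm_facts.

(** * The classical gradient *)

Section gradient.
Context {R : realType} {n : nat}.
Implicit Types (v : 'rV[R]_n -> R) (x w : 'rV[R]_n).

(** The classical counterpart of [grad], which is a weak gradient selected by choice; for test
    functions the two agree almost everywhere on [Omega]. *)
Definition cgrad v x : 'rV[R]_n := \row_i partial i v x.

(** Continuity of the partials gives every directional derivative: the components of [w] are added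
    one at a time by [is_derive_add]. *)
Lemma is_derive_cgrad v x w : ck 1 v ->
  is_derive x w v (\sum_i w ord0 i * cgrad v x ord0 i).
Proof.
move=> cv.
rewrite [X in is_derive _ X](row_sum_delta w).
rewrite (_ : (\sum_i w ord0 i * _) = \sum_(i <- index_enum 'I_n) w ord0 i * partial i v x); last first.
  by apply: eq_bigr => i _; rewrite mxE.
elim: (index_enum _) x => [|i s IHs] x.
  by rewrite !big_nil; exact: is_derive0.
rewrite !big_cons.
apply: (@is_derive_add _ _ v x _ _ (fun x => w ord0 i * partial i v x)
  (fun x => \sum_(j <- s) w ord0 j * partial j v x)) => //.
  have [_ [_ /(_ i)[c _]]] := cv.
  by apply: continuousM; [exact: cst_continuous|exact: c].
by move=> y; apply: is_derive_scale; exact: (ck_is_derive i y cv).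
Qed.

Lemma cgrad_continuous v : ck 1 v -> continuous (fun x => enorm (cgrad v x)).
Proof.
move=> cv x.
apply: (@continuous_comp _ _ _ (fun x => \sum_i cgrad v x ord0 i ^+ 2) Num.sqrt).
  apply: (ck_continuous (k := 0)); apply: ck_sum => i.
  rewrite (_ : (fun _ => _) = fun y => partial i v y * partial i v y).
    by apply: ckM; exact: (ck_partial i cv).
  by apply/funext => y; rewrite mxE expr2.
exact: sqrt_continuous.
Qed.

Lemma cgradB v (w : _ -> R) x : ck 1 v -> ck 1 w ->
  cgrad (fun y => v y - w y) x = cgrad v x - cgrad w x.
Proof.
move=> cv cw; apply/rowP => i; rewrite !mxE.
have [_ <-] := is_deriveB (ck_is_derive i x cv) (ck_is_derive i x cw).
by [].
Qed.

Lemma cgradD v (w : _ -> R) x : ck 1 v -> ck 1 w ->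
  cgrad (fun y => v y + w y) x = cgrad v x + cgrad w x.
Proof.
move=> cv cw; apply/rowP => i; rewrite !mxE.
have [_ <-] := is_deriveD (ck_is_derive i x cv) (ck_is_derive i x cw).
by [].
Qed.

Lemma cgradZ (c : R) v x : ck 1 v -> cgrad (fun y => c * v y) x = c *: cgrad v x.
Proof.
move=> cv; apply/rowP => i; rewrite !mxE.
by have [_ E] := is_deriveZ c (ck_is_derive i x cv); exact: E.
Qed.

End gradient.

(** * Comparison of moments *)

Section power_mean.
Context d (T : measurableType d) (R : realType) (mu : {measure set T -> \bar R}).

(** As a function of x^p, the power x^q is concave and lies below its tangent at x = M. After
    division by [M] this is Young's inequality for the product of y^q and 1, with exponents p / q
    and 1 / (1 - q / p). *)
Lemma powR_le_young (x M p q : R) : 0 <= x -> 0 < M -> 0 < q -> q <= p ->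
  x `^ q <= M `^ q * (1 - q / p) + (q / p) * M `^ (q - p) * x `^ p.
Proof.
move=> x0 M0 q0 qp; have p0 : 0 < p := lt_le_trans q0 qp.
set y := x / M.
have y0 : 0 <= y by rewrite divr_ge0// ltW.
have -> : x = M * y by rewrite /y mulrCA divff ?mulr1// gt_eqF.
rewrite (powRM _ (ltW M0) y0) (powRM _ (ltW M0) y0).
have -> : q / p * M `^ (q - p) * (M `^ p * y `^ p) = M `^ q * (q / p * y `^ p).
  rewrite (_ : M `^ q = M `^ (q - p) * M `^ p); first by ring.
  by rewrite -powRD ?subrK//; apply/implyP => _; rewrite gt_eqF.
rewrite -mulrDr ler_wpM2l ?powR_ge0//.
(* For q = p the conjugate exponent would be infinite. *)
move: qp; rewrite le_eqVlt => /predU1P[<-|qp].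
  by rewrite divff ?gt_eqF// subrr add0r mul1r.
have r0 : 0 < p / q by rewrite divr_gt0.
have s0 : 0 < (1 - q / p)^-1 by rewrite invr_gt0 subr_gt0 ltr_pdivrMr// mul1r.
have e1 : (p / q)^-1 + ((1 - q / p)^-1)^-1 = 1 by rewrite invrK invf_div addrC subrK.
have := conjugate_powR (powR_ge0 y q) ler01 r0 s0 e1.
rewrite mulr1 powR1 mul1r invrK invf_div -powRrM (_ : q * (p / q) = p).
  by rewrite addrC (mulrC (q / p)).
by rewrite mulrCA divff ?mulr1// gt_eqF.
Qed.

(* Young's inequality, used here in place of Hölder's. *)
Lemma power_mean (D : set T) (f : T -> R) (m M p q : R) :
  measurable D -> (mu D <= m%:E)%E -> measurable_fun D f ->
  (forall x, D x -> 0 <= f x) -> 0 < M -> 0 < q -> q <= p ->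
  (\int[mu]_(x in D) (f x `^ p)%:E <= (m * M `^ p)%:E)%E ->
  (\int[mu]_(x in D) (f x `^ q)%:E <= (m * M `^ q)%:E)%E.
Proof.
move=> mD Dm mf f0 M0 q0 qp h.
have p0 : 0 < p := lt_le_trans q0 qp.
have mfp r : measurable_fun D (fun x => (f x `^ r)%:E).
  apply/measurable_EFinP.
  exact: (@measurable_comp _ _ _ _ _ _ setT (@powR R ^~ r)).
(* Coefficients of the tangent; applied to total mass m and p-th moment m M^p they recombine to
   exactly m M^q. *)
set A := M `^ q * (1 - q / p); set B := (q / p) * M `^ (q - p).
have A0 : 0 <= A.
  by rewrite mulr_ge0 ?powR_ge0// subr_ge0 ler_pdivrMr// mul1r.
have B0 : 0 <= B by rewrite mulr_ge0 ?powR_ge0// divr_ge0 ?ltW.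
apply: (@le_trans _ _ (\int[mu]_(x in D) (A%:E + B%:E * (f x `^ p)%:E))%E).
  apply: ge0_le_integral => //.
  - by move=> x _; rewrite lee_fin powR_ge0.
  - by apply: emeasurable_funD => //; apply: emeasurable_funM.
  - move=> x Dx; rewrite -EFinM -EFinD lee_fin.
    exact: powR_le_young (f0 _ Dx) M0 q0 qp.
rewrite ge0_integralD//; last 2 first.
- by move=> x _; rewrite -EFinM lee_fin mulr_ge0// powR_ge0.
- exact: emeasurable_funM.
rewrite integral_cst// ge0_integralZl_EFin//; last first.
  by move=> x _; rewrite lee_fin powR_ge0.
apply: (@le_trans _ _ (A%:E * m%:E + B%:E * (m * M `^ p)%:E)%E).
  by apply: leeD; apply: lee_wpmul2l; rewrite ?lee_fin.
rewrite -!EFinM -EFinD lee_fin /A /B.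
rewrite (_ : M `^ q = M `^ (q - p) * M `^ p); last first.
  by rewrite -powRD ?subrK//; apply/implyP => _; rewrite gt_eqF.
by rewrite le_eqVlt; apply/orP; left; apply/eqP; field; rewrite gt_eqF.
Qed.

End power_mean.

(** * Averages over moving and shrinking cubes *)

Section averages.
Context {R : realType} {n : nat}.
Implicit Types (a b c x h : 'rV[R]_n).
Variables (v : 'rV[R]_n -> R) (B : R).
Hypothesis cv : ck 1 v.
Hypothesis vB : forall x, `|v x| <= B.
Hypothesis gB : forall x, enorm (cgrad v x) <= B.

Local Notation mu := (leb n).

Lemma continuous_ucube_integrable (f : 'rV[R]_n -> R) (K : R) : continuous f ->
  (forall h, ucube h -> `|f h| <= K) -> mu.-integrable ucube (EFin \o f).
Proof.
move=> cf fK; apply: measurable_bounded_integrable.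
- exact: measurable_ucube.
- exact: leb_ucube_lty.
- by apply: measurable_funTS; exact: continuous_measurable_rV.
- exists K; split; first exact: num_real.
  by move=> r Kr h hc /=; apply: le_trans (fK h hc) (ltW Kr).
Qed.

Lemma affine_continuous c (s : R) : continuous (fun h : 'rV[R]_n => c + s *: h).
Proof.
move=> h; apply: (@continuousD _ _ _ (fun=> c) (fun h => s *: h)).
  exact: cst_continuous.
exact: scaler_continuous.
Qed.

Lemma comp_affine_continuous (f : 'rV[R]_n -> R) c (s : R) : continuous f ->
  continuous (fun h : 'rV[R]_n => f (c + s *: h)).
Proof.
move=> cf h; apply: (@continuous_comp _ _ _ (fun h => c + s *: h) f).
  exact: affine_continuous.
exact: cf.
Qed.

Definition avg a (s : R) : R := \int[mu]_(h in ucube) v (a + s *: h).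

Lemma avg0 a : avg a 0 = v a.
Proof.
rewrite /avg; under eq_Rintegral => h _ do rewrite scale0r addr0.
rewrite Rintegral_cst; last exact: measurable_ucube.
by rewrite (_ : _ ucube = 1%E) ?mulr1//; exact: leb_ucube.
Qed.

Section derivative.
Variables (c b : 'rV[R]_n) (s0 s1 : R).

Let w h := b + s1 *: h.
Let y (t : R) h := c + s0 *: h + t *: w h.
Let f (t : R) h := v (y t h).
Let df (t : R) h := \sum_i w h ord0 i * cgrad v (y t h) ord0 i.

Let is_derive_f (t : R) h : is_derive t 1 (f ^~ h) (df t h).
Proof. by apply: is_derive_slice_at; exact: is_derive_cgrad. Qed.

Let yE t h : y t h = (c + t *: b) + (s0 + t * s1) *: h.
Proof. by rewrite /y /w scalerDr scalerA addrACA -scalerDl. Qed.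

Let df_bound t h : `|df t h| <= enorm (w h) * enorm (cgrad v (y t h)).
Proof. exact: cauchy_schwarz. Qed.

(* Covers both motions of the cube: translation ([s1 = 0]) and dilation ([b = 0]). *)
Definition pavg (t : R) : R :=
  \int[mu]_(h in ucube) v (c + s0 *: h + t *: (b + s1 *: h)).

(** Differentiation under the integral. The crude bound [B] serves only for domination; the
    derivative is bounded by the speed [W] of the points times the mean of |grad v|. *)
Lemma is_derive_pavg (t : R) (W M : R) : 0 <= W ->
  (forall h, ucube h -> enorm (b + s1 *: h) <= W) ->
  (\int[mu]_(h in ucube) (enorm (cgrad v (c + s0 *: h + t *: (b + s1 *: h))))%:E
     <= M%:E)%E ->
  derivable pavg t 1 /\ `|'D_1 pavg t| <= W * M.
Proof.
move=> W0 hW hM.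
have B0 : 0 <= B := le_trans (normr_ge0 _) (vB 0).
have cf s : continuous (f s).
  rewrite (_ : f s = fun h => v ((c + s *: b) + (s0 + s * s1) *: h)).
    by apply: comp_affine_continuous; exact: ck_continuous cv.
  by apply/funext => h; rewrite /f yE.
have cg s : continuous (fun h => enorm (cgrad v (y s h))).
  rewrite (_ : (fun _ => _) = fun h => enorm (cgrad v ((c + s *: b) + (s0 + s * s1) *: h))).
    exact: (@comp_affine_continuous (fun x => enorm (cgrad v x)) _ _ (cgrad_continuous cv)).
  by apply/funext => h; rewrite yE.
have mu1 := @measurable_ucube R n.
have It : (`]t - 1, t + 1[%classic : set R) t by rewrite /= in_itv /= ltrDl gtrDl ltrN10 ltr01.
have intf s : (`]t - 1, t + 1[%classic : set R) s -> mu.-integrable ucube (EFin \o f s).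
  by move=> _; apply: (@continuous_ucube_integrable _ B) => // h _; exact: vB.
have der s h : (`]t - 1, t + 1[%classic : set R) s -> ucube h -> derivable (f ^~ h) s 1.
  by move=> _ _; have [] := is_derive_f s h.
have G0 h : 0 <= (fun=> W * B) h by rewrite mulr_ge0.
have intG : mu.-integrable ucube (EFin \o (fun=> W * B)).
  apply: (@continuous_ucube_integrable _ (W * B)); first exact: cst_continuous.
  by move=> h _; rewrite ger0_norm// mulr_ge0.
have Gub s h : (`]t - 1, t + 1[%classic : set R) s -> ucube h ->
    `|partial1of2 f s h| <= (fun=> W * B) h.
  move=> _ hc; rewrite partial1of2E.
  have [_ ->] := is_derive_f s h.
  apply: le_trans (df_bound _ _) _; apply: ler_pM; rewrite ?enorm_ge0//.
  exact: hW.
split; first exact: (derivable_under_integral mu1 It intf der G0 intG Gub).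
rewrite -derive1E (differentiation_under_integral mu1 It intf der G0 intG Gub).
have E h : partial1of2 f t h = df t h by rewrite partial1of2E; have [] := is_derive_f t h.
under eq_Rintegral => h _ do rewrite E.
have mdf : measurable_fun ucube (df t).
  apply: measurable_funTS; apply: measurable_sum => i; apply: measurable_funM.
    apply: continuous_measurable_rV.
    by apply: (@comp_affine_continuous (fun x => x ord0 i)); exact: coord_continuous.
  apply: continuous_measurable_rV.
  rewrite (_ : (fun _ => _) = fun h => partial i v ((c + t *: b) + (s0 + t * s1) *: h)).
    by apply: comp_affine_continuous; exact: (ck_continuous (ck_partial i cv)).
  by apply/funext => h; rewrite mxE yE.
have intdf : mu.-integrable ucube (EFin \o df t).
  apply: measurable_bounded_integrable => //; first exact: leb_ucube_lty.
  exists (W * B); split; first exact: num_real.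
  move=> r Kr h hc /=; apply: le_trans (ltW Kr); rewrite -E; exact: Gub.
rewrite -lee_fin EFin_normr_Rintegral//.
apply: le_trans (le_abse_integral _ _ _) _ => //; first exact/measurable_EFinP.
rewrite EFinM; apply: le_trans (lee_wpmul2l _ hM); last by rewrite lee_fin.
rewrite -ge0_integralZl_EFin//.
- apply: ge0_le_integral => //.
  + by apply: measurableT_comp => //; exact/measurable_EFinP.
  + apply/measurable_EFinP/measurable_funM => //.
    exact: (measurable_funTS (continuous_measurable_rV (cg t))).
  + move=> h hc; rewrite /= lee_fin; apply: le_trans (df_bound _ _) _.
    by rewrite ler_wpM2r ?enorm_ge0//; exact: hW.
- by move=> h _; rewrite lee_fin enorm_ge0.
- apply/measurable_EFinP.
  exact: (measurable_funTS (continuous_measurable_rV (cg t))).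
Qed.

End derivative.
End averages.

(** * Morrey's estimate for smooth functions *)

Section morrey.
Context {R : realType} {n : nat}.
Implicit Types (a b c x h : 'rV[R]_n).
Variables (v : 'rV[R]_n -> R) (B : R).
Hypothesis cv : ck 1 v.
Hypothesis vB : forall x, `|v x| <= B.
Hypothesis gB : forall x, enorm (cgrad v x) <= B.

Local Notation mu := (leb n).
Local Notation A := (avg v).

Lemma measurable_cgrad_affine a (s : R) (D : set 'rV[R]_n) :
  measurable_fun D (fun h => enorm (cgrad v (a + s *: h))).
Proof.
apply: measurable_funTS; apply: continuous_measurable_rV.
exact: (@comp_affine_continuous _ _ (fun x => enorm (cgrad v x)) _ _ (cgrad_continuous cv)).
Qed.

(** The cube slides from [a] to [b] in unit time, all its points having velocity b - a, and the mean
    value theorem applies on [0, 1]. *)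
Lemma avg_lip a b (eps M : R) : 0 <= M ->
  (forall c, (\int[mu]_(h in ucube) (enorm (cgrad v (c + eps *: h)))%:E <= M%:E)%E) ->
  `|A a eps - A b eps| <= enorm (a - b) * M.
Proof.
move=> M0 hM.
pose F := pavg v a (b - a) eps 0.
have hF (t : R) : derivable F t 1 /\ `|'D_1 F t| <= enorm (b - a) * M.
  apply: (is_derive_pavg cv vB gB (enorm_ge0 _)).
    by move=> h _; rewrite scale0r addr0.
  have E h : a + eps *: h + t *: (b - a + 0 *: h) = a + t *: (b - a) + eps *: h.
    by rewrite scale0r addr0 addrAC.
  by under eq_integral => h _ do rewrite E.
have F0 : F 0 = A a eps.
  by apply: eq_Rintegral => h _; rewrite scale0r addr0.
have F1 : F 1 = A b eps.
  apply: eq_Rintegral => h _; rewrite scale0r addr0 scale1r.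
  by rewrite addrC addrA subrK.
have [c _ E] : exists2 c, c \in `[0, 1]%R & F 1 - F 0 = 'D_1 F c * (1 - 0).
  apply: MVT_segment => //; first by move=> t _; apply: derivableP; exact: (hF t).1.
  apply: continuous_subspaceT => t; apply: differentiable_continuous.
  by apply/derivable1_diffP; exact: (hF t).1.
by rewrite -F0 -F1 distrC E subr0 mulr1 enormC; exact: (hF c).2.
Qed.

(** The cube shrinks to [a]. The derivative of the average in the side [s] is at most sqrt n K
    s^(-al), integrable at 0 because al < 1; in use [al] is n / p. *)
Lemma avg_end a (eps K al : R) : 0 <= K -> 0 < eps -> al < 1 ->
  (forall s, 0 < s -> s <= eps ->
    (\int[mu]_(h in ucube) (enorm (cgrad v (a + s *: h)))%:E <= (K * s `^ (- al))%:E)%E) ->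
  `|v a - A a eps| <= Num.sqrt n%:R * K * (eps `^ (1 - al) / (1 - al)).
Proof.
move=> K0 e0 al1 hM; set C := _ * K.
have B0 : 0 <= B := le_trans (normr_ge0 _) (vB 0).
pose F := pavg v a 0 0 1.
have FE s : F s = A a s.
  by apply: eq_Rintegral => h _; rewrite scale0r addr0 add0r scale1r.
have W h : ucube h -> enorm (0 + 1 *: h) <= Num.sqrt n%:R.
  move=> hc; rewrite add0r scale1r; apply: le_trans (enorm_le_norm _) _.
  by rewrite ler_piMr// ucube_norm.
have hF (t M : R) : (\int[mu]_(h in ucube) (enorm (cgrad v (a + t *: h)))%:E <= M%:E)%E ->
    derivable F t 1 /\ `|'D_1 F t| <= Num.sqrt n%:R * M.
  move=> hI; apply: (is_derive_pavg cv vB gB (sqrtr_ge0 _) W).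
  have E h : a + 0 *: h + t *: (0 + 1 *: h) = a + t *: h.
    by rewrite scale0r addr0 add0r scale1r.
  by under eq_integral => h _ do rewrite E.
have dF (t : R) : derivable F t 1.
  have : (\int[mu]_(h in ucube) (enorm (cgrad v (a + t *: h)))%:E <= B%:E)%E.
    apply: (@le_trans _ _ (\int[mu]_(h in ucube) B%:E)%E).
      apply: ge0_le_integral => //; first exact: measurable_ucube.
      - by move=> h _; rewrite lee_fin enorm_ge0.
      - by apply/measurable_EFinP; exact: measurable_cgrad_affine.
      - by move=> h _; rewrite lee_fin.
    rewrite integral_cst//; last exact: measurable_ucube.
    by rewrite (_ : _ ucube = 1%E) ?mule1//; exact: leb_ucube.
  by move=> /hF[].
have cF : continuous F.
  by move=> t; apply: differentiable_continuous; exact/derivable1_diffP.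
have b0 : 0 < 1 - al by rewrite subr_gt0.
(* A primitive of the bound C s^(-al); monotonicity against it replaces integration. *)
pose G (s : R) := C / (1 - al) * s `^ (1 - al).
have dG (s : R) : 0 < s -> is_derive s 1 G (C * s `^ (- al)).
  move=> s0.
  rewrite (_ : C * s `^ (- al) = (C / (1 - al)) *: ((1 - al) * s `^ (1 - al - 1))); last first.
    rewrite /GRing.scale /= mulrA divfK ?gt_eqF//; congr (_ * _ `^ _); ring.
  have -> : G = (C / (1 - al)) *: ((@powR R) ^~ (1 - al)) by [].
  by apply: is_deriveZ; exact: is_derive1_powR.
have C0 : 0 <= C by rewrite mulr_ge0.
(* The bound may be singular at 0, so the comparison starts at de > 0: G + F and G - F are
   nondecreasing on [de, eps], and G de >= 0 is dropped. *)
have key (de : R) : 0 < de -> de < eps -> `|F eps - F de| <= G eps.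
  move=> d0 de_eps.
  have dH (sg : R) (s : R) : s \in `]de, eps[%R -> is_derive s 1 (fun t => G t + sg * F t)
      (C * s `^ (- al) + sg * 'D_1 F s).
    rewrite in_itv /= => /andP[ds se].
    apply: (@is_deriveD _ _ _ G (fun t => sg * F t)); first exact: dG (lt_trans d0 ds).
    by apply: (@is_deriveZ _ _ _ F sg); exact: derivableP.
  have cH (sg : R) : {within `[de, eps], continuous (fun t => G t + sg * F t)}.
    apply: derivable_within_continuous => s; rewrite in_itv /= => /andP[ds se].
    apply: (@derivableD _ _ _ G (fun t => sg * F t)).
      by have [] := dG s (lt_le_trans d0 ds).
    exact: (@derivableZ _ _ _ F sg).
  have mono (sg : R) : `|sg| = 1 -> G de + sg * F de <= G eps + sg * F eps.
    move=> sg1; have := @ger0_derive1_le_cc R (fun t => G t + sg * F t) de eps.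
    apply => //; rewrite ?in_itv /= ?lexx ?(ltW de_eps)//.
    - by move=> s /(dH sg)[].
    - move=> s sI; rewrite derive1E; have [_ ->] := dH sg _ sI.
      move: sI; rewrite in_itv /= => /andP[ds se].
      have [_ h] := hF _ _ (hM s (lt_trans d0 ds) (ltW se)).
      rewrite -lerBlDr sub0r; apply: le_trans (ler_norm _) _.
      by rewrite normrN normrM sg1 mul1r /C -mulrA.
  have := mono 1 (normr1 _); have := mono (-1) (normrN1 _).
  have Gd : 0 <= G de by rewrite mulr_ge0 ?powR_ge0// divr_ge0// ltW.
  rewrite !mulN1r !mul1r ler_norml => h1 h2; apply/andP; split; lra.
have -> : C * (eps `^ (1 - al) / (1 - al)) = G eps.
  by rewrite /G mulrA mulrAC.
rewrite -(avg0 v a) -!FE distrC.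
apply/ler_addgt0Pr => r r0.
have /cvgrPdist_le/(_ _ r0) := cF 0.
move=> /nbhs_ballP[d /= d0 hd].
pose de := Num.min (d / 2) (eps / 2).
have de0 : 0 < de by rewrite lt_min !divr_gt0.
have dee : de < eps by rewrite gt_min; apply/orP; right; rewrite ltr_pdivrMr// ltr_pMr// ltr1n.
have ded : de < d by rewrite gt_min; apply/orP; left; rewrite ltr_pdivrMr// ltr_pMr// ltr1n.
apply: (@le_trans _ _ (`|F eps - F de| + `|F de - F 0|)).
  by apply: le_trans (ler_normD _ _); rewrite addrA subrK.
apply: lerD; first exact: key.
rewrite distrC; apply: hd; rewrite /ball /= sub0r normrN gtr0_norm//.
Qed.

(** The change of variables bounds the p-th moment over the cube by s^(-n) K^p = M^p, and the power
    mean inequality with q = 1 lowers the exponent. *)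
Lemma mean_grad a (s K p : R) : 0 < K -> 0 < s -> 1 <= p ->
  (\int[mu]_x (enorm (cgrad v x) `^ p)%:E <= (K `^ p)%:E)%E ->
  (\int[mu]_(h in ucube) (enorm (cgrad v (a + s *: h)))%:E <= (K * s `^ (- (n%:R / p)))%:E)%E.
Proof.
move=> K0 s0 p1 hp; have p0 : 0 < p := lt_le_trans ltr01 p1.
set M := K * _.
have M0 : 0 < M by rewrite mulr_gt0// powR_gt0.
suff : (\int[mu]_(h in ucube) (enorm (cgrad v (a + s *: h)) `^ 1)%:E <= (1 * M `^ 1)%:E)%E.
  under eq_integral => h _ do rewrite (powRr1 (enorm_ge0 _)).
  by rewrite (powRr1 (ltW M0)) mul1r.
have f0 h : ucube h -> 0 <= enorm (cgrad v (a + s *: h)) by move=> _; exact: enorm_ge0.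
refine (@power_mean _ _ R mu ucube (fun h => enorm (cgrad v (a + s *: h))) 1 M p 1
  (@measurable_ucube R n) (@leb_ucube_le1 R n) (@measurable_cgrad_affine a s ucube) f0 M0 ltr01 p1 _).
have mgp (D : set 'rV[R]_n) (c : 'rV[R]_n) (r : R) :
    measurable_fun D (fun h => (enorm (cgrad v (c + r *: h)) `^ p)%:E).
  apply/measurable_EFinP.
  apply: (@measurable_comp _ _ _ _ _ _ setT (@powR R ^~ p)) => //.
  exact: measurable_cgrad_affine.
apply: (@le_trans _ _ (\int[mu]_h (enorm (cgrad v (a + s *: h)) `^ p)%:E)%E).
  apply: ge0_subset_integral => //; first exact: measurable_ucube.
  by move=> h _; rewrite lee_fin powR_ge0.
have mg : measurable_fun setT (fun h => (enorm (cgrad v h) `^ p)%:E).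
  apply/measurable_EFinP.
  apply: (@measurable_comp _ _ _ _ _ _ setT (@powR R ^~ p)) => //.
  exact: (continuous_measurable_rV (cgrad_continuous cv)).
have g0 x : (0 <= (enorm (cgrad v x) `^ p)%:E)%E by rewrite lee_fin powR_ge0.
rewrite (ge0_integral_affine a s0 mg g0) in hp.
have sn0 : 0 < s ^+ n by rewrite exprn_gt0.
rewrite mul1r (_ : M `^ p = (s ^+ n)^-1 * K `^ p); last first.
  rewrite /M powRM ?powR_ge0 ?(ltW K0)// -powRrM mulNr divfK ?gt_eqF//.
  by rewrite powRN powR_mulrn ?(ltW s0)// mulrC.
by rewrite EFinM lee_pdivlMl.
Qed.

Lemma morrey a b (eps K p : R) : 0 < K -> 0 < eps -> n%:R < p -> 1 <= p ->
  (\int[mu]_x (enorm (cgrad v x) `^ p)%:E <= (K `^ p)%:E)%E ->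
  `|v a - v b| <= K * (enorm (a - b) * eps `^ (- (n%:R / p)) +
    2 * (Num.sqrt n%:R * (eps `^ (1 - n%:R / p) / (1 - n%:R / p)))).
Proof.
move=> K0 e0 np p1 hp; have p0 : 0 < p := lt_le_trans ltr01 p1.
have al1 : n%:R / p < 1 by rewrite ltr_pdivrMr// mul1r.
have hend c : `|v c - A c eps| <= Num.sqrt n%:R * K * (eps `^ (1 - n%:R / p) / (1 - n%:R / p)).
  by apply: avg_end => //; [exact: ltW|move=> s s0 _; exact: mean_grad].
have hmid : `|A a eps - A b eps| <= enorm (a - b) * (K * eps `^ (- (n%:R / p))).
  apply: avg_lip; first by rewrite mulr_ge0 ?powR_ge0// ltW.
  by move=> c; exact: mean_grad.
(* Up from [a] to scale [eps], across at that scale, and down to [b]. *)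
have -> : v a - v b = (v a - A a eps) + (A a eps - A b eps) - (v b - A b eps) by ring.
apply: le_trans (ler_normB _ _) _.
apply: le_trans (lerD (ler_normD _ _) (hend b)) _.
apply: le_trans (lerD (lerD (hend a) hmid) (lexx _)) _.
by rewrite le_eqVlt; apply/orP; left; apply/eqP; ring.
Qed.

End morrey.

(** * Test functions *)

Section test_functions.
Context {R : realType} {n : nat}.
Variable Omega : set 'rV[R]_n.
Implicit Types (phi psi f : 'rV[R]_n -> R) (x : 'rV[R]_n).

Local Notation supp f := (closure [set x | f x != 0]).

(** A compact set is closed, so once it contains the points where [phi] is nonzero it contains the
    support. *)
Lemma test_fun_of phi (C : set 'rV[R]_n) : (forall k, ck k phi) -> compact C ->
  C `<=` Omega -> (forall x, phi x != 0 -> C x) -> test_fun Omega phi.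
Proof.
move=> cphi cC CO phiC.
have clC : closed C by apply: compact_closed => //; exact: norm_hausdorff.
have sC : supp phi `<=` C.
  by rewrite [X in _ `<=` X](closure_id C).1//; exact: closure_subset.
split; first exact/smoothP.
  apply: (subclosed_compact _ cC) => //; exact: closed_closure.
exact: subset_trans CO.
Qed.

Lemma test_fun_ck phi k : test_fun Omega phi -> ck k phi.
Proof. by move=> [/smoothP]. Qed.

Lemma test_fun_compact phi : test_fun Omega phi -> compact (supp phi).
Proof. by case. Qed.

Lemma test_fun_supp phi x : phi x != 0 -> supp phi x.
Proof. by move=> h; apply: subset_closure. Qed.

Lemma test_fun_out phi x : test_fun Omega phi -> ~ Omega x -> phi x = 0.
Proof.
move=> [_ _ sO] nO; apply/eqP; apply: contra_notT nO => h.
by apply: sO; exact: test_fun_supp.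
Qed.

Lemma partial_supp phi i x : partial i phi x != 0 -> supp phi x.
Proof.
apply: contra_neqP => nx.
have : nbhs x (~` supp phi).
  by apply: open_nbhs_nbhs; split => //; apply: closed_openC; exact: closed_closure.
move=> hx; rewrite /partial -[RHS](@derive_cst R 'rV[R]_n R^o 0 x (delta_mx ord0 i)).
apply: near_eq_derive; apply: filterS hx => y /= ny.
by apply/eqP; apply: contra_notT ny; exact: test_fun_supp.
Qed.

Lemma test_fun_partial phi i : test_fun Omega phi -> test_fun Omega (partial i phi).
Proof.
move=> tphi; apply: (@test_fun_of _ (supp phi)).
- by move=> k; exact: (ck_partial i (test_fun_ck k.+1 tphi)).
- exact: test_fun_compact.
- by case: tphi.
- by move=> x; exact: partial_supp.
Qed.

Lemma cgrad_supp phi x : ~ supp phi x -> cgrad phi x = 0.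
Proof.
move=> nx; apply/rowP => i; rewrite !mxE; apply/eqP.
by apply: contra_notT nx; exact: partial_supp.
Qed.

Lemma cgrad_out phi x : test_fun Omega phi -> ~ Omega x -> cgrad phi x = 0.
Proof.
move=> [_ _ sO] nO; apply: cgrad_supp => /sO.
exact: nO.
Qed.

Lemma test_funM phi f : test_fun Omega phi -> (forall k, ck k f) ->
  test_fun Omega (fun x => phi x * f x).
Proof.
move=> tphi cf; apply: (@test_fun_of _ (supp phi)).
- by move=> k; apply: ckM => //; exact: test_fun_ck.
- exact: test_fun_compact.
- by case: tphi.
- by move=> x; rewrite mulf_eq0 negb_or => /andP[h _]; exact: test_fun_supp.
Qed.

Lemma test_funZ phi (c : R) : test_fun Omega phi -> test_fun Omega (fun x => c * phi x).
Proof.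
move=> tphi; have := test_funM tphi (fun k => ck_cst k c).
by rewrite (_ : (fun x => phi x * c) = fun x => c * phi x)//; apply/funext => x; rewrite mulrC.
Qed.

Lemma test_funD phi psi : test_fun Omega phi -> test_fun Omega psi ->
  test_fun Omega (fun x => phi x + psi x).
Proof.
move=> tphi tpsi; apply: (@test_fun_of _ (supp phi `|` supp psi)).
- by move=> k; apply: ckD; exact: test_fun_ck.
- by apply: compactU; exact: test_fun_compact.
- by rewrite subUset; split; [case: tphi|case: tpsi].
- move=> x h; have [p0|p0] := eqVneq (phi x) 0; last by left; exact: test_fun_supp.
  by right; apply: test_fun_supp; rewrite p0 add0r in h.
Qed.

Lemma test_funB phi psi : test_fun Omega phi -> test_fun Omega psi ->
  test_fun Omega (fun x => phi x - psi x).
Proof.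
move=> tphi /(test_funZ (-1)) tpsi; have := test_funD tphi tpsi.
by rewrite (_ : (fun x => _) = fun x => phi x - psi x)//; apply/funext => x; rewrite mulN1r.
Qed.

Lemma test_fun_bounded phi : test_fun Omega phi ->
  exists2 B : R, 0 < B & forall x, `|phi x| <= B.
Proof.
move=> tphi.
have : compact (phi @` supp phi).
  apply: continuous_compact; last exact: test_fun_compact.
  by apply: continuous_subspaceT; exact: (ck_continuous (test_fun_ck 0 tphi)).
move=> /compact_bounded /ex_strict_bound_gt0[B B0 hB].
exists B => // x; have [->|h] := eqVneq (phi x) 0; first by rewrite normr0 ltW.
by apply/ltW/hB; exists x => //; exact: test_fun_supp.
Qed.

(** One constant for [phi] and its gradient, as the domination in the cube averages requires. *)
Lemma test_fun_bounds phi : test_fun Omega phi ->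
  exists B : R, (forall x, `|phi x| <= B) /\ forall x, enorm (cgrad phi x) <= B.
Proof.
move=> tphi; have [B0 B0_gt0 hB0] := test_fun_bounded tphi.
have /choice[C hC] (i : 'I_n) : exists C : R, forall x, `|partial i phi x| <= C.
  by have [C _ hC] := test_fun_bounded (test_fun_partial i tphi); exists C.
have C0 i : 0 <= C i := le_trans (normr_ge0 _) (hC i 0).
exists (B0 + \sum_i C i); split=> x.
  by rewrite (le_trans (hB0 x))// lerDl sumr_ge0.
apply: le_trans (enorm_le_sum _) _.
rewrite -[leLHS]add0r lerD ?(ltW B0_gt0)// ler_sum// => i _.
by rewrite mxE.
Qed.

Lemma test_fun_bounded_supp phi : test_fun Omega phi ->
  exists2 M : R, 0 < M & forall x, supp phi x -> `|x| < M.
Proof.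
move=> /test_fun_compact/compact_bounded/ex_strict_bound_gt0[M M0 hM].
by exists M.
Qed.

Lemma test_fun_measurable phi (D : set 'rV[R]_n) : test_fun Omega phi -> measurable_fun D phi.
Proof.
move=> tphi; apply: measurable_funTS; apply: continuous_measurable_rV.
exact: (ck_continuous (test_fun_ck 0 tphi)).
Qed.

Lemma test_fun_integrable phi (D : set 'rV[R]_n) : measurable D -> test_fun Omega phi ->
  (leb n).-integrable D (EFin \o phi).
Proof.
move=> mD tphi; suff : (leb n).-integrable setT (EFin \o phi).
  by apply: integrableS.
have [M M0 hM] := test_fun_bounded_supp tphi.
have [B B0 hB] := test_fun_bounded tphi.
pose C := obox (const_mx (- M)) (const_mx M) : set 'rV[R]_n.
have mC : measurable C by exact: measurable_obox.
have phiC : (EFin \o phi) = (EFin \o phi) \_ C.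
  apply/funext => x; rewrite /patch; case: ifPn => // xC /=.
  congr EFin; apply/eqP; move: xC; apply: contraNT => /test_fun_supp/hM xM.
  rewrite inE => i; rewrite /= in_itv /= !mxE -ltr_norml.
  exact: le_lt_trans (coord_le_norm x i) xM.
rewrite phiC -integrable_mkcond//.
apply: measurable_bounded_integrable => //.
- exact: leb_obox_lty.
- exact: test_fun_measurable.
- exists B; split; first exact: num_real.
  by move=> r Br x _ /=; exact: le_trans (hB x) (ltW Br).
Qed.

End test_functions.

(** * Integration by parts *)

Section integration_by_parts.
Context {R : realType} {n : nat}.

Lemma integral_shift (f : 'rV[R]_n -> \bar R) (a : 'rV[R]_n) : measurable_fun setT f ->
  (\int[leb n]_x f (a + x)%R = \int[leb n]_x f x)%E.
Proof.
move=> mf; rewrite integralE [in RHS]integralE.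
have h (g : 'rV[R]_n -> \bar R) : measurable_fun setT g -> (forall x, (0 <= g x)%E) ->
    (\int[leb n]_x g (a + x)%R = \int[leb n]_x g x)%E.
  move=> mg g0; rewrite [RHS](ge0_integral_affine a ltr01 mg g0) expr1n mul1e.
  by apply: eq_integral => x _; rewrite scale1r.
have hp := h _ (measurable_funepos mf) (fun x => funepos_ge0 f x).
have hn := h _ (measurable_funeneg mf) (fun x => funeneg_ge0 f x).
by rewrite -hp -hn; congr (_ - _)%E; apply: eq_integral => x _; rewrite ?funeposE ?funenegE.
Qed.

Variable Omega : set 'rV[R]_n.

(** By translation invariance the integral of x -> phi (x + t e_i) over a large box does not depend
    on [t] in [-1, 1]; its derivative at 0 is the integral of the partial. *)
Lemma integral_partial0 (phi : 'rV[R]_n -> R) (i : 'I_n) : test_fun Omega phi ->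
  \int[leb n]_x partial i phi x = 0.
Proof.
move=> tphi; have [M M0 hM] := test_fun_bounded_supp tphi.
have [B B0 hB] := test_fun_bounded (test_fun_partial i tphi).
have [B' B'0 hB'] := test_fun_bounded tphi.
pose e : 'rV[R]_n := delta_mx ord0 i.
(* One unit wider than a box around the support, so that translates by |t| <= 1 stay inside. *)
pose D := obox (const_mx (- (M + 1))) (const_mx (M + 1)) : set 'rV[R]_n.
have mD : measurable D by exact: measurable_obox.
have outD (t : R) x : `|t| <= 1 -> ~ D x -> phi (x + t *: e) = 0.
  move=> t1 nD; apply/eqP; apply: contra_notT nD => /test_fun_supp/hM xM j.
  rewrite /= in_itv /= !mxE -ltr_norml.
  have := le_lt_trans (coord_le_norm _ j) xM; rewrite !mxE => h.
  have -> : x ord0 j = x ord0 j + t * ((ord0 == ord0 :> 'I_1) && (j == i))%:R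
      - t * ((ord0 == ord0 :> 'I_1) && (j == i))%:R by rewrite addrK.
  apply: le_lt_trans (ler_normB _ _) _; apply: ltr_leD => //.
  rewrite normrM; case: (_ && _); rewrite ?normr1 ?mulr1//.
  by rewrite normr0 mulr0.
pose f (t : R) (x : 'rV[R]_n) := phi (x + t *: e).
have Df (t : R) x : is_derive t 1 (f ^~ x) (partial i phi (x + t *: e)).
  by apply: is_derive_slice_at; exact: (ck_is_derive i _ (test_fun_ck 1 tphi)).
have I0 : (`]-1, 1[%classic : set R) 0 by rewrite /= in_itv /= ltrN10 ltr01.
have cf t : measurable_fun setT (f t).
  apply: continuous_measurable_rV.
  rewrite (_ : f t = fun x => phi (t *: e + 1 *: x)).
    by apply: comp_affine_continuous; exact: (ck_continuous (test_fun_ck 0 tphi)).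
  by apply/funext => x; rewrite scale1r addrC.
have intf t : (`]-1, 1[%classic : set R) t -> (leb n).-integrable D (EFin \o f t).
  move=> _; apply: measurable_bounded_integrable => //.
  - exact: leb_obox_lty.
  - exact: measurable_funTS.
  - exists B'; split; first exact: num_real.
    by move=> r Br x _ /=; exact: le_trans (hB' _) (ltW Br).
have der t x : (`]-1, 1[%classic : set R) t -> D x -> derivable (f ^~ x) t 1.
  by move=> _ _; have [] := Df t x.
have G0 (x : 'rV[R]_n) : 0 <= (fun=> B) x by exact: ltW.
have intG : (leb n).-integrable D (EFin \o (fun=> B)).
  apply: measurable_bounded_integrable => //; first exact: leb_obox_lty.
  exists B; split; first exact: num_real.
  by move=> r Br x _ /=; rewrite ger0_norm ?ltW.
have Gub t x : (`]-1, 1[%classic : set R) t -> D x -> `|partial1of2 f t x| <= (fun=> B) x.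
  by move=> _ _; rewrite partial1of2E; have [_ ->] := Df t x; exact: hB.
have Fcst (t : R) : `|t| <= 1 -> \int[leb n]_(x in D) f t x = \int[leb n]_x phi x.
  move=> t1; rewrite Rintegral_mkcond.
  have -> : f t \_ D = f t.
    apply/funext => x; rewrite /patch; case: ifPn => //; rewrite notin_setE => nD.
    by rewrite /f outD.
  rewrite /Rintegral; congr fine.
  rewrite -[RHS](@integral_shift _ (t *: e)).
    by apply: eq_integral => x _; rewrite /f addrC.
  by apply/measurable_EFinP; exact: test_fun_measurable tphi.
have := differentiation_under_integral mD I0 intf der G0 intG Gub.
have -> : (fun t => \int[leb n]_(x in D) f t x)^`()%classic 0 = 0.
  rewrite derive1E -[RHS](@derive_cst R R R^o (\int[leb n]_x phi x) 0 1).
  apply: near_eq_derive; near=> t; apply: Fcst; apply: ltW; near: t.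
  by apply/nbhs_ballP; exists 1 => //= y; rewrite /ball /= sub0r normrN.
move=> E; rewrite [RHS]E [RHS]Rintegral_mkcond; apply: eq_Rintegral => x _.
rewrite /patch; case: ifPn => [_|].
  by rewrite partial1of2E; have [_ ->] := Df 0 x; rewrite scale0r addr0.
rewrite notin_setE => nD; apply/eqP; apply: contra_notT nD => /partial_supp.
move=> /hM xM j; rewrite /= in_itv /= !mxE -ltr_norml.
by apply: le_lt_trans (coord_le_norm x j) _; rewrite (lt_trans xM)// ltrDl.
Unshelve. all: by end_near. Qed.

(** The product [phi * psi] is a test function, and the integral of its partial vanishes. *)
Lemma integration_by_parts (phi psi : 'rV[R]_n -> R) (i : 'I_n) : open Omega ->
  test_fun Omega phi -> test_fun Omega psi ->
  \int[leb n]_(x in Omega) (phi x * partial i psi x) =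
  - \int[leb n]_(x in Omega) (partial i phi x * psi x).
Proof.
move=> oO tphi tpsi.
have mO : measurable Omega by exact: open_measurable_rV.
have t1 : test_fun Omega (fun x => phi x * partial i psi x).
  by apply: test_funM => // k; exact: (test_fun_ck k (test_fun_partial i tpsi)).
have t2 : test_fun Omega (fun x => partial i phi x * psi x).
  by apply: test_funM; [exact: test_fun_partial|move=> k; exact: (test_fun_ck k tpsi)].
apply/eqP; rewrite -subr_eq0 opprK -RintegralD//; last 2 first.
- exact: test_fun_integrable t1.
- exact: test_fun_integrable t2.
rewrite Rintegral_mkcond.
have tM := test_funM tphi (fun k => test_fun_ck k tpsi).
apply/eqP; rewrite -[RHS](integral_partial0 i tM). apply: eq_Rintegral => x _.
have -> : partial i (fun x => phi x * psi x) x = phi x * partial i psi x + partial i phi x * psi x.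
  have [_ E] := is_deriveM (ck_is_derive i x (test_fun_ck 1 tphi)) (ck_is_derive i x (test_fun_ck 1 tpsi)).
  by rewrite [partial i phi x * _]mulrC; exact: E.
rewrite /patch; case: ifPn => //; rewrite notin_setE => nO.
by rewrite (test_fun_out tphi nO) (test_fun_out tpsi nO) mul0r mulr0 addr0.
Qed.

End integration_by_parts.

(** * Smooth approximations of indicators of boxes *)

Section box_bumps.
Context {R : realType} {n : nat}.

Lemma flat0_ge0 (t : R) : 0 <= flat 0 t.
Proof. by rewrite /flat; case: ifP => // _; rewrite expr0 invr1 mul1r expR_ge0. Qed.

Lemma flat0_eq0 (t : R) : t <= 0 -> flat 0 t = 0.
Proof. by move=> t0; rewrite /flat ltNge t0. Qed.

Lemma flat0_le1 (t : R) : flat 0 t <= 1.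
Proof.
rewrite /flat; case: ifPn => // t0; rewrite expr0 invr1 mul1r -[leRHS]expR0 ler_expR.
by rewrite oppr_le0 invr_ge0 ltW.
Qed.

Lemma flat0_cvg (t : R) : 0 < t -> flat 0 (k.+1%:R * t) @[k --> \oo] --> (1 : R).
Proof.
move=> t0.
have E : (fun k => flat 0 (k.+1%:R * t)) = (fun k => expR (- (t^-1 * k.+1%:R^-1))).
  apply/funext => k; rewrite /flat mulr_gt0// expr0 invr1 mul1r.
  by rewrite invfM [in LHS]mulrC.
rewrite E -[X in _ --> X]expR0; apply: (@continuous_cvg _ _ _ _ _ _ expR); first exact: continuous_expR.
rewrite -[X in _ --> X]oppr0 -[X in _ --> - X](mulr0 t^-1).
apply: cvgN; apply: cvgMr; exact: cvg_harmonic.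
Qed.

(* Tends to the indicator function of [obox a b]. *)
Definition boxfun (a b : 'rV[R]_n) (k : nat) (x : 'rV[R]_n) : R :=
  \prod_(i < n) (flat 0 (k.+1%:R * (x ord0 i - a ord0 i)) *
                 flat 0 (k.+1%:R * (b ord0 i - x ord0 i))).

Lemma ck_boxfun a b k m : ck m (boxfun a b k).
Proof.
apply: ck_prod => i; apply: ckM; apply: ck_flat; apply: ckZ; apply: ckB;
  by [exact: ck_coord|exact: ck_cst].
Qed.

Lemma boxfun_out a b k x : ~ obox a b x -> boxfun a b k x = 0.
Proof.
move=> /existsNP[i /=]; rewrite in_itv /= => /negP; rewrite negb_and -!leNgt => h.
rewrite /boxfun (bigD1 i)//=; case/orP: h => h.
  by rewrite flat0_eq0 ?mul0r// mulr_ge0_le0// subr_le0.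
by rewrite (@flat0_eq0 (_ * (b ord0 i - _))) ?mulr0 ?mul0r// mulr_ge0_le0// subr_le0.
Qed.

Lemma boxfun_ge0 a b k x : 0 <= boxfun a b k x.
Proof. by apply: prodr_ge0 => i _; rewrite mulr_ge0// flat0_ge0. Qed.

Lemma boxfun_le1 a b k x : boxfun a b k x <= 1.
Proof.
apply: prodr_ile1 => i _; rewrite mulr_ge0 ?flat0_ge0//=.
by rewrite mulr_ile1 ?flat0_ge0 ?flat0_le1.
Qed.

Lemma boxfun_cvg a b x : obox a b x -> boxfun a b k x @[k --> \oo] --> (1 : R).
Proof.
move=> h; have -> : (1 : R) = \prod_(i <- index_enum 'I_n) 1 by rewrite big1_eq.
rewrite /boxfun; elim: (index_enum _) => [|i s IHs].
  by under eq_fun do rewrite big_nil; rewrite big_nil; exact: cvg_cst.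
under eq_fun do rewrite big_cons; rewrite big_cons.
have := h i; rewrite /= in_itv /= => /andP[h1 h2].
apply: cvgM => //; rewrite -[X in _ --> X]mulr1.
by apply: cvgM; apply: flat0_cvg; rewrite subr_gt0.
Qed.

Lemma obox_sub_cbox (a b : 'rV[R]_n) : obox a b `<=` cbox a b.
Proof. by move=> v h i; have := h i; rewrite /= in_itv /= => /andP[/ltW-> /ltW->]. Qed.

Lemma compact_cbox (a b : 'rV[R]_n) : compact (cbox a b).
Proof.
rewrite (_ : cbox a b = [set v : 'rV[R]_n | forall i, `[a ord0 i, b ord0 i]%classic (v ord0 i)]).
  by apply: (@rV_compact R n (fun i => `[a ord0 i, b ord0 i]%classic)) => i; exact: segment_compact.
by apply/seteqP; split => v h i; have := h i; rewrite /= in_itv.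
Qed.

Lemma test_boxfun (Omega : set 'rV[R]_n) a b k : cbox a b `<=` Omega ->
  test_fun Omega (boxfun a b k).
Proof.
move=> abO; apply: (@test_fun_of _ _ _ _ (cbox a b)) => //.
- by move=> m; exact: ck_boxfun.
- exact: compact_cbox.
move=> x; apply: contra_neqP => nx; apply: boxfun_out => /obox_sub_cbox.
exact: nx.
Qed.

End box_bumps.

(** * The fundamental lemma and uniqueness of weak gradients *)

Section fundamental_lemma.
Context {R : realType} {n : nat}.
Variable Omega : set 'rV[R]_n.
Hypothesis oO : open Omega.
Implicit Types (w v f : 'rV[R]_n -> R).

Lemma measurable_Omega : measurable Omega.
Proof. exact: open_measurable_rV. Qed.
Local Notation mO := measurable_Omega.

Lemma L1loc_test f phi : inL1loc Omega f -> test_fun Omega phi ->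
  (leb n).-integrable Omega (EFin \o (fun x => f x * phi x)).
Proof.
move=> [mf intf] tphi.
set K := closure [set x | phi x != 0].
have cK : compact K := test_fun_compact tphi.
have KO : K `<=` Omega by case: tphi.
have mK : measurable K.
  rewrite -[K]setCK; apply: measurableC; apply: open_measurable_rV.
  by apply: closed_openC; exact: closed_closure.
have [B B0 hB] := test_fun_bounded tphi.
have E : (EFin \o (fun x => f x * phi x)) = (EFin \o (fun x => f x * phi x)) \_ K.
  apply/funext => x; rewrite /patch; case: ifPn => //; rewrite notin_setE => nK /=.
  rewrite (_ : phi x = 0) ?mulr0//; apply/eqP; apply: contra_notT nK.
  exact: test_fun_supp.
rewrite E; apply: (@integrableS _ _ _ _ setT) => //; first exact: mO.
apply/(integrable_mkcond _ mK).
have := @integrableMl _ _ _ (leb n) K mK (EFin \o f) phi (intf K cK KO).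
apply.
  exact: test_fun_measurable tphi.
exists B; split; first exact: num_real.
by move=> r Br x _ /=; exact: le_trans (hB x) (ltW Br).
Qed.

(** Tested against [boxfun], [w] has integral 0 over every box inside [obox c d] by dominated
    convergence, and [integral_oboxes_ae0] concludes. *)
Lemma fundamental_lemma_box w (c d : 'rV[R]_n) : inL1loc Omega w ->
  (forall phi, test_fun Omega phi -> \int[leb n]_(x in Omega) (w x * phi x) = 0) ->
  cbox c d `<=` Omega -> {ae leb n, forall x, obox c d x -> w x = 0}.
Proof.
move=> Lw hw cdO.
have mcd : measurable (obox c d) by exact: measurable_obox.
have intw : (leb n).-integrable (obox c d) (EFin \o w).
  have mcb : measurable (cbox c d).
    rewrite (_ : cbox c d = [set v | forall i, `[c ord0 i, d ord0 i]%classic (v ord0 i)]).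
      by apply: (@measurable_box R n (fun i => `[c ord0 i, d ord0 i]%classic)) => i; exact: measurable_itv.
    by apply/seteqP; split => v h i; have := h i; rewrite /= in_itv.
  exact: (integrableS mcb mcd (@obox_sub_cbox R n c d) (Lw.2 _ (@compact_cbox R n c d) cdO)).
apply: integral_oboxes_ae0 => // a b; rewrite oboxI.
set a' := (X in obox X _); set b' := (X in obox _ X).
have sub' : obox a' b' `<=` obox c d by rewrite /a' /b' -oboxI; exact: subIsetr.
have csub : cbox a' b' `<=` Omega.
  apply: subset_trans cdO => v h i; have := h i; rewrite !mxE ge_max le_min.
  by move=> /andP[/andP[_ ->] /andP[_ ->]].
have m' : measurable (obox a' b') by exact: measurable_obox.
have int' : (leb n).-integrable (obox a' b') (EFin \o w) by apply: integrableS intw.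
pose f_ k x := (w x * boxfun a' b' k x)%:E.
have f0 k : (\int[leb n]_(x in obox a' b') f_ k x = 0)%E.
  have tk := test_boxfun k csub.
  have := hw _ tk; rewrite /Rintegral.
  have -> : (\int[leb n]_(x in Omega) (w x * boxfun a' b' k x)%:E =
      \int[leb n]_(x in obox a' b') f_ k x)%E.
    rewrite [RHS]integral_mkcond [LHS]integral_mkcond; apply: eq_integral => x _.
    rewrite /patch; case: ifPn => hx; case: ifPn => hx' //.
      by move: hx'; rewrite notin_setE => hx'; rewrite boxfun_out// mulr0.
    move: hx hx'; rewrite notin_setE inE => nO hx'; exfalso; apply: nO.
    exact: csub (obox_sub_cbox hx').
  move=> h; rewrite -[LHS]fineK ?h//.
  apply: integrable_fin_num => //.
  apply: (integrableS mO) (L1loc_test Lw tk) => //.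
  by move=> x hx; apply: csub; exact: obox_sub_cbox.
have mw : measurable_fun (obox a' b') w.
  by apply/measurable_EFinP; exact: measurable_int int'.
have mf_ k : measurable_fun (obox a' b') (f_ k).
  apply/measurable_EFinP/measurable_funM => //.
  apply: measurable_funTS; apply: continuous_measurable_rV.
  exact: (ck_continuous (ck_boxfun a' b' k 0)).
have f_f : {ae leb n, forall x, obox a' b' x -> f_ ^~ x @ \oo --> (w x)%:E}.
  apply: aeW => x hx; apply: cvg_EFin; first exact: nearW.
  rewrite -[X in _ --> X]mulr1; apply: cvgMr; exact: boxfun_cvg.
have intg : (leb n).-integrable (obox a' b') (EFin \o (fun x => `|w x|)).
  exact: (integrable_norm int').
have f_g : {ae leb n, forall x k, obox a' b' x -> (`|f_ k x| <= `|w x|%R%:E)%E}.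
  apply: aeW => x k _; rewrite /= lee_fin normrM ler_piMr//.
  by rewrite ger0_norm ?boxfun_ge0// boxfun_le1.
have [_ _ h] := @dominated_convergence _ _ _ (leb n) _ m' f_ (EFin \o w) _ mf_
  (measurable_int _ int') f_f intg f_g.
rewrite (_ : (fun k => _) = (fun=> 0%E)) in h; last by apply/funext => k; exact: f0.
by rewrite -(cvg_lim _ h)//; exact: lim_cst.
Qed.

Lemma fundamental_lemma w : inL1loc Omega w ->
  (forall phi, test_fun Omega phi -> \int[leb n]_(x in Omega) (w x * phi x) = 0) ->
  {ae leb n, forall x, Omega x -> w x = 0}.
Proof.
move=> Lw hw.
(* One null set for each rational box, indexed by [nat] through [unpickle] so that [ae_foralln]
   unites them; a number that encodes no box gives [True]. *)
have h (k : nat) : {ae leb n, forall x,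
    if unpickle k is Some c then crbox c `<=` Omega -> rbox c x -> w x = 0 else True}.
  case: unpickle => [c|]; last exact: aeW.
  have [cO|ncO] := pselect (crbox c `<=` Omega); last by apply: aeW => x /ncO.
  have := fundamental_lemma_box Lw hw cO; rewrite -rboxE.
  by apply: filterS => x hx _.
move/ae_foralln : h; apply: filterS => x hx.
rewrite {1}(open_bigcup_rbox oO) => -[c cO cx].
by have := hx (pickle c); rewrite pickleK; exact.
Qed.

(** [grad] is an arbitrary choice among weak gradients; this lets any explicit weak gradient stand
    in for it inside norms. The fundamental lemma applies to each component of the difference. *)
Lemma weak_gradient_unique v (g g' : 'rV[R]_n -> 'rV[R]_n) :
  weak_gradient Omega v g -> weak_gradient Omega v g' ->
  {ae leb n, forall x, Omega x -> g x = g' x}.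
Proof.
move=> [Lv hg] [_ hg'].
have h (i : 'I_n) : {ae leb n, forall x, Omega x -> g x ord0 i - g' x ord0 i = 0}.
  have [Lg Eg] := hg i; have [Lg' Eg'] := hg' i.
  apply: fundamental_lemma.
    split; first by apply: measurable_funB; [exact: Lg.1|exact: Lg'.1].
    move=> K cK KO; have mK : measurable K.
      rewrite -[K]setCK; apply: measurableC; apply: open_measurable_rV.
      by apply: closed_openC; apply: compact_closed => //; exact: norm_hausdorff.
    exact: (integrableB mK (Lg.2 K cK KO) (Lg'.2 K cK KO)).
  move=> phi tphi; have e1 := Eg phi tphi; have e2 := Eg' phi tphi.
  under eq_Rintegral => x _ do rewrite mulrBl.
  rewrite RintegralB; [|exact: mO|exact: L1loc_test|exact: L1loc_test].
  by apply/eqP; rewrite subr_eq0 -eqr_opp -e1 e2.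
have /filter_forall : forall i : 'I_n, {ae leb n, forall x, Omega x -> g x ord0 i - g' x ord0 i = 0} := h.
apply: filterS => x hx Ox; apply/rowP => i; apply/eqP; rewrite -subr_eq0.
by rewrite (hx i Ox).
Qed.

Lemma test_weak_gradient phi : test_fun Omega phi -> weak_gradient Omega phi (cgrad phi).
Proof.
move=> tphi.
have L (psi : 'rV[R]_n -> R) : test_fun Omega psi -> inL1loc Omega psi.
  move=> tpsi; split; first exact: test_fun_measurable tpsi.
  move=> K cK KO; apply: test_fun_integrable tpsi.
  rewrite -[K]setCK; apply: measurableC; apply: open_measurable_rV.
  by apply: closed_openC; apply: compact_closed => //; exact: norm_hausdorff.
split; first exact: L.
move=> i; have E : (fun x => cgrad phi x ord0 i) = partial i phi.
  by apply/funext => x; rewrite mxE.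
split; first by rewrite E; apply: L; exact: test_fun_partial.
move=> psi tpsi; rewrite (integration_by_parts i oO tphi tpsi).
by congr (- _); apply: eq_Rintegral => x _; rewrite mxE.
Qed.

Lemma weak_gradient_grad v g : weak_gradient Omega v g ->
  weak_gradient Omega v (grad Omega v).
Proof.
by move=> h; have := @xgetPex _ (fun=> 0) [set g | weak_gradient Omega v g] (ex_intro _ g h).
Qed.

End fundamental_lemma.

(** * L^p norms on Omega *)

Section lpn.
Context {R : realType} {n : nat}.
Variable Omega : set 'rV[R]_n.
Hypothesis mO : measurable Omega.
Implicit Types (f g : 'rV[R]_n -> R) (p : R).

Lemma LpNE p f : 0 < p ->
  LpN Omega p%:E f = ((\int[leb n]_(x in Omega) (`|f x| `^ p)%:E) `^ p^-1)%E.
Proof.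
move=> p0; rewrite /LpN unlock; congr (_ `^ _)%E.
rewrite [RHS]integral_mkcond; apply: eq_integral => x _ /=.
rewrite /patch; case: ifPn => // _; by rewrite normr0 powR0 ?gt_eqF.
Qed.

(** Trades a norm bound for a bound on the integral of the p-th power, the form in which Morrey's
    estimate is stated. *)
Lemma LpN_leP p f (K : R) : 0 < p -> 0 <= K ->
  (LpN Omega p%:E f <= K%:E)%E <->
  (\int[leb n]_(x in Omega) (`|f x| `^ p)%:E <= (K `^ p)%:E)%E.
Proof.
move=> p0 K0; rewrite LpNE//; set I := (\int[_]_(x in _) _)%E.
have I0 : (0 <= I)%E by apply: integral_ge0 => x _; rewrite lee_fin powR_ge0.
have le_poweR (r : R) (x y : \bar R) : 0 <= r -> (0 <= x)%E -> (x <= y)%E -> (x `^ r <= y `^ r)%E.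
  move=> r0 x0 xy; apply: gt0_ler_poweR => //.
    by rewrite in_itv /= x0 leey.
  by rewrite in_itv /= (le_trans x0 xy) leey.
split=> h.
  have := @le_poweR p _ _ (ltW p0) (poweR_ge0 _ _) h.
  by rewrite -poweRrM mulVf ?gt_eqF// poweRe1// poweR_EFin.
have ip0 : 0 <= p^-1 by rewrite invr_ge0 ltW.
have := @le_poweR p^-1 _ _ ip0 I0 h.
by rewrite poweR_EFin -powRrM mulfV ?gt_eqF// powRr1.
Qed.

Lemma LpN_ge0 (p : \bar R) f : (0 <= LpN Omega p f)%E.
Proof. exact: Lnorm_ge0. Qed.

Lemma measurable_absX p f : measurable_fun Omega f ->
  measurable_fun Omega (fun x => (`|f x| `^ p)%:E).
Proof.
move=> mf; apply/measurable_EFinP.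
apply: (@measurable_comp _ _ _ _ _ _ setT (@powR R ^~ p)) => //.
exact: measurable_abs.
Qed.

Lemma ae_LpN_le p f g : 0 < p -> measurable_fun Omega f -> measurable_fun Omega g ->
  {ae leb n, forall x, Omega x -> `|f x| <= `|g x|} ->
  (LpN Omega p%:E f <= LpN Omega p%:E g)%E.
Proof.
move=> p0 mf mg fg; rewrite !LpNE//.
have I0 h : (0 <= \int[leb n]_(x in Omega) (`|h x| `^ p)%:E)%E.
  by apply: integral_ge0 => x _; rewrite lee_fin powR_ge0.
apply: gt0_ler_poweR.
- by rewrite invr_ge0 ltW.
- by rewrite in_itv /= I0 leey.
- by rewrite in_itv /= I0 leey.
apply: ae_ge0_le_integral => //.
- exact: measurable_absX.
- exact: measurable_absX.
apply: filterS fg => x fg Ox; rewrite lee_fin ge0_ler_powR ?nnegrE ?(ltW p0)//.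
exact: fg.
Qed.

Lemma LpN_le p f g : 0 < p -> measurable_fun Omega f -> measurable_fun Omega g ->
  (forall x, Omega x -> `|f x| <= `|g x|) ->
  (LpN Omega p%:E f <= LpN Omega p%:E g)%E.
Proof. by move=> p0 mf mg fg; apply: ae_LpN_le => //; exact: aeW. Qed.

Lemma LpND p f g : 1 <= p -> measurable_fun Omega f -> measurable_fun Omega g ->
  (LpN Omega p%:E (fun x => f x + g x)%R <= LpN Omega p%:E f + LpN Omega p%:E g)%E.
Proof.
move=> p1 mf mg; rewrite /LpN.
rewrite (_ : (fun x => f x + g x) \_ Omega = ((f \_ Omega) + (g \_ Omega))); last first.
  apply/funext => x; rewrite -[RHS]/((f \_ Omega) x + (g \_ Omega) x) /patch.
  by case: ifP => // _; rewrite addr0.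
have [mf' _] := measurable_restrictT f mO; have [mg' _] := measurable_restrictT g mO.
exact: (minkowski_EFin (leb n) (mf' mf) (mg' mg) p1).
Qed.

Lemma LpN_sum p (I : Type) (s : seq I) (f : I -> 'rV[R]_n -> R) : 1 <= p ->
  (forall i, measurable_fun Omega (f i)) ->
  (LpN Omega p%:E (fun x => \sum_(i <- s) f i x)%R <= \sum_(i <- s) LpN Omega p%:E (f i))%E.
Proof.
move=> p1 mf; have p0 : 0 < p := lt_le_trans ltr01 p1.
elim: s => [|i s IHs].
  rewrite big_nil; apply/LpN_leP => //; rewrite integral0_eq ?lee_fin ?powR_ge0//.
  by move=> x _; rewrite big_nil normr0 powR0 ?gt_eqF.
rewrite big_cons; under eq_fun do rewrite big_cons.
apply: le_trans (LpND p1 (mf i) _) _; last exact: leeD.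
exact: measurable_sum.
Qed.

Lemma LpN_norm (p : R) f : 0 < p -> LpN Omega p%:E (fun x => `|f x|) = LpN Omega p%:E f.
Proof. by move=> p0; rewrite !LpNE//; under eq_integral do rewrite normr_id. Qed.

Lemma measurable_enorm (D : set 'rV[R]_n) (g : 'rV[R]_n -> 'rV[R]_n) :
  (forall i : 'I_n, measurable_fun D (fun x => g x ord0 i)) ->
  measurable_fun D (fun x => enorm (g x)).
Proof.
move=> mg.
apply: (@measurable_comp _ _ _ _ _ _ setT (@Num.sqrt R)) => //.
  by apply: continuous_measurable_fun; exact: sqrt_continuous.
by apply: measurable_sum => i; exact: measurable_funX.
Qed.

Lemma measurable_enormB (D : set 'rV[R]_n) (g h : 'rV[R]_n -> 'rV[R]_n) :
  (forall i, measurable_fun D (fun x => g x ord0 i)) ->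
  (forall i, measurable_fun D (fun x => h x ord0 i)) ->
  measurable_fun D (fun x => enorm (g x - h x)).
Proof.
move=> mg mh; apply: measurable_enorm => i; under eq_fun do rewrite mxE [X in _ + X]mxE.
by apply: measurable_funB; [exact: mg|exact: mh].
Qed.

End lpn.

Lemma within_closure_continuous (R : realType) (n : nat) (Omega : set 'rV[R]_n)
    (v : 'rV[R]_n -> R) (x : 'rV[R]_n) :
  open Omega -> {within closure Omega, continuous v} -> Omega x -> {for x, continuous v}.
Proof.
move=> oO cv Ox.
have : {within Omega, continuous v} by apply: continuous_subspaceW cv; exact: subset_closure.
by rewrite continuous_open_subspace// => /(_ x); apply; rewrite inE.
Qed.

(** * Morrey's estimate in W_0^{1,p} *)

Section sobolev_morrey.
Context {R : realType} {n : nat}.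
Variable Omega : set 'rV[R]_n.
Hypothesis oO : open Omega.
Hypothesis bO : bounded_set Omega.
Hypothesis n1 : (1 <= n)%N.
Implicit Types (v phi : 'rV[R]_n -> R) (p K eps d : R) (x y z : 'rV[R]_n).

Local Notation mO := (measurable_Omega oO).

(** Test functions vanish at [z], so Morrey's estimate between [z] and the points of [Omega] bounds
    them uniformly. Dimension at least 1 provides a point outside a bounded set. *)
Lemma outside_point : exists2 z, ~ Omega z &
  exists2 d : R, 0 < d & forall y, Omega y -> enorm (y - z) <= d.
Proof.
have [M M0 hM] := bounded_setP bO.
have nz : ~ Omega (const_mx M).
  move=> /hM; have := coord_le_norm (const_mx M : 'rV[R]_n) (Ordinal n1).
  by rewrite mxE gtr0_norm// => h1 /(le_lt_trans h1); rewrite ltxx.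
exists (const_mx M) => //.
exists (Num.sqrt n%:R * M + enorm (const_mx M : 'rV[R]_n) + 1).
  by rewrite ltr_wpDl// addr_ge0 ?enorm_ge0// mulr_ge0// ltW.
move=> y /hM yM; apply: le_trans (enormD _ _) _; rewrite enormN.
rewrite (@le_trans _ _ (Num.sqrt n%:R * M + enorm (const_mx M : 'rV[R]_n)))//; last first.
  by rewrite lerDl.
rewrite lerD2r; apply: le_trans (enorm_le_norm _) _.
by rewrite ler_wpM2l// ltW.
Qed.

(* The modulus in Morrey's estimate, at the free scale [eps]. *)
Definition mrate p eps d : R :=
  d * eps `^ (- (n%:R / p)) + 2 * (Num.sqrt n%:R * (eps `^ (1 - n%:R / p) / (1 - n%:R / p))).

Lemma mrate_ge0 p eps d : n%:R < p -> 0 <= d -> 0 <= mrate p eps d.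
Proof.
move=> np d0; have p0 : 0 < p := le_lt_trans (ler0n _ _) np.
rewrite addr_ge0 ?mulr_ge0 ?powR_ge0// invr_ge0 subr_ge0 ler_pdivrMr// mul1r.
exact: ltW.
Qed.

Lemma mrateS p eps d d' : d <= d' -> mrate p eps d <= mrate p eps d'.
Proof. by move=> dd'; rewrite lerD2r ler_wpM2r ?powR_ge0. Qed.

Lemma mrate_small p (r : R) : n%:R < p -> 0 < r ->
  exists eps s : R, [/\ 0 < eps, 0 < s & forall d, d <= s -> mrate p eps d <= r].
Proof.
move=> np r0; have p0 : 0 < p := le_lt_trans (ler0n _ _) np.
have b0 : 0 < 1 - n%:R / p by rewrite subr_gt0 ltr_pdivrMr// mul1r.
have sn0 : 0 < Num.sqrt n%:R :> R by rewrite sqrtr_gt0 ltr0n.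
set be := 1 - n%:R / p in b0.
(* With eps^be = t the second term of [mrate] is r / 2; then [s] keeps the first term at most r /
   2. *)
pose t := r * be / (4 * Num.sqrt n%:R).
have t0 : 0 < t by rewrite divr_gt0 ?mulr_gt0.
pose eps := t `^ be^-1.
have e0 : 0 < eps by rewrite powR_gt0.
have et : eps `^ be = t by rewrite -powRrM mulVf ?gt_eqF// powRr1// ltW.
pose s := r / (2 * eps `^ (- (n%:R / p))).
have q0 : 0 < eps `^ (- (n%:R / p)) by rewrite powR_gt0.
exists eps, s; split=> //; first by rewrite divr_gt0// mulr_gt0.
move=> d ds; rewrite /mrate -/be et.
have -> : 2 * (Num.sqrt n%:R * (t / be)) = r / 2.
  by rewrite /t; field; rewrite !gt_eqF.
rewrite [leRHS]splitr lerD2r -ler_pdivlMr//.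
by apply: le_trans ds _; rewrite /s invfM mulrA.
Qed.

Lemma morrey_test v p K eps x y : test_fun Omega v -> n%:R < p -> 0 < K -> 0 < eps ->
  (\int[leb n]_x (enorm (cgrad v x) `^ p)%:E <= (K `^ p)%:E)%E ->
  `|v x - v y| <= K * mrate p eps (enorm (x - y)).
Proof.
move=> tv np K0 e0 h; have [B [vB gB]] := test_fun_bounds tv.
apply: (morrey (test_fun_ck 1 tv) vB gB) => //.
by apply: le_trans (ltW np); rewrite ler1n.
Qed.

(** The gradient of a test function vanishes off [Omega], so the integral over [Omega] in the norm
    is the one over the whole space in Morrey's estimate. *)
Lemma LpN_cgradP v p K : test_fun Omega v -> 0 < p -> 0 <= K ->
  (LpN Omega p%:E (fun x => enorm (cgrad v x)) <= K%:E)%E <->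
  (\int[leb n]_x (enorm (cgrad v x) `^ p)%:E <= (K `^ p)%:E)%E.
Proof.
move=> tv p0 K0; rewrite (LpN_leP _ _ p0 K0).
rewrite integral_mkcond.
have -> : (fun x => (`|enorm (cgrad v x)| `^ p)%:E) \_ Omega = (fun x => (enorm (cgrad v x) `^ p)%:E).
  apply/funext => x; rewrite /patch; case: ifPn => [_|]; first by rewrite ger0_norm ?enorm_ge0.
  by rewrite notin_setE => nx; rewrite (cgrad_out tv nx) enorm0 powR0 ?gt_eqF.
by [].
Qed.

Lemma LpN_enorm_le_sum p (w : 'rV[R]_n -> 'rV[R]_n) : 1 <= p ->
  (forall i : 'I_n, measurable_fun Omega (fun x => w x ord0 i)) ->
  (LpN Omega p%:E (fun x => enorm (w x)) <= \sum_i LpN Omega p%:E (fun x => w x ord0 i))%E.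
Proof.
move=> p1 mw; have p0 : 0 < p := lt_le_trans ltr01 p1.
have mw' i : measurable_fun Omega (fun x => `|w x ord0 i|).
  exact: measurable_abs.
apply: (@le_trans _ _ (LpN Omega p%:E (fun x => \sum_i `|w x ord0 i|))).
  apply: LpN_le => //; [exact: mO|exact: measurable_enorm|exact: measurable_sum|].
  move=> x _; rewrite !ger0_norm ?enorm_ge0 ?sumr_ge0//; exact: enorm_le_sum.
apply: le_trans (LpN_sum mO _ p1 mw') _.
by apply: lee_sum => i _; rewrite LpN_norm.
Qed.

Lemma LpN_enormD p (w w' : 'rV[R]_n -> 'rV[R]_n) : 1 <= p ->
  (forall i : 'I_n, measurable_fun Omega (fun x => w x ord0 i)) ->
  (forall i : 'I_n, measurable_fun Omega (fun x => w' x ord0 i)) ->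
  (LpN Omega p%:E (fun x => enorm (w x + w' x)) <=
   LpN Omega p%:E (fun x => enorm (w x)) + LpN Omega p%:E (fun x => enorm (w' x)))%E.
Proof.
move=> p1 mw mw'; have p0 : 0 < p := lt_le_trans ltr01 p1.
apply: le_trans (LpND mO p1 (measurable_enorm mw) (measurable_enorm mw')).
apply: LpN_le => //; first exact: mO.
- apply: measurable_enorm => i; under eq_fun do rewrite mxE.
  exact: measurable_funD.
- by apply: measurable_funD; exact: measurable_enorm.
- by move=> x _; rewrite !ger0_norm ?addr_ge0 ?enorm_ge0//; exact: enormD.
Qed.

Lemma cvg0_near (u : nat -> \bar R) (r : R) : u k @[k --> \oo] --> 0%E -> 0 < r ->
  \forall k \near \oo, (u k <= r%:E)%E.
Proof.
move=> u0 r0.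
have : nbhs (0%E : \bar R) [set y : \bar R | (y < r%:E)%E].
  by apply: open_nbhs_nbhs; split; [exact: open_ereal_lt_ereal|rewrite /= lte_fin].
move=> /u0 h; near=> k; apply: ltW; near: k; exact: h.
Unshelve. all: by end_near. Qed.

Lemma test_measurable_partial phi (i : 'I_n) : test_fun Omega phi ->
  measurable_fun Omega (fun x => cgrad phi x ord0 i).
Proof.
move=> tphi; under eq_fun do rewrite mxE.
exact: (test_fun_measurable (test_fun_partial i tphi)).
Qed.

Lemma cgrad_powR_integral v p K : test_fun Omega v -> 0 < p -> 0 < K ->
  (LpN Omega p%:E (fun x => enorm (cgrad v x)) <= K%:E)%E ->
  (\int[leb n]_x (enorm (cgrad v x) `^ p)%:E <= (K `^ p)%:E)%E.
Proof. by move=> tv p0 /ltW K0; move/(LpN_cgradP tv p0 K0). Qed.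

Section approximation.
Variables (p : R) (v : 'rV[R]_n -> R) (phi : nat -> 'rV[R]_n -> R).
Hypothesis np : n%:R < p.
Hypothesis vC0 : C0 Omega v.
Hypothesis mv : measurable_fun Omega v.
Hypothesis mgv : forall i : 'I_n, measurable_fun Omega (fun x => grad Omega v x ord0 i).
Hypothesis tphi : forall k, test_fun Omega (phi k).
Hypothesis phi_v : LpN Omega p%:E (fun x => phi k x - v x) @[k --> \oo] --> 0%E.
Hypothesis dphi_v : forall i : 'I_n,
  LpN Omega p%:E (fun x => partial i (phi k) x - grad Omega v x ord0 i) @[k --> \oo] --> 0%E.

Let p1 : 1 <= p. Proof. by apply: le_trans (ltW np); rewrite ler1n. Qed.
Let p0 : 0 < p. Proof. exact: lt_le_trans ltr01 p1. Qed.

Lemma approx_grad (r : R) : 0 < r ->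
  \forall k \near \oo, (LpN Omega p%:E (fun x => enorm (cgrad (phi k) x - grad Omega v x)) <= r%:E)%E.
Proof.
move=> r0; have rn : 0 < r / n%:R by rewrite divr_gt0// ltr0n.
have /filter_forall h := fun i => cvg0_near (dphi_v i) rn.
apply: filterS h => k hk.
apply: le_trans (LpN_enorm_le_sum p1 _) _.
  move=> i; under eq_fun do rewrite !mxE.
  apply: measurable_funB => //.
  exact: (test_fun_measurable (test_fun_partial i (tphi k))).
apply: (@le_trans _ _ (\sum_(i < n) (r / n%:R)%:E)%E).
  by apply: lee_sum => i _; under eq_fun do rewrite !mxE; exact: hk.
rewrite sumEFin lee_fin sumr_const card_ord -[X in X <= _]mulr_natr divfK//.
by rewrite pnatr_eq0 -lt0n.
Qed.

(** The gap between [K] and the norm, positive by strictness, absorbs the error of approximation. *)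
Lemma approx_K K : (gradN Omega p%:E v < K%:E)%E ->
  \forall k \near \oo, (LpN Omega p%:E (fun x => enorm (cgrad (phi k) x)) <= K%:E)%E.
Proof.
move=> vK.
have g0 : (0 <= gradN Omega p%:E v)%E by exact: LpN_ge0.
have gfin : gradN Omega p%:E v \is a fin_num.
  by rewrite ge0_fin_numE// (lt_trans vK)// ltry.
have r0 : 0 < K - fine (gradN Omega p%:E v).
  by rewrite subr_gt0 -lte_fin fineK.
apply: filterS (approx_grad r0) => k hk.
have := @LpN_enormD p (fun x => cgrad (phi k) x - grad Omega v x) (grad Omega v) p1.
under eq_fun do rewrite subrK.
move=> h; apply: le_trans (h _ mgv) _.
  move=> i; under eq_fun do rewrite mxE.
  apply: measurable_funD; first exact: test_measurable_partial.
  by under eq_fun do rewrite mxE; exact: measurableT_comp.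
apply: (@le_trans _ _ ((K - fine (gradN Omega p%:E v))%:E + gradN Omega p%:E v)%E).
  exact: leeD.
by rewrite -[X in (_ + X)%E]fineK// -EFinD subrK.
Qed.

(** Convergence in L^p alone says nothing at the point [y]. But the [phi k] share a modulus of
    continuity for large [k], so an error above [e] at [y] persists as e / 3 on a fixed ball,
    against convergence in L^p. *)
Lemma approx_pointwise K y (e : R) : 0 < K -> (gradN Omega p%:E v < K%:E)%E -> Omega y -> 0 < e ->
  \forall k \near \oo, `|phi k y - v y| <= e.
Proof.
move=> K0 vK Oy e0.
have e3 : 0 < e / 3 by rewrite divr_gt0.
have [eps [s [eps0 s0 hs]]] := mrate_small np (divr_gt0 e3 K0).
have vy : {for y, continuous v} := within_closure_continuous oO vC0.1 Oy.
have [t t0 ht] : exists2 t : R, 0 < t & forall x, ball y t x ->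
    [/\ Omega x, `|v y - v x| <= e / 3 & enorm (x - y) <= s].
  have /nbhs_ballP[t1 /= t10 h1] : nbhs y Omega by exact: open_nbhs_nbhs.
  move/cvgrPdist_le : vy => /(_ _ e3)/nbhs_ballP[t2 /= t20 h2].
  have t30 : 0 < s / (Num.sqrt n%:R + 1) by rewrite divr_gt0// ltr_wpDl.
  exists (Num.min t1 (Num.min t2 (s / (Num.sqrt n%:R + 1)))).
    by rewrite !lt_min t10 t20 t30.
  move=> x yx; split.
  - by apply: h1; apply: le_ball yx; rewrite ge_min lexx.
  - by apply: h2; apply: le_ball yx; rewrite !ge_min lexx orbT.
  apply: le_trans (enorm_le_norm _) _.
  have : `|x - y| < s / (Num.sqrt n%:R + 1).
    have : ball y (s / (Num.sqrt n%:R + 1)) x by apply: le_ball yx; rewrite !ge_min lexx !orbT.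
    by rewrite -ball_normE /= distrC.
  rewrite ltr_pdivlMr; last by rewrite ltr_wpDl.
  move=> /ltW; apply: le_trans; rewrite mulrC ler_wpM2l//.
  by rewrite lerDl.
pose U : set 'rV[R]_n := ball y t.
have oU : open U by exact: ball_open.
have mU : measurable U by exact: open_measurable_rV.
have UO : U `<=` Omega by move=> x /ht[].
have U0 : (0 < leb n U)%E by apply: open_leb_gt0 => //; exists y; exact: ballxx.
have Ufin : (leb n U < +oo)%E.
  apply: le_lt_trans (bounded_leb_lty mO bO).
  by apply: le_measure => //; rewrite inE//; exact: mO.
set m := fine (leb n U).
have mE : leb n U = m%:E by rewrite fineK// ge0_fin_numE// ltW.
have m0 : 0 < m by rewrite -lte_fin -mE.
(* The factor 1 / 2 makes the lower bound (e / 3)^p m and the upper bound (e / 3)^p m / 2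
   incompatible. *)
pose de := e / 3 * (m / 2) `^ p^-1.
have de0 : 0 < de by rewrite mulr_gt0// powR_gt0// divr_gt0.
apply: filterS2 (approx_K vK) (cvg0_near phi_v de0) => k hk hde.
rewrite leNgt; apply/negP => contra.
have far x : U x -> e / 3 <= `|phi k x - v x|.
  move=> /ht[Ox vx xs].
  have phix : `|phi k x - phi k y| <= e / 3.
    have := morrey_test x y (tphi k) np K0 eps0 (cgrad_powR_integral (tphi k) p0 K0 hk).
    move=> /le_trans; apply; rewrite -ler_pdivlMl// mulrC; exact: hs.
  have tri : `|phi k y - v y| <= `|phi k x - phi k y| + `|phi k x - v x| + `|v y - v x|.
    have -> : phi k y - v y = - (phi k x - phi k y) + (phi k x - v x) - (v y - v x) by ring.
    apply: le_trans (ler_normB _ _) _; rewrite lerD2r.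
    by apply: le_trans (ler_normD _ _) _; rewrite normrN.
  lra.
have : ((e / 3) `^ p * m <= (e / 3) `^ p * (m / 2)).
  have -> : (e / 3) `^ p * (m / 2) = de `^ p.
    rewrite /de (powRM _ (ltW e3) (powR_ge0 _ _)) -powRrM mulVf ?gt_eqF// powRr1//.
    by rewrite divr_ge0// ltW.
  rewrite -lee_fin; move: hde => /(LpN_leP _ _ p0 (ltW de0)) => hde.
  apply: le_trans hde.
  apply: (@le_trans _ _ (\int[leb n]_(x in U) (`|phi k x - v x| `^ p)%:E)%E); last first.
    apply: ge0_subset_integral => //; first exact: mO.
    apply: measurable_absX; apply: measurable_funB => //.
    exact: test_fun_measurable (tphi k).
  rewrite EFinM -mE -(integral_cst _ mU); apply: ge0_le_integral => //.
  - by move=> x _; rewrite lee_fin powR_ge0.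
  - apply: (measurable_funS mO UO); apply: measurable_absX; apply: measurable_funB => //.
    exact: test_fun_measurable (tphi k).
  - move=> x Ux; rewrite lee_fin ge0_ler_powR ?nnegrE ?(ltW p0) ?(ltW e3)//.
    exact: far.
rewrite ler_pM2l ?powR_gt0// => h.
by move: h; rewrite ler_pdivlMr// mulr2n mulrDr mulr1 gerDl leNgt m0.
Qed.

(** A second index [l], depending on [y], carries the pointwise convergence. The difference of
    [phi k] and [phi l] vanishes at the outside point, so its gradient norm alone bounds it, and [k]
    need not depend on [y]. *)
Lemma approx_uniform K (e : R) : 0 < K -> (gradN Omega p%:E v < K%:E)%E -> 0 < e ->
  \forall k \near \oo, (forall y, closure Omega y -> `|phi k y - v y| <= e) /\
    (\int[leb n]_x (enorm (cgrad (phi k) x) `^ p)%:E <= (K `^ p)%:E)%E.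
Proof.
move=> K0 vK e0.
have [z nz [D D0 hD]] := outside_point.
(* Bounds the modulus at scale 1 between [z] and any point of [Omega]; the added 1 makes it
   positive. *)
have Cgt0 : 0 < mrate p 1 D + 1 by rewrite ltr_wpDl// mrate_ge0// ltW.
set C := mrate p 1 D + 1 in Cgt0.
have de0 : 0 < e / (4 * C) by rewrite divr_gt0// mulr_gt0.
apply: filterS2 (approx_K vK) (approx_grad de0) => k hkK hk.
split; last exact: cgrad_powR_integral (tphi k) p0 K0 hkK.
move=> y cy; have [Oy|nOy] := pselect (Omega y); last first.
  have -> : v y = 0 by apply: vC0.2; split=> // /interior_subset.
  by rewrite (test_fun_out (tphi k) nOy) subr0 normr0 ltW.
have e2 : 0 < e / 2 by rewrite divr_gt0.
have [l [hl ly]] : exists l, (LpN Omega p%:E (fun x => enorm (cgrad (phi l) x - grad Omega v x)) <= (e / (4 * C))%:E)%E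
    /\ `|phi l y - v y| <= e / 2.
  near \oo => l; exists l; split; near: l; first exact: approx_grad.
  exact: approx_pointwise vK Oy e2.
have tkl := test_funB (tphi k) (tphi l).
pose f x := phi k x - phi l x.
have gkl : (LpN Omega p%:E (fun x => enorm (cgrad f x)) <= (e / (2 * C))%:E)%E.
  have E x : cgrad f x =
      (cgrad (phi k) x - grad Omega v x) + (grad Omega v x - cgrad (phi l) x).
    rewrite (cgradB x (test_fun_ck 1 (tphi k)) (test_fun_ck 1 (tphi l))).
    by rewrite addrA subrK.
  under eq_fun do rewrite E.
  have mm (j : nat) (i : 'I_n) : measurable_fun Omega (fun x => cgrad (phi j) x ord0 i - grad Omega v x ord0 i).
    by apply: measurable_funB => //; exact: test_measurable_partial.
  apply: le_trans (LpN_enormD p1 _ _) _.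
  - by move=> i; under eq_fun do rewrite mxE [X in _ + X]mxE; exact: mm.
  - move=> i; under eq_fun do rewrite mxE [X in _ + X]mxE.
    by apply: measurable_funB => //; exact: test_measurable_partial.
  have -> : e / (2 * C) = e / (4 * C) + e / (4 * C) by field; rewrite gt_eqF.
  rewrite EFinD leeD//.
  by under eq_fun do rewrite enormC.
have dd0 : 0 < e / (2 * C) by rewrite divr_gt0// mulr_gt0.
have := morrey_test y z tkl np dd0 ltr01 (cgrad_powR_integral tkl p0 dd0 gkl).
rewrite (test_fun_out tkl nz) subr0 => h.
have h2 : `|phi k y - phi l y| <= e / 2.
  apply: le_trans h _.
  apply: (@le_trans _ _ (e / (2 * C) * C)).
    rewrite ler_wpM2l ?(ltW dd0)//; apply: (@le_trans _ _ (mrate p 1 D)); last by rewrite lerDl.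
    by apply: mrateS; exact: hD.
  by rewrite le_eqVlt; apply/orP; left; apply/eqP; field; rewrite gt_eqF.
have -> : phi k y - v y = (phi k y - phi l y) + (phi l y - v y) by rewrite addrA subrK.
by rewrite [leRHS]splitr; apply: le_trans (ler_normD _ _) _; exact: lerD.
Unshelve. all: by end_near. Qed.

End approximation.

(** The defining sequence converges only in norm; Morrey's estimate makes it converge uniformly up
    to the boundary, while the strict bound keeps [K] valid for the approximants. *)
Lemma w1p0_approx p v K (e : R) : n%:R < p -> W1p0_cont Omega p v -> 0 < K ->
  (gradN Omega p%:E v < K%:E)%E -> 0 < e ->
  exists phi, [/\ test_fun Omega phi, (forall y, closure Omega y -> `|phi y - v y| <= e) &
    (\int[leb n]_x (enorm (cgrad phi x) `^ p)%:E <= (K `^ p)%:E)%E].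
Proof.
move=> np [[[[mv _] wg Lg] [phi [tphi h1 h2]]] vC0] K0 vK e0.
have mg (i : 'I_n) : measurable_fun Omega (fun x => grad Omega v x ord0 i) := (Lg i).1.
near \oo => k; exists (phi k).
have [hk1 hk2] : (forall y, closure Omega y -> `|phi k y - v y| <= e) /\
    (\int[leb n]_x (enorm (cgrad (phi k) x) `^ p)%:E <= (K `^ p)%:E)%E.
  by near: k; exact: approx_uniform.
by split.
Unshelve. all: by end_near. Qed.

Lemma morrey_w1p0 p v K eps x y : n%:R < p -> W1p0_cont Omega p v -> 0 < K -> 0 < eps ->
  (gradN Omega p%:E v < K%:E)%E -> closure Omega x -> closure Omega y ->
  `|v x - v y| <= K * mrate p eps (enorm (x - y)).
Proof.
move=> np vW K0 eps0 vK cx cy; apply/ler_addgt0Pr => e e0.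
have e2 : 0 < e / 2 by rewrite divr_gt0.
have [phi [tphi hphi gphi]] := w1p0_approx np vW K0 vK e2.
have := morrey_test x y tphi np K0 eps0 gphi.
have := hphi x cx; have := hphi y cy; rewrite (distrC (phi x)) => h1 h2 h3.
have -> : v x - v y = (v x - phi x) + (phi y - v y) + (phi x - phi y) by ring.
apply: le_trans (ler_normD _ _) _; rewrite addrC lerD// [e]splitr.
by apply: le_trans (ler_normD _ _) _; exact: lerD.
Qed.

End sobolev_morrey.

(** * Distance to the boundary and the upper bound for s_p *)

Section boundary_distance.
Context {R : realType} {n : nat}.
Variable Omega : set 'rV[R]_n.
Hypothesis oO : open Omega.
Implicit Types (x y z : 'rV[R]_n).

Lemma boundaryP y : boundary Omega y <-> closure Omega y /\ ~ Omega y.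
Proof. by rewrite /boundary (interior_id Omega).1. Qed.

(** Let [t0] be the first time the segment leaves [Omega]: openness puts [ga t0] outside, and
    earlier times put it in the closure. *)
Lemma segment_boundary x z : Omega x -> ~ Omega z ->
  exists2 y, boundary Omega y & enorm (x - y) <= enorm (x - z).
Proof.
move=> Ox nOz.
pose ga (t : R) := x + t *: (z - x).
have cga : continuous ga.
  move=> t; apply: (@continuousD _ _ _ (fun=> x) (fun t : R => t *: (z - x))).
    exact: cst_continuous.
  exact: scalel_continuous.
pose E : set R := [set t | 0 <= t /\ ~ Omega (ga t)].
have E1 : E 1 by split => //; rewrite /ga scale1r addrC subrK.
have lbE : lbound E 0 by move=> t [].
have infE : has_inf E by split; [exists 1|exists 0].
set t0 := inf E.
have t0_ge0 : 0 <= t0 by apply: lb_le_inf => //; exists 1.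
have t0_le1 : t0 <= 1 by apply: ge_inf => //; exists 0.
have below t : 0 <= t -> t < t0 -> Omega (ga t).
  move=> tge0 tt0; apply: contrapT => nO; move: tt0; rewrite ltNge => /negP; apply.
  by apply: ge_inf; [exists 0|split].
have nOt0 : ~ Omega (ga t0).
  move=> Ot0; have : nbhs (ga t0) Omega by exact: open_nbhs_nbhs.
  move=> /cga /nbhs_ballP[d /= d0 hd].
  have [t [tge0 nOt] td] := inf_adherent d0 infE.
  have t0t : t0 <= t by apply: ge_inf; [exists 0|split].
  move: td; rewrite -/t0 => td.
  by apply: nOt; apply: hd; rewrite /ball /= ltr_norml; apply/andP; split; lra.
have t0_gt0 : 0 < t0.
  rewrite lt_neqAle t0_ge0 andbT; apply/eqP => t00; apply: nOt0.
  by rewrite -t00 /ga scale0r addr0.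
exists (ga t0).
  apply/boundaryP; split => // B /cga /nbhs_ballP[d /= d0 hd].
  (* A time strictly between 0 and [t0], within [d] of [t0]. *)
  pose t := t0 - Num.min t0 d / 2.
  have m0 : 0 < Num.min t0 d by rewrite lt_min t0_gt0.
  have mt : Num.min t0 d <= t0 by rewrite ge_min lexx.
  have md : Num.min t0 d <= d by rewrite ge_min lexx orbT.
  exists (ga t); split; first by apply: below; rewrite /t; lra.
  by apply: hd; rewrite /ball /= /t opprB addrCA subrr addr0 ger0_norm; lra.
rewrite /ga opprD addrA subrr add0r enormN enormZ ger0_norm// enormC ler_piMl//.
exact: enorm_ge0.
Qed.

Hypothesis bO : bounded_set Omega.
Hypothesis n1 : (1 <= n)%N.

Local Notation bset x := [set enorm (x - y) | y in boundary Omega].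

Lemma bset_lbound x : lbound (bset x) 0.
Proof. by move=> _ [y _ <-]; exact: enorm_ge0. Qed.

Lemma bdist_le x y : boundary Omega y -> bdist Omega x <= enorm (x - y).
Proof. by move=> By; apply: ge_inf; [exists 0; exact: bset_lbound|exists y]. Qed.

Lemma bdist_ge0 x : 0 <= bdist Omega x.
Proof.
have [h|/set0P h] := eqVneq (bset x) set0; first by rewrite /bdist h inf0.
by apply: lb_le_inf => //; exact: bset_lbound.
Qed.

Lemma bdist_out x z : Omega x -> ~ Omega z -> bdist Omega x <= enorm (x - z).
Proof.
by move=> Ox nz; have [y By] := segment_boundary Ox nz; apply: le_trans; exact: bdist_le.
Qed.

Lemma boundary_nonempty x : Omega x -> boundary Omega !=set0.
Proof.
move=> Ox; have [z nz _] := outside_point bO n1.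
by have [y By _] := segment_boundary Ox nz; exists y.
Qed.

Lemma bdist_adherent x (e : R) : Omega x -> 0 < e ->
  exists2 y, boundary Omega y & enorm (x - y) < bdist Omega x + e.
Proof.
move=> Ox e0; have [y By] := boundary_nonempty Ox.
have hi : has_inf (bset x) by split; [exists (enorm (x - y)); exists y|exists 0; exact: bset_lbound].
by have [_ [w Bw <-] h] := inf_adherent e0 hi; exists w.
Qed.

Lemma bdist_gt0 x : Omega x -> 0 < bdist Omega x.
Proof.
move=> Ox; have /nbhs_ballP[e /= e0 h] : nbhs x Omega by exact: open_nbhs_nbhs.
apply: (lt_le_trans e0); have [y By] := boundary_nonempty Ox.
apply: lb_le_inf; first by exists (enorm (x - y)); exists y.
move=> _ [w /boundaryP[_ nw] <-]; rewrite leNgt; apply/negP => we; apply: nw; apply: h.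
by rewrite -ball_normE /=; exact: le_lt_trans (norm_le_enorm _) we.
Qed.

Lemma bdist_boundary x : boundary Omega x -> bdist Omega x = 0.
Proof.
move=> Bx; apply/eqP; rewrite eq_le bdist_ge0 andbT.
by apply: le_trans (bdist_le x Bx) _; rewrite subrr enorm0.
Qed.

Lemma gradN_lty (p : R) v : 1 <= p -> W1p Omega p%:E v -> (gradN Omega p%:E v < +oo)%E.
Proof.
move=> p1 [_ _ Lg]; apply: le_lt_trans (LpN_enorm_le_sum oO p1 _) _.
  by move=> i; exact: (Lg i).1.
by apply: lte_sum_pinfty => i _; exact: (Lg i).2.
Qed.

(** Morrey's estimate between [x] and a boundary point that is nearest up to [e], for any [K] above
    the gradient norm; then [e] tends to 0 and [K] to the norm. *)
Lemma w1p0_bdist_bound (p eps : R) v x : n%:R < p -> W1p0_cont Omega p v -> 0 < eps ->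
  Omega x -> `|v x| <= fine (gradN Omega p%:E v) * @mrate R n p eps (bdist Omega x).
Proof.
move=> np vW eps0 Ox.
have p1 : 1 <= p by apply: le_trans (ltW np); rewrite ler1n.
have gfin : gradN Omega p%:E v \is a fin_num.
  by rewrite ge0_fin_numE ?LpN_ge0// gradN_lty//; case: vW => -[].
set G := fine _; have G0 : 0 <= G by apply: fine_ge0; exact: LpN_ge0.
have A0 : 0 < eps `^ (- (n%:R / p)) by rewrite powR_gt0.
set A := eps `^ _ in A0.
have m0 : 0 <= @mrate R n p eps (bdist Omega x) by apply: mrate_ge0 => //; exact: bdist_ge0.
set m := @mrate _ _ _ _ _ in m0 *.
have h K e : G < K -> 0 < e -> `|v x| <= K * (m + e * A).
  move=> GK e0; have K0 : 0 < K := le_lt_trans G0 GK.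
  have [y By xy] := bdist_adherent Ox e0.
  have [cy ny] := (boundaryP y).1 By.
  have vK : (gradN Omega p%:E v < K%:E)%E by rewrite -[X in (X < _)%E]fineK// lte_fin.
  have := morrey_w1p0 oO bO n1 np vW K0 eps0 vK (subset_closure Ox) cy.
  rewrite (vW.2.2 y By) subr0 => /le_trans; apply.
  rewrite ler_wpM2l ?(ltW K0)// (_ : m + e * A = @mrate R n p eps (bdist Omega x + e)).
    by apply: mrateS; exact: ltW.
  by rewrite /m /mrate -/A; ring.
have h2 K : G < K -> `|v x| <= K * m.
  move=> GK; have K0 : 0 < K := le_lt_trans G0 GK.
  apply/ler_addgt0Pr => e e0.
  have e'0 : 0 < e / (K * A) by rewrite divr_gt0// mulr_gt0.
  have := h K _ GK e'0; rewrite mulrDr (_ : K * (e / (K * A) * A) = e)//.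
  by field; rewrite !gt_eqF.
apply/ler_addgt0Pr => e e0.
have e'0 : 0 < e / (m + 1) by rewrite divr_gt0// ltr_wpDl.
have := h2 (G + e / (m + 1)); rewrite ltrDl => /(_ e'0) /le_trans; apply.
rewrite mulrDl lerD2l mulrAC ler_pdivrMr ?ltr_wpDl//.
by rewrite ler_wpM2l ?(ltW e0)// lerDl.
Qed.

Lemma sp_le (p eps : R) x : n%:R < p -> 0 < eps -> Omega x ->
  (sp Omega p x <= (@mrate R n p eps (bdist Omega x))%:E)%E.
Proof.
move=> np eps0 Ox; rewrite /sp mem_set//.
apply: ge_ereal_sup => _ [v [vW _] <-]; rewrite lee_fin.
have G0 : 0 <= fine (gradN Omega p%:E v) by apply: fine_ge0; exact: LpN_ge0.
(* If the gradient norm is 0, the quotient is 0 by the convention on inverses. *)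
move: G0; rewrite le_eqVlt => /predU1P[<-|G0].
  by rewrite invr0 mulr0; apply: mrate_ge0 => //; exact: bdist_ge0.
by rewrite ler_pdivrMr// mulrC; exact: w1p0_bdist_bound.
Qed.

End boundary_distance.

(** * Test functions as elements of W_0^{1,p} *)

Section test_in_w1p0.
Context {R : realType} {n : nat}.
Variable Omega : set 'rV[R]_n.
Hypothesis oO : open Omega.
Hypothesis bO : bounded_set Omega.
Implicit Types (phi f : 'rV[R]_n -> R).
Local Notation mO := (measurable_Omega oO).

Lemma bounded_LpN (p B : R) f : 0 < p -> 0 <= B -> measurable_fun Omega f ->
  (forall x, Omega x -> `|f x| <= B) ->
  (LpN Omega p%:E f <= (B * fine (leb n Omega) `^ p^-1)%:E)%E.
Proof.
move=> p0 B0 mf fB.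
have K0 : 0 <= B * fine (leb n Omega) `^ p^-1 by rewrite mulr_ge0// powR_ge0.
apply/(LpN_leP _ _ p0 K0).
set m := fine _; have m0 : 0 <= m by exact: fine_ge0.
have mE : leb n Omega = m%:E.
  by rewrite fineK// ge0_fin_numE//; exact: bounded_leb_lty mO bO.
rewrite powRM ?powR_ge0// -powRrM mulVf ?gt_eqF// powRr1// EFinM -mE.
rewrite -(integral_cst _ mO); apply: ge0_le_integral => //.
- exact: mO.
- exact: measurable_absX.
- move=> x Ox; rewrite lee_fin ge0_ler_powR ?nnegrE ?(ltW p0)//.
  exact: fB.
Qed.

Lemma grad_test_ae phi : test_fun Omega phi ->
  {ae leb n, forall x, Omega x -> grad Omega phi x = cgrad phi x}.
Proof.
move=> tphi; apply: weak_gradient_unique => //; last exact: test_weak_gradient.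
exact: (weak_gradient_grad (test_weak_gradient oO tphi)).
Qed.

(** The constant sequence approximates [phi]: the weak gradient agrees with the classical one off a
    null set, so the differences have norm 0. *)
Lemma test_w1p0_cont (p : R) phi : 1 <= p -> test_fun Omega phi -> W1p0_cont Omega p phi.
Proof.
move=> p1 tphi; have p0 : 0 < p := lt_le_trans ltr01 p1.
have wg : weak_gradient Omega phi (grad Omega phi).
  exact: (weak_gradient_grad (test_weak_gradient oO tphi)).
have mg (i : 'I_n) : measurable_fun Omega (fun x => grad Omega phi x ord0 i).
  exact: ((wg.2 i).1).1.
have mphi : measurable_fun Omega phi := test_fun_measurable tphi.
have [B [hB gB]] := test_fun_bounds tphi.
have B0 : 0 <= B := le_trans (normr_ge0 _) (hB 0).
have mcg (i : 'I_n) : measurable_fun Omega (fun x => cgrad phi x ord0 i) := test_measurable_partial i tphi.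
have fin f : measurable_fun Omega f -> (forall x, Omega x -> `|f x| <= B) ->
    (LpN Omega p%:E f < +oo)%E.
  by move=> mf fB; apply: le_lt_trans (bounded_LpN p0 B0 mf fB) _; rewrite ltry.
have Z f : measurable_fun Omega f -> {ae leb n, forall x, Omega x -> f x = 0} ->
    LpN Omega p%:E f = 0%E.
  move=> mf f0; apply/eqP; rewrite eq_le LpN_ge0 andbT.
  apply: (@le_trans _ _ (LpN Omega p%:E (fun=> 0))).
    apply: ae_LpN_le => //; first exact: mO.
    by apply: filterS f0 => x f0 Ox; rewrite f0.
  have := @bounded_LpN p 0 (fun=> 0) p0 (lexx _); rewrite mul0r; apply => //.
  by move=> x _; rewrite normr0.
split; last first.
  split; last by move=> y /(boundaryP oO)[_ ny]; exact: test_fun_out tphi ny.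
  apply: continuous_subspaceT; exact: (ck_continuous (test_fun_ck 0 tphi)).
split.
  split => //; first by split => //; exact: fin.
  move=> i; split => //.
  apply: le_lt_trans (fin _ (mcg i) _); last first.
    by move=> x _; exact: le_trans (coord_le_enorm _ _) (gB x).
  apply: ae_LpN_le => //; first exact: mO.
  by apply: filterS (grad_test_ae tphi) => x h Ox; rewrite h.
exists (fun=> phi); split => //.
  rewrite (_ : (fun=> _) = fun=> 0%E); first exact: cvg_cst.
  apply/funext => k; apply: Z; first by apply: measurable_funB.
  by apply: aeW => x _; rewrite subrr.
move=> i; rewrite (_ : (fun=> _) = fun=> 0%E); first exact: cvg_cst.
apply/funext => k; apply: Z.
  apply: measurable_funB => //; exact: (test_fun_measurable (test_fun_partial i tphi)).
by apply: filterS (grad_test_ae tphi) => x h Ox; rewrite h// mxE subrr.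
Qed.

(** Used for the cones: |Omega|^(1/p) tends to 1, so a slope at most 1 costs nothing in the
    limit. *)
Lemma gradN_test_le (p : R) phi : 1 <= p -> test_fun Omega phi ->
  (forall x, enorm (cgrad phi x) <= 1) ->
  (gradN Omega p%:E phi <= (fine (leb n Omega) `^ p^-1)%:E)%E.
Proof.
move=> p1 tphi g1; have p0 : 0 < p := lt_le_trans ltr01 p1.
have mcg : measurable_fun Omega (fun x => enorm (cgrad phi x)).
  by apply: measurable_enorm => i; exact: test_measurable_partial.
rewrite -[fine _ `^ _]mul1r.
apply: le_trans (bounded_LpN p0 ler01 mcg _); last first.
  by move=> x _; rewrite ger0_norm ?enorm_ge0.
apply: ae_LpN_le => //; first exact: mO.
  apply: measurable_enorm => i.
  have := weak_gradient_grad (test_weak_gradient oO tphi).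
  by move=> [_ /(_ i)[[]]].
by apply: filterS (grad_test_ae tphi) => x h Ox; rewrite h.
Qed.

End test_in_w1p0.

(** * Smooth cones *)

Section cone.
Context {R : realType} {n : nat}.
Variables (y : 'rV[R]_n) (r de : R).
Hypothesis de0 : 0 < de.

Let rho (x : 'rV[R]_n) : R := Num.sqrt (\sum_i (x ord0 i - y ord0 i) ^+ 2 + de ^+ 2).

(* A smooth minorant of [r - |x - y|]: [rho] smooths the distance and
   [t exp (- de / t)] the positive part. *)
Definition cone (x : 'rV[R]_n) : R := (r - rho x) * flat 0 ((r - rho x) / de).

Let sq_gt0 (x : 'rV[R]_n) : 0 < \sum_i (x ord0 i - y ord0 i) ^+ 2 + de ^+ 2.
Proof. by rewrite ltr_wpDl ?exprn_gt0// sumr_ge0// => i _; exact: sqr_ge0. Qed.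

Let rho_gt0 x : 0 < rho x. Proof. by rewrite sqrtr_gt0. Qed.

Let enorm_le_rho (x : 'rV[R]_n) : enorm (x - y) <= rho x.
Proof.
rewrite ler_wsqrtr// (eq_bigr (fun i => (x ord0 i - y ord0 i) ^+ 2)) ?lerDl ?sqr_ge0//.
by move=> i _; rewrite !mxE.
Qed.

Let ck_sq k : ck k (fun x : 'rV[R]_n => \sum_i (x ord0 i - y ord0 i) ^+ 2 + de ^+ 2).
Proof.
apply: ckD; last exact: ck_cst.
apply: ck_sum => i; rewrite (_ : (fun _ => _) = fun x : 'rV[R]_n =>
  (x ord0 i - y ord0 i) * (x ord0 i - y ord0 i)); last by apply/funext => x; rewrite expr2.
by apply: ckM; apply: ckB; [exact: ck_coord|exact: ck_cst|exact: ck_coord|exact: ck_cst].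
Qed.

Let ck_rho k : ck k rho.
Proof. exact: (ck_sqrt sq_gt0 (ck_sq k)). Qed.

Lemma ck_cone k : ck k cone.
Proof.
have h : ck k (fun x => r - rho x) by apply: ckB; [exact: ck_cst|exact: ck_rho].
apply: ckM => //; apply: ck_flat.
rewrite (_ : (fun _ => _) = fun x => de^-1 * (r - rho x)); first exact: ckZ.
by apply/funext => x; rewrite mulrC.
Qed.

Lemma cone_supp (x : 'rV[R]_n) : cone x != 0 -> enorm (x - y) <= r.
Proof.
apply: contra_neqT; rewrite -ltNge => h; rewrite /cone flat0_eq0 ?mulr0//.
rewrite pmulr_lle0 ?invr_gt0// subr_le0; apply: ltW; exact: lt_le_trans h (enorm_le_rho x).
Qed.

(** At the centre [rho] equals [de], so for r > de the value is (r - de) exp (- de / (r - de)), and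
    exp x >= 1 + x. *)
Lemma cone_center : r - de - de <= cone y.
Proof.
have -> : cone y = (r - de) * flat 0 ((r - de) / de).
  rewrite /cone /rho big1 ?add0r ?sqrtr_sqr ?gtr0_norm// => i _.
  by rewrite subrr expr0n.
have [h|h] := leP (r - de) 0.
  rewrite flat0_eq0 ?mulr0; first by rewrite subr_le0 (le_trans h)// ltW.
  by rewrite pmulr_lle0// invr_gt0.
rewrite /flat divr_gt0// expr0 invr1 mul1r invf_div.
apply: (@le_trans _ _ ((r - de) * (1 - de / (r - de)))).
  by rewrite le_eqVlt; apply/orP; left; apply/eqP; field; rewrite gt_eqF.
by rewrite ler_wpM2l ?(ltW h)//; exact: expR_ge1Dx.
Qed.

(** For t > 0 the profile t exp (- de / t) has derivative (1 + de / t) exp (- de / t), between 0 and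
    1 because 1 + s <= exp s; and the gradient (x - y) / rho of [rho] has norm at most 1. *)
Lemma cone_grad (x : 'rV[R]_n) : enorm (cgrad cone x) <= 1.
Proof.
pose psi (t : R) := t * flat 0 (t / de).
pose dpsi (t : R) := flat 0 (t / de) + t * (flat 2 (t / de) / de).
have dpsiP (t : R) : is_derive t 1 psi (dpsi t).
  have h1 : is_derive t 1 (fun t : R => t / de) de^-1.
    rewrite (_ : (fun t : R => t / de) = de^-1 *: (@id R)); last first.
      by apply/funext => s; rewrite mulrC.
    by rewrite -[X in is_derive _ _ _ X]mulr1; apply: is_deriveZ.
  have h2 : is_derive t 1 (fun t : R => flat 0 (t / de)) (flat 2 (t / de) / de).
    apply: (@is_derive1_comp _ (flat 0) (fun t => t / de)) => //.
    by have := flat_derive 0 (t / de); rewrite mul0r subr0.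
  have := is_deriveM (is_derive_id t 1) h2.
  rewrite (_ : _ + _ = dpsi t)//.
  by rewrite /dpsi /GRing.scale /= mulr1 addrC.
have dpsi0 t : 0 <= dpsi t <= 1.
  rewrite /dpsi /flat; case: ifPn => [h|_]; last by rewrite mul0r mulr0 addr0 lexx ler01.
  set s := t / de in h *.
  have -> : t * (s ^- 2 * expR (- s^-1) / de) = s^-1 * expR (- s^-1).
    have t0 : t != 0 by apply/eqP => t0; move: h; rewrite /s t0 mul0r ltxx.
    by rewrite /s; move: (expR _) => E; field; rewrite t0 gt_eqF.
  have -> : s ^- 0 * expR (- s^-1) + s^-1 * expR (- s^-1) = (1 + s^-1) / expR s^-1.
    by rewrite expr0 invr1 expRN -mulrDl.
  have s0 : 0 <= s^-1 by rewrite invr_ge0 ltW.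
  by rewrite divr_ge0 ?expR_ge0 ?addr_ge0//= ler_pdivrMr ?expR_gt0// mul1r expR_ge1Dx.
have E (i : 'I_n) : partial i cone x = - (dpsi (r - rho x) / rho x) * (x - y) ord0 i.
  have hr : is_derive x (delta_mx ord0 i) rho ((rho x)^-1 * (x - y) ord0 i).
    have hco (j : 'I_n) : is_derive x (delta_mx ord0 i : 'rV[R]_n)
        (fun z : 'rV[R]_n => z ord0 j - y ord0 j) ((i == j)%:R : R).
      apply/is_derive_slice.
      rewrite (_ : (fun _ => _) = cst (x ord0 j - y ord0 j) + (i == j)%:R *: (@id R)); last first.
        apply/funext => t; rewrite !mxE eqxx /= -[RHS]/(_ + _ * t) (eq_sym j) /=; ring.
      rewrite -[X in is_derive _ _ _ X]add0r -[X in is_derive _ _ _ (_ + X)]mulr1.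
      by apply: is_deriveD; apply: is_deriveZ.
    have hs := is_derive_sum (fun j => is_deriveM (hco j) (hco j)).
    have hs2 := is_deriveD hs (is_derive_cst (de ^+ 2) x (delta_mx ord0 i : 'rV[R]_n)).
    have hs3 : is_derive x (delta_mx ord0 i : 'rV[R]_n)
        (fun z : 'rV[R]_n => \sum_j (z ord0 j - y ord0 j) ^+ 2 + de ^+ 2) (2 * (x - y) ord0 i).
      move: hs2; rewrite fct_sumE addr0.
      rewrite (_ : (fun z : 'rV[R]_n => _) + _ =
        (fun z : 'rV[R]_n => \sum_j (z ord0 j - y ord0 j) ^+ 2 + de ^+ 2)); last first.
        by apply/funext => z; rewrite -[LHS]/(_ + _) /=; congr (_ + _).
      rewrite (_ : \sum_(j < n) (_ + _) = 2 * (x - y) ord0 i)//.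
      rewrite (bigD1 i)//= eqxx big1 => [|j ji].
        by rewrite addr0 /GRing.scale /= !mxE; ring.
      by rewrite eq_sym (negbTE ji) /GRing.scale /=; ring.
    have -> : (rho x)^-1 * (x - y) ord0 i = (2 * rho x)^-1 * (2 * (x - y) ord0 i).
      by field; rewrite gt_eqF.
    exact: (is_derive_comp hs3 (is_derive1_sqrt (sq_gt0 x))).
  have hc := is_derive_comp (is_deriveB (is_derive_cst r x (delta_mx ord0 i)) hr) (dpsiP (r - rho x)).
  have [_ hE] := hc.
  rewrite -[LHS]/('D_(delta_mx ord0 i) (psi \o (cst r - rho)) x) hE sub0r; ring.
have -> : cgrad cone x = - (dpsi (r - rho x) / rho x) *: (x - y).
  by apply/rowP => i; rewrite [LHS]mxE E [RHS]mxE.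
have /andP[d0 d1] := dpsi0 (r - rho x).
rewrite enormZ normrN ger0_norm; last by rewrite divr_ge0// ltW.
rewrite mulrAC ler_pdivrMr// mul1r.
apply: le_trans (enorm_le_rho x).
by rewrite ler_piMl// enorm_ge0.
Qed.

End cone.

(** * Limits of the constants as p tends to infinity *)

Section limits.
Context {R : realType}.

Lemma invr_cvg_pinfty : (p^-1 : R) @[p --> +oo] --> (0 : R).
Proof.
apply/gtr0_cvgV0; first exact: nbhs_pinfty_gt.
exact: cvg_id.
Qed.

Lemma powR_cvg_pinfty (a c b : R) : 0 < a ->
  a `^ (c + b * p^-1) @[p --> +oo] --> a `^ c.
Proof.
move=> a0; have E x : a `^ x = expR (x * ln a) by rewrite /powR gt_eqF.
rewrite E; under eq_fun do rewrite E.
apply: (@continuous_cvg _ _ _ _ _ _ expR); first exact: continuous_expR.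
apply: cvgMl; rewrite -[X in _ --> X]addr0 -[X in _ --> c + X](mulr0 b).
apply: cvgD; first exact: cvg_cst.
by apply: cvgMr; exact: invr_cvg_pinfty.
Qed.

Lemma mrate_cvg (n : nat) (eps d : R) : 0 < eps ->
  @mrate R n p eps d @[p --> +oo] --> d + 2 * (Num.sqrt n%:R * eps).
Proof.
move=> e0; apply: cvgD.
  rewrite -[X in _ --> X]mulr1; apply: cvgMr.
  rewrite -(powRr0 eps); under eq_fun do rewrite -[- _]add0r -mulNr.
  exact: powR_cvg_pinfty.
apply: cvgMr; apply: cvgMr; rewrite -[X in _ --> X]mulr1; apply: cvgM.
  rewrite -[X in _ --> X](powRr1 (ltW e0)).
  under eq_fun do rewrite -mulNr.
  exact: powR_cvg_pinfty.
rewrite -[X in _ --> X]invr1; apply: cvgV; first exact: oner_neq0.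
rewrite -[X in _ --> X]subr0 -[X in _ --> _ - X](mulr0 n%:R).
apply: cvgB; first exact: cvg_cst.
by apply: cvgMr; exact: invr_cvg_pinfty.
Qed.

End limits.

(** * The limit of s_p *)

Section sp_limit.
Context {R : realType} {n : nat}.
Variable Omega : set 'rV[R]_n.
Hypothesis oO : open Omega.
Hypothesis bO : bounded_set Omega.
Hypothesis n1 : (1 <= n)%N.

(** The cone lives in the closed Euclidean ball of radius [r], which contains no point outside
    [Omega] since those are at distance at least [bdist Omega y]. *)
Lemma test_cone (y : 'rV[R]_n) (r de : R) : 0 < de -> Omega y -> r < bdist Omega y ->
  test_fun Omega (cone y r de).
Proof.
move=> de0 Oy ry; apply: (@test_fun_of _ _ _ _ [set x | enorm (x - y) <= r]).
- by move=> k; exact: ck_cone.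
- apply: bounded_closed_compact.
    exists (`|y| + r); split; first exact: num_real.
    move=> M rM x /= xr; apply: le_trans (ltW rM).
    rewrite -[x](subrK y) addrC; apply: le_trans (ler_normD _ _) _.
    by rewrite lerD2l; exact: le_trans (norm_le_enorm _) xr.
  apply: (@preimage_closed _ _ (fun x : 'rV[R]_n => enorm (x - y)) [set t | t <= r]); last exact: closed_le.
  move=> x _; apply: (@continuous_comp _ _ _ (fun x : 'rV[R]_n => x - y) (@enorm R n)).
    apply: (@continuousB _ _ _ (fun x => x) (fun=> y)); first exact: cvg_id.
    exact: cst_continuous.
  exact: enorm_continuous.
- move=> x /= xr; apply: contrapT => nx; move: ry; rewrite ltNge => /negP; apply.
  by apply: le_trans xr; rewrite enormC; exact: (bdist_out oO Oy nx).
- by move=> x; exact: cone_supp.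
Qed.

Lemma sp_ge (y : 'rV[R]_n) (p r de : R) : n%:R < p -> 0 < de -> Omega y ->
  r < bdist Omega y -> 0 < r - de - de ->
  (((r - de - de) / (fine (leb n Omega) `^ p^-1))%:E <= sp Omega p y)%E.
Proof.
move=> np de0 Oy ry rde.
have p1 : 1 <= p by apply: le_trans (ltW np); rewrite ler1n.
have tphi := test_cone de0 Oy ry.
have phiW := test_w1p0_cont oO bO p1 tphi.
have cy := @cone_center R n y r de de0.
set phi := cone y r de in tphi phiW cy.
have phiy : 0 < phi y := lt_le_trans rde cy.
have Gm := gradN_test_le oO bO p1 tphi (cone_grad y r de0).
have gfin : gradN Omega p%:E phi \is a fin_num.
  by rewrite ge0_fin_numE ?LpN_ge0// (le_lt_trans Gm)// ltry.
rewrite -[X in (X <= _)%E]fineK// lee_fin in Gm.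
(* A zero norm would make the quotient 0 by convention; it is excluded because it would force [phi]
   to vanish at [y]. *)
have G0 : 0 < fine (gradN Omega p%:E phi).
  rewrite lt_neqAle fine_ge0 ?LpN_ge0// andbT eq_sym; apply/eqP => G0.
  have := w1p0_bdist_bound oO bO n1 np phiW ltr01 Oy.
  by rewrite G0 mul0r normr_le0 gt_eqF.
apply: (@le_trans _ _ (`|phi y| / fine (gradN Omega p%:E phi))%:E).
  rewrite lee_fin gtr0_norm// ler_pM ?(ltW rde)//.
    by rewrite invr_ge0 powR_ge0.
  by rewrite lef_pV2// posrE (lt_le_trans G0).
rewrite /sp mem_set//; apply: ereal_sup_ubound; exists phi => //; split => //.
by exists y => //; rewrite gt_eqF.
Qed.

Lemma sp_near (y : 'rV[R]_n) (e : R) : Omega y -> 0 < e ->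
  \forall p \near +oo, ((bdist Omega y - e)%:E <= sp Omega p y)%E /\
    (sp Omega p y <= (bdist Omega y + e)%:E)%E.
Proof.
move=> Oy e0; set d := bdist Omega y.
have d0 : 0 < d by exact: bdist_gt0.
have up : \forall p \near +oo, (sp Omega p y <= (d + e)%:E)%E.
  have sn0 : 0 < Num.sqrt n%:R :> R by rewrite sqrtr_gt0 ltr0n.
  (* Chosen so that the limit of [mrate] is d + e / 2. *)
  pose eps := e / (4 * Num.sqrt n%:R).
  have eps0 : 0 < eps by rewrite divr_gt0// mulr_gt0.
  have lt : d + 2 * (Num.sqrt n%:R * eps) < d + e.
    rewrite ltrD2l (_ : 2 * _ = e / 2) ?ltr_pdivrMr ?ltr_pMr ?ltr1n//.
    by rewrite /eps; field; rewrite gt_eqF.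
  have h := cvgr_lt _ (@mrate_cvg R n eps d eps0) _ lt.
  near=> p; apply: le_trans (sp_le oO bO n1 _ eps0 Oy) _.
    by near: p; apply: nbhs_pinfty_gt.
  by rewrite lee_fin ltW//; near: p; exact: h.
have lo : \forall p \near +oo, ((d - e)%:E <= sp Omega p y)%E.
  (* With [e'] at most [e] and [d], the value r - 2 de = d - 3 e' / 8 is positive and exceeds d -
     e. *)
  pose e' := Num.min e d; have e'0 : 0 < e' by rewrite lt_min e0.
  have e'e : e' <= e by rewrite ge_min lexx.
  have e'd : e' <= d by rewrite ge_min lexx orbT.
  pose de := e' / 8; pose r := d - de.
  have de0 : 0 < de by rewrite divr_gt0.
  have rd : r < d by rewrite gtrDl oppr_lt0.
  have rde : 0 < r - de - de by rewrite /r /de; lra.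
  set m := fine (leb n Omega).
  have m0 : 0 < m.
    apply: fine_gt0; rewrite open_leb_gt0//=; last by exists y.
    exact: bounded_leb_lty (measurable_Omega oO) bO.
  have h : (r - de - de) / (m `^ p^-1) @[p --> +oo] --> r - de - de.
    rewrite -[X in _ --> X]divr1; apply: cvgMr; apply: cvgV; first exact: oner_neq0.
    rewrite -(powRr0 m); under eq_fun do rewrite -[_^-1]add0r -[_^-1]mul1r.
    exact: powR_cvg_pinfty.
  have lt : d - e < r - de - de by rewrite /r /de; lra.
  have h2 := cvgr_gt _ h _ lt.
  near=> p; apply: (@le_trans _ _ ((r - de - de) / (m `^ p^-1))%:E).
    by rewrite lee_fin ltW//; near: p; exact: h2.
  apply: sp_ge => //; near: p; exact: nbhs_pinfty_gt.
by near=> p; split; near: p.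
Unshelve. all: by end_near. Qed.

Lemma sp_cvg (y : 'rV[R]_n) : closure Omega y ->
  sp Omega p y @[p --> +oo] --> (bdist Omega y)%:E.
Proof.
move=> cy; have [Oy|nOy] := pselect (Omega y); last first.
  have -> : (fun p => sp Omega p y) = fun=> 0%E.
    by apply/funext => p; rewrite /sp memNset.
  rewrite bdist_boundary//; first exact: cvg_cst.
  exact/(boundaryP oO).
apply/fine_cvgP; split.
  apply: filterS (sp_near Oy ltr01) => p [h1 h2].
  by rewrite fin_numE -ltNye -ltey (lt_le_trans _ h1) ?ltNyr// (le_lt_trans h2) ?ltry.
apply/cvgrPdist_le => e e0; apply: filterS (sp_near Oy e0) => p [h1 h2].
have fin : sp Omega p y \is a fin_num.
  by rewrite fin_numE -ltNye -ltey (lt_le_trans _ h1) ?ltNyr// (le_lt_trans h2) ?ltry.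
rewrite -(fineK fin) !lee_fin in h1 h2.
by rewrite /= ler_norml; apply/andP; split; lra.
Qed.

End sp_limit.

(** * An Ascoli theorem for asymptotically equicontinuous sequences *)

Section ascoli.

(** Along an ultrafilter a cluster point is a limit, since the preimage of each neighbourhood or its
    complement is in the ultrafilter. *)
Lemma ultra_compact_cvg (I : Type) (X : topologicalType) (U : set_system I)
    (f : I -> X) (A : set X) : UltraFilter U -> compact A -> U (f @^-1` A) ->
  exists2 p, A p & f @ U --> p.
Proof.
move=> UU cA fA; have [p [Ap clp]] := cA (f @ U) _ fA.
exists p => // B Bp; have [//|nB] := in_ultra_setVsetC (f @^-1` B) UU.
by have [q [/= nq Bq]] := clp (~` B) B nB Bp.
Qed.

Lemma increasing_selection (P : nat -> nat -> Prop) :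
  (forall j N, exists2 k, (N <= k)%N & P j k) ->
  exists sigma : nat -> nat, {homo sigma : i j / (i < j)%N} /\ forall j, P j (sigma j).
Proof.
move=> h.
have /choice[s sP] (jN : nat * nat) : exists k, (jN.2 <= k)%N /\ P jN.1 k.
  by have [k] := h jN.1 jN.2; exists k.
(* Asking for an index beyond the previous value makes [sigma] strictly increasing. *)
pose fix sigma j := if j is i.+1 then s (i.+1, (sigma i).+1) else s (0%N, 0%N).
exists sigma; split; last first.
  by case=> [|j]; [exact: (sP (0%N, 0%N)).2|exact: (sP (j.+1, (sigma j).+1)).2].
apply: homo_ltn => [i j k|i]; first exact: ltn_trans.
exact: (sP (i.+1, (sigma i).+1)).1.
Qed.

(* The limit is taken along an ultrafilter: if the convergence along it were
   not uniform, the bad points would themselves converge along it. *)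
Lemma ascoli_sequence (R : realType) (V : normedModType R) (C : set V)
    (f : nat -> V -> R) : compact C ->
  (forall k y, C y -> `|f k y| <= 1) ->
  (forall e : R, 0 < e -> exists2 d : R, 0 < d & \forall k \near \oo,
     forall a b, C a -> C b -> `|a - b| < d -> `|f k a - f k b| <= e) ->
  exists sigma : nat -> nat, {homo sigma : i j / (i < j)%N} /\
  exists g : V -> R, forall e : R, 0 < e ->
    \forall j \near \oo, forall y, C y -> `|f (sigma j) y - g y| <= e.
Proof.
move=> cC f1 fequi.
have [U [UU ooU]] := @ultraFilterLemma nat \oo _.
have /choice[g gP] (y : V) : exists l : R, C y -> f ^~ y @ U --> l.
  have [Cy|nCy] := pselect (C y); last by exists 0.
  have [|l _ hl] := @ultra_compact_cvg nat R U (f ^~ y) `[-1, 1]%classic UU (@segment_compact R _ _).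
    apply: ooU; exists 0%N => // k _ /=; rewrite in_itv /= -ler_norml; exact: f1.
  by exists l.
have key (e : R) : 0 < e -> U [set k | forall y, C y -> `|f k y - g y| <= e].
  move=> e0; have e4 : 0 < e / 4 by rewrite divr_gt0.
  have [//|nU] := in_ultra_setVsetC [set k | forall y, C y -> `|f k y - g y| <= e] UU.
  exfalso.
  (* [w k] is a bad point of [f k], if it has one; its value is irrelevant otherwise. *)
  have /choice[w wP] (k : nat) : exists y : V, (~ forall y, C y -> `|f k y - g y| <= e) ->
      C y /\ e < `|f k y - g y|.
    have [h|h] := pselect (forall y, C y -> `|f k y - g y| <= e); first by exists 0.
    move/existsNP : h => [y /not_implyP[Cy /negP]]; rewrite -ltNge => hy.
    by exists y.
  have wC : U (w @^-1` C) by apply: filterS nU => k /= /wP[].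
  have [y Cy wy] := @ultra_compact_cvg nat V U w C UU cC wC.
  have [d d0 hd] := fequi _ e4.
  have near_w : U [set k | `|y - w k| < d].
    by move/cvgrPdist_lt : wy => /(_ _ d0).
  have fy : U [set k | `|g y - f k y| <= e / 4].
    by move/cvgrPdist_le : (gP y Cy) => /(_ _ e4).
  (* The asymptotic modulus of the [f k] passes to their pointwise limit along [U]. *)
  have gg z : C z -> `|y - z| < d -> `|g y - g z| <= e / 4.
    move=> Cz yz.
    have hc : (fun k => `|f k y - f k z|) @ U --> `|g y - g z|.
      apply: cvg_norm; apply: cvgB; exact: gP.
    apply: (@closed_cvg _ _ U _ (fun k => `|f k y - f k z|) [set t | t <= e / 4] _ _ _ hc).
      exact: closed_le.
    by apply: filterS (ooU _ hd) => k /=; apply.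
  have : U set0.
    apply: filterS (filterI (filterI nU near_w) (filterI fy (ooU _ hd))).
    move=> k /= [[/wP[Cw bad] yw] [fk hk]].
    have h1 := hk _ _ Cy Cw yw.
    have h2 := gg _ Cw yw.
    have : `|f k (w k) - g (w k)| <= e / 4 + e / 4 + e / 4.
      have -> : f k (w k) - g (w k) =
          - (f k y - f k (w k)) - (g y - f k y) + (g y - g (w k)) by ring.
      apply: le_trans (ler_normD _ _) _; apply: lerD => //.
      by apply: le_trans (ler_normB _ _) _; rewrite normrN; apply: lerD.
    by move=> h3; move: bad; rewrite ltNge => /negP; apply; lra.
  exact: filter_not_empty.
(* [U] refines the filter at infinity, so each of its sets contains arbitrarily large indices and a
   genuine subsequence can be extracted. *)
have [j N|sigma [hs sP]] := @increasing_selection (fun j k => forall y, C y -> `|f k y - g y| <= j.+1%:R^-1).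
  have Nk : U [set k | (N <= k)%N] by apply: ooU; exists N.
  have j0 : 0 < (j.+1%:R^-1 : R) by [].
  have [k [Nk' hk]] := filter_ex (filterI Nk (key _ j0)).
  by exists k.
exists sigma; split => //; exists g => e e0.
have [m _ hm] := near_infty_natSinv_lt (PosNum e0).
exists m => // j /= mj y Cy; apply: le_trans (sP j y Cy) _.
by apply: ltW; exact: hm.
Qed.

End ascoli.

(** * Near-minimizers of a quadratic energy on decreasing classes *)

Section minimizing_sequence.
Context {R : realType} {T : Type}.
Variables (S : nat -> set T) (E : T -> R) (mid half : T -> T -> T).
Hypothesis S0 : forall j, S j !=set0.
Hypothesis SS : forall j, S j.+1 `<=` S j.
Hypothesis Smid : forall j f g, S j f -> S j g -> S j (mid f g).
Hypothesis E0 : forall f, 0 <= E f.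
Variable B : R.
Hypothesis EB : forall f, S 0 f -> E f <= B.
Hypothesis parallelogram : forall f g, S 0 f -> S 0 g ->
  E (mid f g) + E (half f g) = (E f + E g) / 2.

Let Sle i j : (i <= j)%N -> S j `<=` S i.
Proof.
by move=> /subnK <-; elim: (j - i)%N => [|k IHk] //; apply: subset_trans IHk; exact: SS.
Qed.

(** The infima over the decreasing classes increase to a finite limit [l]. Far enough out, the
    energies of [F j] and [F k] are at most l + eps_j / 2 and that of their midpoint is at least l -
    eps_j / 2, so the parallelogram law leaves at most eps_j for the half difference. *)
Lemma minimizing_sequence (eps : nat -> R) : (forall j, 0 < eps j) ->
  exists F : nat -> T, (forall j, S j (F j)) /\
    forall j k, (j <= k)%N -> E (half (F j) (F k)) <= eps j.
Proof.
move=> eps00; pose e2 j := eps j / 2.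
have eps0 j : 0 < e2 j by rewrite divr_gt0.
pose I j := inf [set E f | f in S j].
have hasI j : has_inf [set E f | f in S j].
  split; first by have [f Sf] := S0 j; exists (E f); exists f.
  by exists 0 => _ [f _ <-].
have I_le j f : S j f -> I j <= E f.
  by move=> Sf; apply: ge_inf; [exact: (hasI j).2|exists f].
have ndI : nondecreasing_seq I.
  move=> i j ij; apply: lb_le_inf; first exact: (hasI j).1.
  by move=> _ [f Sf <-]; apply: I_le; exact: Sle Sf.
have I_B j : I j <= B.
  have [f Sf] := S0 j; apply: le_trans (I_le _ _ Sf) _; apply: EB.
  exact: (Sle (leq0n j)) Sf.
have cI : cvgn I by apply: nondecreasing_is_cvgn => //; exists B => _ [j _ <-].
have [l hl] := (cvg_ex _).1 cI.
have I_l j : I j <= l.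
  by rewrite -(cvg_lim (@norm_hausdorff _ R) hl); exact: nondecreasing_cvgn_le.
have /choice[N NP] (j : nat) : exists N, (j <= N)%N /\ l - I N <= e2 j.
  move/cvgrPdist_le : hl => /(_ _ (eps0 j)) [N _ hN].
  exists (maxn j N); split; first exact: leq_maxl.
  by have := hN _ (leq_maxr j N); rewrite /= ger0_norm ?subr_ge0.
(* A level at least [N i] for every i <= j, so that [F k] lies in the class of level [N j] for every
   k >= j. *)
pose ka j := (\sum_(i < j.+1) N i)%N.
have kaN i j : (i <= j)%N -> (N i <= ka j)%N.
  move=> ij; have ij' : (i < j.+1)%N by [].
  by rewrite /ka (bigD1 (Ordinal ij'))//= leq_addr.
have kajj j : (j <= ka j)%N by apply: leq_trans (kaN _ _ (leqnn j)); have [] := NP j.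
(* The minimum of the tolerances up to [j]: each [F k] has to meet those of all earlier indices. *)
have eps2 j : 0 < \big[Num.min/e2 0]_(i < j.+1) e2 i.
  by apply: lt_bigmin.
have /choice[F FP] (j : nat) : exists f, S (ka j) f /\ E f <= I (ka j) + \big[Num.min/e2 0]_(i < j.+1) e2 i.
  have [_ [f Sf <-] h] := inf_adherent (eps2 j) (hasI (ka j)).
  by exists f; split => //; exact: ltW.
exists F; split.
  by move=> j; have [Sf _] := FP j; exact: (Sle (kajj j)) Sf.
move=> j k jk; have [SF EF] := FP j; have [SG EG] := FP k.
have SF' : S (N j) (F j) by exact: (Sle (kaN _ _ (leqnn j))) SF.
have SG' : S (N j) (F k) by exact: (Sle (kaN _ _ jk)) SG.
have Sm := Smid SF' SG'.
have para := parallelogram (Sle (leq0n _) SF') (Sle (leq0n _) SG').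
have h1 := I_le _ _ Sm.
have h2 : E (F j) <= l + e2 j.
  apply: le_trans EF _; apply: lerD; first exact: I_l.
  exact: (bigmin_le _ (ord_max : 'I_j.+1) (fun i : 'I_j.+1 => e2 i)).
have h3 : E (F k) <= l + e2 j.
  apply: le_trans EG _; apply: lerD; first exact: I_l.
  have jk' : (j < k.+1)%N by [].
  exact: (bigmin_le _ (Ordinal jk') (fun i : 'I_k.+1 => e2 i)).
have [_ h4] := NP j.
have -> : E (half (F j) (F k)) = (E (F j) + E (F k)) / 2 - E (mid (F j) (F k)).
  by rewrite -para addrAC subrr add0r.
move: h2 h3 h4; rewrite /e2; lra.
Qed.

End minimizing_sequence.

(** * Fatou's lemma, fast L^1 convergence and sup bounds from moments *)

Section limit_theorems.
Context d (T : measurableType d) (R : realType) (mu : {measure set T -> \bar R}).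
Variable D : set T.
Hypothesis mD : measurable D.

Lemma fatou_le (f : nat -> T -> R) (g : T -> R) (c : \bar R) :
  (forall j, measurable_fun D (f j)) -> measurable_fun D g ->
  (forall j x, D x -> 0 <= f j x) -> (forall x, D x -> 0 <= g x) ->
  {ae mu, forall x, D x -> f j x @[j --> \oo] --> g x} ->
  (\forall j \near \oo, (\int[mu]_(x in D) (f j x)%:E <= c)%E) ->
  (\int[mu]_(x in D) (g x)%:E <= c)%E.
Proof.
move=> mf mg f0 g0 fg [N _ hN].
(* Drops the first terms, for which the bound may fail. *)
pose F j x := (f (j + N)%N x)%:E.
have mF j : measurable_fun D (F j) by apply/measurable_EFinP; exact: mf.
have F0 j x : D x -> (0 <= F j x)%E by move=> Dx; rewrite lee_fin f0.
have mlim : measurable_fun D (fun x => limn_einf (F ^~ x)).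
  rewrite (_ : (fun _ => _) = fun x => (- limn_esup ((fun j x => - F j x) ^~ x))%E)//.
  apply: measurableT_comp => //.
  by apply: measurable_fun_limn_esup => j; exact: measurableT_comp.
apply: (@le_trans _ _ (\int[mu]_(x in D) limn_einf (F ^~ x))%E).
  apply: ae_ge0_le_integral => //.
  - exact/measurable_EFinP.
  - move=> x Dx; rewrite limn_einf_lim; apply: lime_ge; first exact: is_cvg_einfs.
    by apply: nearW => j; apply: le_ereal_inf_tmp => _ [k _ <-]; exact: F0.
  - apply: filterS fg => x h Dx.
    have hF : F ^~ x @ \oo --> (g x)%:E.
      apply: cvg_EFin; first exact: nearW.
      by rewrite (cvg_shiftn N (fun j => f j x)); exact: h.
    by have [->] := cvg_limn_einf_sup hF.
apply: le_trans (fatou mu mD mF F0) _.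
rewrite limn_einf_lim; apply: lime_le; first exact: is_cvg_einfs.
apply: nearW => j; apply: (@le_trans _ _ (\int[mu]_(x in D) F j x)%E).
  by apply: ereal_inf_lbound; exists j => //=.
by apply: hN; rewrite /= leq_addl.
Qed.

(** The absolute increments have integrals of sum at most 1, so their series converges almost
    everywhere. *)
Lemma L1_fast_limit (h : nat -> T -> R) : (forall j, measurable_fun D (h j)) ->
  (forall j, (\int[mu]_(x in D) `|h j.+1 x - h j x|%:E <= (1 / (2 ^ (j + 1))%:R)%:E)%E) ->
  exists2 g : T -> R, measurable_fun D g &
    {ae mu, forall x, D x -> h j x @[j --> \oo] --> g x}.
Proof.
move=> mh hh.
(* A superior limit is measurable without knowing where [h] converges; [fine] makes it real. *)
pose g x := fine (limn_esup (fun j => (h j x)%:E)).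
exists g.
  apply: (@measurable_comp _ _ _ _ _ _ setT (@fine R)) => //.
  by apply: measurable_fun_limn_esup => j; exact/measurable_EFinP.
pose f j x : \bar R := (`|h j.+1 x - h j x|)%:E.
have mf j : measurable_fun D (f j).
  apply/measurable_EFinP; apply: measurableT_comp => //; exact: measurable_funB.
have f0 j x : D x -> (0 <= f j x)%E by move=> _; rewrite lee_fin.
have sum1 : (\int[mu]_(x in D) (\sum_(j <oo) f j x) <= 1%:E)%E.
  rewrite integral_nneseries//.
  have := @cvg_geometric_eseries_half R 1 0.
  rewrite expr0 divr1 => /cvg_lim <-//.
  apply: lee_nneseries => [j _ _|j _]; first by apply: integral_ge0 => x; exact: f0.
  exact: hh.
have ints : mu.-integrable D (fun x => \sum_(j <oo) f j x)%E.
  apply/integrableP; split.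
    by apply: ge0_emeasurable_sum => // j x Dx _; exact: f0.
  apply: le_lt_trans (ltry 1); apply: le_trans sum1.
  rewrite le_eqVlt; apply/orP; left; apply/eqP; apply: eq_integral => x /set_mem Dx.
  by rewrite gee0_abs// nneseries_ge0// => j _ _; exact: f0.
have := integrable_ae mD ints; apply: filterS => x hx Dx.
have {}hx := hx Dx.
have cs : cvgn [normed series (fun j => h j.+1 x - h j x)].
  apply: nondecreasing_is_cvgn.
    by move=> a b ab; rewrite /= -subr_ge0 sub_series_geq// sumr_ge0.
  exists (fine (\sum_(j <oo) f j x)%E) => _ [k _ <-].
  rewrite -lee_fin fineK//= /series /= -sumEFin.
  exact: nneseries_lim_ge (fun j _ _ => f0 j x Dx).
have := normed_cvg cs => /cvg_ex[l hl].
have hxl : h j x @[j --> \oo] --> l + h 0%N x.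
  rewrite (_ : (fun j => h j x) = fun j => series (fun j => h j.+1 x - h j x) j + h 0%N x).
    by apply: cvgD => //; exact: cvg_cst.
  by apply/funext => j; rewrite seriesEnat /= telescope_sumr// subrK.
rewrite /g; have hE : (h j x)%:E @[j --> \oo] --> (l + h 0%N x)%:E.
  by apply: cvg_EFin => //; exact: nearW.
by have [_ ->] := cvg_limn_einf_sup hE.
Qed.

End limit_theorems.

Lemma integral_powR_nat d (T : measurableType d) (R : realType)
    (mu : {measure set T -> \bar R}) (D : set T) (f : T -> R) (q : nat) :
  (forall x, D x -> 0 <= f x) ->
  (\int[mu]_(x in D) (f x `^ q%:R)%:E = \int[mu]_(x in D) (f x ^+ q)%:E)%E.
Proof. by move=> f0; apply: eq_integral => x /set_mem Dx; rewrite powR_mulrn// f0. Qed.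

(** Chebyshev's inequality: the set where |f| > B has measure at most m (A / B)^q for all large [q],
    hence 0. *)
Lemma ae_bound_of_moments d (T : measurableType d) (R : realType)
    (mu : {measure set T -> \bar R}) (D : set T) (f : T -> R) (m A B : R) :
  measurable D -> measurable_fun D f -> 0 <= m -> 0 < A -> A < B ->
  (\forall q \near \oo, (\int[mu]_(x in D) (`|f x| ^+ q)%:E <= (m * A ^+ q)%:E)%E) ->
  {ae mu, forall x, D x -> `|f x| <= B}.
Proof.
move=> mD mf m0 A0 AB h; have B0 : 0 < B := lt_trans A0 AB.
pose Z := D `&` [set x | B < `|f x|].
have mZ : measurable Z.
  have mnf : measurable_fun D (fun x => `|f x|).
    exact: measurable_abs.
  have := mnf mD `]B, +oo[%classic (measurable_itv _).
  congr measurable; apply/seteqP; split => x /=; rewrite /Z /= in_itv /= andbT //.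
have ZD : Z `<=` D by move=> x [].
have key : \forall q \near \oo, (mu Z <= (m * (A / B) ^+ q)%:E)%E.
  apply: filterS h => q hq.
  have Bq : 0 < B ^+ q by rewrite exprn_gt0.
  have h1 : ((B ^+ q)%:E * mu Z <= (m * A ^+ q)%:E)%E.
    apply: le_trans hq; rewrite -(integral_cst _ mZ).
    have mfq (C : set T) : measurable_fun D f -> measurable_fun D (fun x => (`|f x| ^+ q)%:E).
      move=> _; apply/measurable_EFinP; apply: measurable_funX.
      exact: measurable_abs.
    apply: (@le_trans _ _ (\int[mu]_(x in Z) (`|f x| ^+ q)%:E)%E).
      apply: ge0_le_integral => //.
      - by move=> x _; rewrite lee_fin ltW.
      - exact: (measurable_funS mD ZD (mfq Z mf)).
      - move=> x [_ /= Bx]; rewrite lee_fin; apply: lerXn2r; rewrite ?nnegrE ?(ltW B0)//.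
        exact: ltW.
    by apply: ge0_subset_integral => //; first exact: mfq Z mf.
  rewrite (_ : m * (A / B) ^+ q = (B ^+ q)^-1 * (m * A ^+ q)); last first.
    by rewrite exprMn exprVn; ring.
  by rewrite EFinM lee_pdivlMl.
have mu0 : mu Z = 0%E.
  apply/eqP; rewrite eq_le measure_ge0 andbT.
  have cv : (m * (A / B) ^+ q)%:E @[q --> \oo] --> 0%E.
    apply: cvg_EFin; first exact: nearW.
    rewrite -[X in _ --> X](mulr0 m); apply: cvgMr; apply: cvg_expr.
    by rewrite ger0_norm ?divr_ge0 ?ltW// ltr_pdivrMr// mul1r.
  exact: cvge_ge key cv.
exists Z; split => // x /= nx; have [Dx|nDx] := pselect (D x); last first.
  by exfalso; apply: nx => /nDx.
split => //=; rewrite ltNge; apply/negP => fB; exact: nx.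
Qed.

(** * Approximants with gradients converging in L^1 *)

Section gradient_approximation.
Context {R : realType} {n : nat}.
Variable Omega : set 'rV[R]_n.
Hypothesis oO : open Omega.
Hypothesis bO : bounded_set Omega.
Hypothesis O0 : Omega !=set0.
Variables (L : R) (u : 'rV[R]_n -> R).
Hypothesis L0 : 0 < L.
Hypothesis approx : forall e Q : R, 0 < e -> exists (phi : 'rV[R]_n -> R) (p : R),
  [/\ test_fun Omega phi, (forall y, closure Omega y -> `|phi y - u y| <= e), Q <= p &
      (\int[leb n]_x (enorm (cgrad phi x) `^ p)%:E <= ((L + e) `^ p)%:E)%E].
Implicit Types (f g phi : 'rV[R]_n -> R).

Local Notation mO := (measurable_Omega oO).
Local Notation mu := (leb n).

Let M0 : R := fine (mu Omega).

Let M0E : mu Omega = M0%:E.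
Proof. by rewrite fineK// ge0_fin_numE//; exact: bounded_leb_lty mO bO. Qed.

Let M0_gt0 : 0 < M0.
Proof. by rewrite -lte_fin -M0E; exact: open_leb_gt0. Qed.

(** The classes over which the energy is minimized. The range q <= m + n + 2 grows with [m], so
    every moment is eventually controlled, and at every level it admits q = 2 for the energy and q =
    n + 1 for Morrey's estimate. *)
Let Sm (m : nat) : set ('rV[R]_n -> R) := [set f | [/\ test_fun Omega f,
  (forall y, closure Omega y -> `|f y - u y| <= m.+1%:R^-1) &
  forall q : nat, (0 < q)%N -> (q <= m + n + 2)%N ->
    (\int[mu]_(x in Omega) (enorm (cgrad f x) ^+ q)%:E <= (M0 * (L + m.+1%:R^-1) ^+ q)%:E)%E]].

Let E f : R := \int[mu]_(x in Omega) (enorm (cgrad f x) ^+ 2).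
Let mid f g : 'rV[R]_n -> R := fun x => 2^-1 * (f x + g x).
Let half f g : 'rV[R]_n -> R := fun x => 2^-1 * (f x - g x).

Let measurable_grad f (D : set 'rV[R]_n) (q : nat) : test_fun Omega f ->
  measurable_fun D (fun x => enorm (cgrad f x) ^+ q).
Proof.
move=> tf; apply: measurable_funX; apply: measurable_funTS; apply: continuous_measurable_rV.
exact: (cgrad_continuous (test_fun_ck 1 tf)).
Qed.

Let integrable_grad f (q : nat) : test_fun Omega f ->
  mu.-integrable Omega (EFin \o (fun x => enorm (cgrad f x) ^+ q)).
Proof.
move=> tf; have [B [_ gB]] := test_fun_bounds tf.
apply: measurable_bounded_integrable.
- exact: mO.
- exact: bounded_leb_lty mO bO.
- exact: measurable_grad.
- exists (B ^+ q); split; first exact: num_real.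
  move=> r Br x _ /=; apply: le_trans (ltW Br).
  rewrite normrX ger0_norm ?enorm_ge0//; apply: lerXn2r; rewrite ?nnegrE ?enorm_ge0//.
  exact: le_trans (enorm_ge0 _) (gB x).
Qed.

Let test_mid f g : test_fun Omega f -> test_fun Omega g -> test_fun Omega (mid f g).
Proof. by move=> tf tg; apply: test_funZ; exact: test_funD. Qed.

Let test_half f g : test_fun Omega f -> test_fun Omega g -> test_fun Omega (half f g).
Proof. by move=> tf tg; apply: test_funZ; exact: test_funB. Qed.

Let cgrad_mid f g x : test_fun Omega f -> test_fun Omega g ->
  cgrad (mid f g) x = 2^-1 *: (cgrad f x + cgrad g x).
Proof.
move=> tf tg; rewrite /mid cgradZ; last exact: test_fun_ck (test_funD tf tg).
by rewrite (cgradD _ (test_fun_ck 1 tf) (test_fun_ck 1 tg)).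
Qed.

Let cgrad_half f g x : test_fun Omega f -> test_fun Omega g ->
  cgrad (half f g) x = 2^-1 *: (cgrad f x - cgrad g x).
Proof.
move=> tf tg; rewrite /half cgradZ; last exact: test_fun_ck (test_funB tf tg).
by rewrite (cgradB _ (test_fun_ck 1 tf) (test_fun_ck 1 tg)).
Qed.

Let parallelogram f g : test_fun Omega f -> test_fun Omega g ->
  E (mid f g) + E (half f g) = (E f + E g) / 2.
Proof.
move=> tf tg; rewrite /E.
have im := @integrable_grad _ 2 (test_mid tf tg).
have ih := @integrable_grad _ 2 (test_half tf tg).
have i_f := @integrable_grad _ 2 tf.
have ig := @integrable_grad _ 2 tg.
transitivity (\int[mu]_(x in Omega) (enorm (cgrad (mid f g) x) ^+ 2 + enorm (cgrad (half f g) x) ^+ 2)).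
  exact: (esym (RintegralD mO im ih)).
transitivity (\int[mu]_(x in Omega) (2^-1 * (enorm (cgrad f x) ^+ 2 + enorm (cgrad g x) ^+ 2))).
  apply: eq_Rintegral => x _; rewrite cgrad_mid// cgrad_half// !enormZ !exprMn !enorm_sqr.
  rewrite ger0_norm// -mulrDr -big_split -big_split /= !mulr_sumr.
  by apply: eq_bigr => i _; rewrite !mxE; field.
have ifg : mu.-integrable Omega (EFin \o (fun x => enorm (cgrad f x) ^+ 2 + enorm (cgrad g x) ^+ 2)).
  have := integrableD mO i_f ig.
  by apply: eq_integrable; [exact: mO|move=> x _].
transitivity (2^-1 * \int[mu]_(x in Omega) (enorm (cgrad f x) ^+ 2 + enorm (cgrad g x) ^+ 2)).
  exact: (RintegralZl 2^-1 mO ifg).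
rewrite [RHS]mulrC; congr (_ * _).
exact: (RintegralD mO i_f ig).
Qed.

(** Midpoint convexity of powers, by induction from (s - t) (s^q - t^q) >= 0. It makes the classes
    [Sm] stable under midpoints. *)
Let powS (q : nat) (s t : R) : 0 <= s -> 0 <= t ->
  ((s + t) / 2) ^+ q <= (s ^+ q + t ^+ q) / 2.
Proof.
move=> s0 t0; elim: q => [|q IH]; first by rewrite !expr0; lra.
have h : 0 <= (s - t) * (s ^+ q - t ^+ q).
  have [st|/ltW ts] := leP s t.
    by rewrite mulr_le0// subr_le0// lerXn2r.
  by rewrite mulr_ge0// subr_ge0// lerXn2r.
rewrite exprS; apply: (@le_trans _ _ ((s + t) / 2 * ((s ^+ q + t ^+ q) / 2))).
  by rewrite ler_wpM2l// divr_ge0// addr_ge0.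
by rewrite !exprS; nra.
Qed.

Let Smid j f g : Sm j f -> Sm j g -> Sm j (mid f g).
Proof.
move=> [tf uf Ef] [tg ug Eg]; split; first exact: test_mid.
  move=> y cy; rewrite /mid (_ : _ - u y = 2^-1 * ((f y - u y) + (g y - u y))); last by field.
  rewrite normrM gtr0_norm// ler_pdivrMl//; apply: le_trans (ler_normD _ _) _.
  by rewrite mulr2n mulrDl mul1r; apply: lerD; [exact: uf|exact: ug].
move=> q q0 qm; have hf := Ef q q0 qm; have hg := Eg q q0 qm.
set c := M0 * _ in hf hg *.
have -> : c%:E = ((2^-1)%:E * (c%:E + c%:E))%E by rewrite -EFinD -EFinM; congr EFin; field.
apply: (@le_trans _ _ ((2^-1)%:E * (\int[mu]_(x in Omega) (enorm (cgrad f x) ^+ q)%:E +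
   \int[mu]_(x in Omega) (enorm (cgrad g x) ^+ q)%:E))%E); last first.
  refine (lee_wpmul2l _ (leeD hf hg)); by rewrite lee_fin invr_ge0.
have mf := @measurable_grad f Omega q tf; have mg := @measurable_grad g Omega q tg.
have f0 x : Omega x -> (0 <= (enorm (cgrad f x) ^+ q)%:E)%E by move=> _; rewrite lee_fin exprn_ge0// enorm_ge0.
have g0 x : Omega x -> (0 <= (enorm (cgrad g x) ^+ q)%:E)%E by move=> _; rewrite lee_fin exprn_ge0// enorm_ge0.
have eq1 := @ge0_integralD _ _ _ mu _ mO _ _ f0 (proj2 (measurable_EFinP _ _) mf) g0 (proj2 (measurable_EFinP _ _) mg).
rewrite -eq1.
have fg0 x : Omega x -> (0 <= (enorm (cgrad f x) ^+ q)%:E + (enorm (cgrad g x) ^+ q)%:E)%E.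
  by move=> Ox; exact: adde_ge0 (f0 x Ox) (g0 x Ox).
have mfg : measurable_fun Omega (fun x => (enorm (cgrad f x) ^+ q)%:E + (enorm (cgrad g x) ^+ q)%:E)%E.
  apply: emeasurable_funD; [exact: (proj2 (measurable_EFinP _ _) mf)|exact: (proj2 (measurable_EFinP _ _) mg)].
have h2 : 0 <= 2^-1 :> R by rewrite invr_ge0.
rewrite -(@ge0_integralZl_EFin _ _ _ mu _ mO _ fg0 mfg _ h2).
apply: ge0_le_integral.
- exact: mO.
- by move=> x _; rewrite lee_fin exprn_ge0// enorm_ge0.
- by apply/measurable_EFinP; apply: measurable_grad; exact: test_mid.
- apply: emeasurable_funM; [exact: measurable_cst|exact: mfg].
move=> x _; rewrite -EFinD -EFinM lee_fin cgrad_mid// mulrC.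
apply: le_trans (powS q (enorm_ge0 _) (enorm_ge0 _)).
apply: lerXn2r; rewrite ?nnegrE ?enorm_ge0//; first by rewrite divr_ge0 ?addr_ge0 ?enorm_ge0.
by rewrite enormZ gtr0_norm// mulrC ler_wpM2r//; exact: enormD.
Qed.

(** An approximant at one large exponent [p] controls all smaller ones by the power mean inequality;
    the normalization costs a factor |Omega|^(-1/p), close to 1. *)
Let Sm0 m : Sm m !=set0.
Proof.
pose r : R := m.+1%:R^-1; have r0 : 0 < r by rewrite invr_gt0.
have cv := @powR_cvg_pinfty R M0 0 (-1) M0_gt0.
rewrite powRr0 in cv.
have l1 : (1 : R) < (L + r) / (L + r / 2).
  by rewrite ltr_pdivlMr ?mul1r; [lra|apply: addr_gt0 => //; rewrite divr_gt0].
have [P [_ hP]] := cvgr_lt _ cv _ l1.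
have r2 : 0 < r / 2 by rewrite divr_gt0.
(* The exponent must exceed [P] strictly, dominate every [q] of the class, and be at least 1. *)
have [phi [p [tphi phiu Qp phip]]] := approx (Num.max (Num.max (P + 1) (m + n + 2)%:R) 1) r2.
move: Qp; rewrite !ge_max => /andP[/andP[Pp mp] p1].
have p0 : 0 < p := lt_le_trans ltr01 p1.
have hp : M0 `^ (0 + -1 / p) < (L + r) / (L + r / 2).
  by apply: hP; apply: lt_le_trans Pp; rewrite ltrDl.
exists phi; split => //.
  move=> y cy; apply: le_trans (phiu y cy) _; rewrite -/r; lra.
move=> q q0 qm.
have Lr0 : 0 < L + r / 2 by rewrite addr_gt0// divr_gt0.
(* Solves |Omega| M^p = (L + r / 2)^p; for [p] this large, M <= L + r. *)
pose M := (L + r / 2) * M0 `^ (0 + (-1) / p).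
have M_gt0 : 0 < M by rewrite mulr_gt0// powR_gt0.
have Mr : M <= L + r.
  by rewrite /M mulrC -ler_pdivlMr// ltW.
have Mp : M0 * M `^ p = (L + r / 2) `^ p.
  rewrite powRM ?ltW// ?powR_gt0// -powRrM add0r mulN1r mulNr mulVf ?gt_eqF//.
  by rewrite powR_inv1 ?ltW// mulrCA divff ?mulr1// gt_eqF.
have e0 x : Omega x -> 0 <= enorm (cgrad phi x) by move=> _; exact: enorm_ge0.
rewrite -(integral_powR_nat mu q e0).
apply: (@le_trans _ _ (M0 * M `^ q%:R)%:E); last first.
  rewrite lee_fin ler_pM2l//; rewrite powR_mulrn ?(ltW M_gt0)//; apply: lerXn2r => //.
  - by rewrite nnegrE ltW.
  - by rewrite nnegrE addr_ge0// ltW.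
have mcg : measurable_fun setT (fun x => enorm (cgrad phi x)).
  exact: (continuous_measurable_rV (cgrad_continuous (test_fun_ck 1 tphi))).
have muM : (mu Omega <= M0%:E)%E by rewrite M0E.
have mcO : measurable_fun Omega (fun x => enorm (cgrad phi x)) := measurable_funTS mcg.
have q0' : 0 < q%:R :> R by rewrite ltr0n.
apply: (power_mean mO muM mcO e0 M_gt0 q0' (p := p)).
- by apply: le_trans mp; rewrite ler_nat.
rewrite Mp; apply: le_trans phip.
apply: (ge0_subset_integral mu mO measurableT).
- by apply/measurable_EFinP; apply: (@measurable_comp _ _ _ _ _ _ setT (@powR R ^~ p)) => //.
- by move=> x _; rewrite lee_fin powR_ge0.
- exact: subsetT.
Qed.

Let SmS m : Sm m.+1 `<=` Sm m.
Proof.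
have h : (m.+2%:R^-1 : R) <= m.+1%:R^-1 by rewrite lef_pV2 ?posrE// ler_nat.
move=> f [tf uf Ef]; split => //.
  by move=> y cy; apply: le_trans (uf y cy) h.
move=> q q0 qm; apply: le_trans (Ef q q0 _) _.
  by apply: leq_trans qm _; rewrite !leq_add2r.
rewrite lee_fin ler_pM2l//; apply: lerXn2r; rewrite ?nnegrE.
- by rewrite addr_ge0// ltW.
- by rewrite addr_ge0// ltW.
- by rewrite lerD2l.
Qed.

Lemma gradient_sequence : exists F : nat -> 'rV[R]_n -> R,
  [/\ forall j, test_fun Omega (F j),
      forall j y, closure Omega y -> `|F j y - u y| <= j.+1%:R^-1,
      forall j q, (0 < q)%N -> (q <= j + n + 2)%N ->
        (\int[mu]_(x in Omega) (enorm (cgrad (F j) x) ^+ q)%:E <=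
          (fine (mu Omega) * (L + j.+1%:R^-1) ^+ q)%:E)%E &
      forall j k, (j <= k)%N ->
        (\int[mu]_(x in Omega) (enorm (cgrad (F j) x - cgrad (F k) x))%:E <=
          (1 / (2 ^ (j + 1))%:R)%:E)%E].
Proof.
pose b (j : nat) : R := 1 / (2 ^ (j + 1))%:R.
have b0 j : 0 < b j by rewrite divr_gt0// ltr0n expn_gt0.
(* The squared difference of gradients has integral 4 E (half) <= b^2 / |Omega|, which the power
   mean inequality turns into an L^1 bound by [b]. *)
have eps0 j : 0 < b j ^+ 2 / (4 * M0) by rewrite divr_gt0 ?exprn_gt0 ?mulr_gt0.
have E0 f : 0 <= E f by apply: Rintegral_ge0 => x _; rewrite exprn_ge0// enorm_ge0.
have EE f : test_fun Omega f -> (E f)%:E = (\int[mu]_(x in Omega) (enorm (cgrad f x) ^+ 2)%:E)%E.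
  move=> tf; rewrite /E /Rintegral fineK//.
  exact: (integrable_fin_num mO (integrable_grad 2 tf)).
have EB f : Sm 0 f -> E f <= M0 * (L + 1^-1) ^+ 2.
  move=> [tf _ hf]; rewrite -lee_fin EE//; apply: hf => //.
  by rewrite addnC.
have par f g : Sm 0 f -> Sm 0 g -> E (mid f g) + E (half f g) = (E f + E g) / 2.
  by move=> [tf _ _] [tg _ _]; exact: parallelogram.
have [F [SF EF]] := minimizing_sequence Sm0 SmS Smid E0 EB par eps0.
exists F; split.
- by move=> j; have [] := SF j.
- by move=> j; have [_ + _] := SF j.
- by move=> j; have [_ _ +] := SF j.
move=> j k jk; have tj : test_fun Omega (F j) by have [] := SF j.
have tk : test_fun Omega (F k) by have [] := SF k.
have e0 x : Omega x -> 0 <= enorm (cgrad (F j) x - cgrad (F k) x) by move=> _; exact: enorm_ge0.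
have muM : (mu Omega <= M0%:E)%E by rewrite M0E.
have mD : measurable_fun Omega (fun x => enorm (cgrad (F j) x - cgrad (F k) x)).
  have := @measurable_grad _ Omega 1 (test_funB tj tk).
  apply: eq_measurable_fun => x _.
  by rewrite (cgradB _ (test_fun_ck 1 tj) (test_fun_ck 1 tk)).
have bM : 0 < b j / M0 by rewrite divr_gt0.
have l12 : (1 : R) <= 2%:R by rewrite ler1n.
have := power_mean mO muM mD e0 bM ltr01 l12.
rewrite (integral_powR_nat mu 2 e0) (integral_powR_nat mu 1 e0) => /(_ _)/wrap[].
  apply: (@le_trans _ _ (4%:E * (E (half (F j) (F k)))%:E)%E).
    rewrite EE; last exact: test_half.
    have fh0 x : Omega x -> (0 <= (enorm (cgrad (half (F j) (F k)) x) ^+ 2)%:E)%E.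
      by move=> _; rewrite lee_fin exprn_ge0// enorm_ge0.
    have mfh : measurable_fun Omega (fun x => (enorm (cgrad (half (F j) (F k)) x) ^+ 2)%:E).
      by apply/measurable_EFinP; apply: measurable_grad; exact: test_half.
    have h4 : 0 <= 4 :> R by rewrite ler0n.
    rewrite -(@ge0_integralZl_EFin _ _ _ mu _ mO _ fh0 mfh _ h4).
    rewrite le_eqVlt; apply/orP; left; apply/eqP; apply: eq_integral => x _.
    rewrite -EFinM cgrad_half// enormZ exprMn; congr EFin.
    by rewrite gtr0_norm//; field.
  rewrite -EFinM lee_fin -ler_pdivlMl//.
  apply: le_trans (EF j k jk) _; rewrite powR_mulrn ?(ltW bM)//.
  rewrite le_eqVlt; apply/orP; left; apply/eqP; field; exact: lt0r_neq0.
by rewrite powRr1 ?(ltW bM)// mulrC divfK ?gt_eqF.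
Qed.

End gradient_approximation.

Lemma cvg_enorm (R : realType) (n : nat) (T : Type) (F : set_system T) (FF : Filter F)
    (f : T -> 'rV[R]_n) (l : 'rV[R]_n) :
  (forall i, f t ord0 i @[t --> F] --> l ord0 i) -> enorm (f t) @[t --> F] --> enorm l.
Proof.
move=> h; apply: continuous_cvg; first exact: enorm_continuous.
apply/cvg_ballP => e e0.
have h2 i : \forall t \near F, `|l ord0 i - f t ord0 i| < e.
  by have /cvgrPdist_lt := h i; apply.
have := filter_forall FF h2; apply: (@filterS _ F FF) => t ht.
exact/rV_ballP.
Qed.

Lemma dist_Rintegral d (T : measurableType d) (R : realType)
    (mu : {measure set T -> \bar R}) (D : set T) (f g : T -> R) (c : R) :
  measurable D -> mu.-integrable D (EFin \o f) -> mu.-integrable D (EFin \o g) ->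
  (\int[mu]_(x in D) `|f x - g x|%:E <= c%:E)%E ->
  `|\int[mu]_(x in D) f x - \int[mu]_(x in D) g x| <= c.
Proof.
move=> mD fi gi h.
have fgi : mu.-integrable D (EFin \o (fun x => f x - g x)).
  have := integrableB mD fi gi.
  by apply: eq_integrable; [exact: mD|move=> x _].
rewrite -(RintegralB mD fi gi).
apply: (le_trans (le_normr_Rintegral mD fgi)).
rewrite -lee_fin /Rintegral fineK//.
apply: integrable_fin_num => //; exact: integrable_norm fgi.
Qed.

Lemma integrable_inL1loc (R : realType) (n : nat) (Omega : set 'rV[R]_n) (f : 'rV[R]_n -> R) :
  open Omega -> measurable_fun Omega f -> (leb n).-integrable Omega (EFin \o f) ->
  inL1loc Omega f.
Proof.
move=> oO mf fi; split => // K cK KO; apply: integrableS fi => //; first exact: measurable_Omega.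
rewrite -[K]setCK; apply: measurableC; apply: open_measurable_rV; apply: closed_openC.
apply: compact_closed => //; exact: norm_hausdorff.
Qed.

(** * The gradient of the limit, its upper bound and the converse estimate *)

Section limit_gradient.
Context {R : realType} {n : nat}.
Variable Omega : set 'rV[R]_n.
Hypothesis oO : open Omega.
Hypothesis bO : bounded_set Omega.
Variables (L : R) (u : 'rV[R]_n -> R) (F : nat -> 'rV[R]_n -> R).
Hypothesis L0 : 0 < L.
Hypothesis tF : forall j, test_fun Omega (F j).
Hypothesis Fu : forall j y, closure Omega y -> `|F j y - u y| <= j.+1%:R^-1.
Hypothesis Fq : forall j q, (0 < q)%N -> (q <= j + n + 2)%N ->
  (\int[leb n]_(x in Omega) (enorm (cgrad (F j) x) ^+ q)%:E <=
     (fine (leb n Omega) * (L + j.+1%:R^-1) ^+ q)%:E)%E.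
Hypothesis FF : forall j k, (j <= k)%N ->
  (\int[leb n]_(x in Omega) (enorm (cgrad (F j) x - cgrad (F k) x))%:E <=
     (1 / (2 ^ (j + 1))%:R)%:E)%E.

Local Notation mO := (measurable_Omega oO).
Local Notation mu := (leb n).

Let M0 : R := fine (mu Omega).

Let M0E : mu Omega = M0%:E.
Proof. by rewrite fineK// ge0_fin_numE//; exact: bounded_leb_lty mO bO. Qed.

Let M0_ge0 : 0 <= M0.
Proof. by rewrite -lee_fin -M0E. Qed.

Let mcoord j i (D : set 'rV[R]_n) : measurable_fun D (fun x => cgrad (F j) x ord0 i).
Proof.
apply: measurable_funTS; apply: continuous_measurable_rV => x.
have /= := @ck_continuous _ _ _ _ (ck_partial i (test_fun_ck 1 (tF j))) x.
by under eq_fun do rewrite mxE.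
Qed.

(** Coordinate by coordinate, consecutive gradients are geometrically close in L^1. *)
Lemma limit_gradient_exists : exists G : 'rV[R]_n -> 'rV[R]_n,
  (forall i, measurable_fun Omega (fun x => G x ord0 i)) /\
  {ae mu, forall x, Omega x -> forall i, cgrad (F j) x ord0 i @[j --> \oo] --> G x ord0 i}.
Proof.
have h i : exists g : 'rV[R]_n -> R, measurable_fun Omega g /\
    {ae mu, forall x, Omega x -> cgrad (F j) x ord0 i @[j --> \oo] --> g x}.
  have hj j : (\int[mu]_(x in Omega) `|cgrad (F j.+1) x ord0 i - cgrad (F j) x ord0 i|%:E <=
     (1 / (2 ^ (j + 1))%:R)%:E)%E.
    apply: le_trans (FF (leqnSn j)).
    apply: ge0_le_integral.
    - exact: mO.
    - by move=> x _; rewrite lee_fin.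
    - apply/measurable_EFinP; apply: measurable_abs.
      by apply: measurable_funB; exact: mcoord.
    - by apply/measurable_EFinP; apply: measurable_enormB => k; exact: mcoord.
    - move=> x _; rewrite lee_fin distrC.
      by have := coord_le_enorm (cgrad (F j) x - cgrad (F j.+1) x) i; rewrite !mxE.
  by have [g mg gg] := L1_fast_limit mO (fun j => @mcoord j i Omega) hj; exists g.
have [g hg] := choice h.
exists (fun x => \row_i g i x); split.
  move=> i; under eq_fun do rewrite mxE.
  exact: (hg i).1.
have h2 : forall i : 'I_n, {ae mu, forall x, Omega x -> cgrad (F j) x ord0 i @[j --> \oo] --> g i x}.
  by move=> i; exact: (hg i).2.
have := filter_forall (ae_filter_ringOfSetsType _) h2; apply: filterS => x hx Ox i.
by rewrite mxE; exact: hx.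
Qed.

Variable G : 'rV[R]_n -> 'rV[R]_n.
Hypothesis mG : forall i, measurable_fun Omega (fun x => G x ord0 i).
Hypothesis FG : {ae mu, forall x, Omega x ->
  forall i, cgrad (F j) x ord0 i @[j --> \oo] --> G x ord0 i}.

Let mcg j : measurable_fun Omega (fun x => enorm (cgrad (F j) x)).
Proof. by apply: measurable_enorm => i; exact: mcoord. Qed.

Let mFG j : measurable_fun Omega (fun x => enorm (cgrad (F j) x - G x)).
Proof. by apply: measurable_enormB => k //; exact: mcoord. Qed.

(** Fatou's lemma in [k], with [j] fixed. *)
Lemma limit_gradient_L1 j :
  (\int[mu]_(x in Omega) (enorm (cgrad (F j) x - G x))%:E <= (1 / (2 ^ (j + 1))%:R)%:E)%E.
Proof.
apply: (fatou_le mO (f := fun k x => enorm (cgrad (F j) x - cgrad (F k) x))).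
- by move=> k; apply: measurable_enormB => i; exact: mcoord.
- exact: mFG.
- by move=> k x _; exact: enorm_ge0.
- by move=> x _; exact: enorm_ge0.
- move: FG; apply: filterS => x hx Ox; apply: cvg_enorm => i.
  rewrite (_ : (fun k => _) = (fun k => cgrad (F j) x ord0 i - cgrad (F k) x ord0 i)); last first.
    by apply/funext => k; rewrite mxE [X in _ + X]mxE.
  rewrite (_ : (cgrad (F j) x - G x) ord0 i = cgrad (F j) x ord0 i - G x ord0 i); last first.
    by rewrite mxE [X in _ + X]mxE.
  exact: cvgB (cvg_cst _) (hx Ox i).
- by exists j => // k /= jk; exact: FF.
Qed.

(** Fatou's lemma at a fixed exponent, which the bounds on [F k] admit as soon as k >= q. *)
Lemma limit_gradient_moment (q : nat) (r : R) : (0 < q)%N -> 0 < r ->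
  (\int[mu]_(x in Omega) (enorm (G x) ^+ q)%:E <= (M0 * (L + r) ^+ q)%:E)%E.
Proof.
move=> q0 r0.
apply: (fatou_le mO (f := fun k x => enorm (cgrad (F k) x) ^+ q)).
- by move=> k; apply: measurable_funX; exact: mcg.
- by apply: measurable_funX; exact: measurable_enorm.
- by move=> k x _; rewrite exprn_ge0// enorm_ge0.
- by move=> x _; rewrite exprn_ge0// enorm_ge0.
- move: FG; apply: filterS => x hx Ox.
  have h1 : enorm (cgrad (F j) x) @[j --> \oo] --> enorm (G x).
    by apply: cvg_enorm => i; exact: hx.
  exact: (cvg_comp _ _ h1 (@exprn_continuous R q (enorm (G x)))).
have c0 := @cvg_harmonic R.
have := cvgr_lt _ c0 _ r0; move=> hr.
near=> k; apply: (@le_trans _ _ (M0 * (L + k.+1%:R^-1) ^+ q)%:E).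
  apply: Fq => //; rewrite (leq_trans _ (leq_addr _ _))// (leq_trans _ (leq_addr _ _))//.
  by near: k; exact: nbhs_infty_ge.
rewrite lee_fin; apply: ler_wpM2l => //; apply: lerXn2r.
- by rewrite nnegrE addr_ge0// ltW.
- by rewrite nnegrE addr_ge0// ltW.
- by rewrite lerD2l; apply: ltW; near: k; exact: hr.
Unshelve. all: by end_near. Qed.

(** All moments are at most |Omega| (L + r)^q, so |G| <= L + 2 r almost everywhere, for each r = 1 /
    (k + 1). *)
Lemma limit_gradient_bound : {ae mu, forall x, Omega x -> enorm (G x) <= L}.
Proof.
have h (k : nat) : {ae mu, forall x, Omega x -> enorm (G x) <= L + 2 / k.+1%:R}.
  pose r : R := k.+1%:R^-1; have r0 : 0 < r by rewrite invr_gt0.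
  have A0 : 0 < L + r by rewrite addr_gt0.
  have AB : L + r < L + 2 / k.+1%:R by rewrite ltrD2l -/r; lra.
  have mE : measurable_fun Omega (fun x => enorm (G x)) by exact: measurable_enorm.
  have hm : \forall q \near \oo, (\int[mu]_(x in Omega) (`|enorm (G x)| ^+ q)%:E <= (M0 * (L + r) ^+ q)%:E)%E.
    exists 1%N => // q /= q1; apply: le_trans (limit_gradient_moment q1 r0).
    rewrite le_eqVlt; apply/orP; left; apply/eqP; apply: eq_integral => x _.
    by rewrite ger0_norm ?enorm_ge0.
  have := ae_bound_of_moments mO mE M0_ge0 A0 AB hm.
  by apply: filterS => x hx Ox; rewrite -[enorm _]ger0_norm ?enorm_ge0// hx.
have := ae_foralln h; apply: filterS => x hx Ox.
apply/ler_addgt0Pr => e e0.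
have e2 : 0 < e / 2 by rewrite divr_gt0.
have [k _ hk] := cvgr_lt _ (@cvg_harmonic R) _ e2.
have {}hk : k.+1%:R^-1 < e / 2 :> R by apply: (hk k) => /=.
by apply: le_trans (hx k Ox) _; rewrite lerD2l; set t := _^-1 in hk *; lra.
Qed.

Let b (j : nat) : R := 1 / (2 ^ (j + 1))%:R.

Let b_cvg : b j @[j --> \oo] --> 0.
Proof.
rewrite (_ : b = geometric 2^-1 2^-1).
  by apply: cvg_geometric; rewrite gtr0_norm// invf_lt1// ltr1n.
by apply/funext => j; rewrite /b /geometric /= addn1 natrX exprS invfM exprVn mul1r.
Qed.

Lemma limit_measurable : measurable_fun Omega u.
Proof.
apply: (@measurable_fun_cvg _ _ _ Omega F u).
  by move=> j; exact: test_fun_measurable (tF j).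
move=> x Ox; apply/cvgrPdist_lt => e e0.
have [N _ hN] := cvgr_lt _ (@cvg_harmonic R) _ e0.
exists N => // j /hN hj.
rewrite distrC; apply: le_lt_trans hj; apply: Fu; exact: subset_closure.
Qed.

Lemma limit_bounded : exists2 B : R, 0 < B & forall x, closure Omega x -> `|u x| <= B.
Proof.
have [B B0 hB] := test_fun_bounded (tF 0%N).
exists (B + 1); first by rewrite addr_gt0.
move=> x cx; rewrite (_ : u x = F 0%N x - (F 0%N x - u x)); last by ring.
apply: le_trans (ler_normB _ _) _; apply: lerD => //.
by have := Fu 0 cx; rewrite invr1.
Qed.

Let limit_integrable : mu.-integrable Omega (EFin \o u).
Proof.
have [B B0 hB] := limit_bounded.
apply: measurable_bounded_integrable.
- exact: mO.
- exact: bounded_leb_lty mO bO.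
- exact: limit_measurable.
- exists B; split; first exact: num_real.
  move=> r Br x Ox /=; apply: le_trans (ltW Br); apply: hB; exact: subset_closure.
Qed.

Let G_integrable i : mu.-integrable Omega (EFin \o (fun x => G x ord0 i)).
Proof.
have Gi : mu.-integrable Omega (EFin \o (fun x => cgrad (F 0%N) x ord0 i - (cgrad (F 0%N) x - G x) ord0 i)).
  have i1 : mu.-integrable Omega (EFin \o (fun x => cgrad (F 0%N) x ord0 i)).
    have := test_fun_integrable mO (test_fun_partial i (tF 0%N)).
    by apply: eq_integrable; [exact: mO|move=> x _; rewrite /= mxE].
  have mcG : measurable_fun Omega (fun x => (cgrad (F 0%N) x - G x) ord0 i).
    under eq_fun do rewrite mxE [X in _ + X]mxE.
    by apply: measurable_funB => //; exact: mcoord.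
  have i2 : mu.-integrable Omega (EFin \o (fun x => (cgrad (F 0%N) x - G x) ord0 i)).
    apply/integrableP; split; first exact/measurable_EFinP.
    apply: le_lt_trans (ltry _); apply: le_trans (limit_gradient_L1 0).
    apply: ge0_le_integral.
    - exact: mO.
    - by move=> x _; rewrite lee_fin.
    - apply/measurable_EFinP; exact: (measurable_abs mcG).
    - by apply/measurable_EFinP; exact: mFG.
    - by move=> x _; rewrite lee_fin coord_le_enorm.
  have := integrableB mO i1 i2.
  by apply: eq_integrable; [exact: mO|move=> x _].
apply: eq_integrable Gi; first exact: mO.
by move=> x _ /=; congr EFin; rewrite mxE [in X in _ - X]mxE !mxE; ring.
Qed.

(** Passage to the limit in the integration by parts for [F j]: uniform convergence on the side of
    [u], L^1 convergence of the gradients on the side of [G]. *)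
Lemma limit_weak_gradient : weak_gradient Omega u G.
Proof.
have uL : inL1loc Omega u := integrable_inL1loc oO limit_measurable limit_integrable.
have GL i : inL1loc Omega (fun x => G x ord0 i) := integrable_inL1loc oO (mG i) (G_integrable i).
split => // i; split => // psi tpsi.
have [B B0 hB] := test_fun_bounded tpsi.
have tp := test_fun_partial i tpsi.
have [B' B'0 hB'] := test_fun_bounded tp.
apply/eqP; rewrite -subr_eq0 opprK -normr_le0; apply/ler_addgt0Pr => e e0; rewrite add0r.
have [FL _] : weak_gradient Omega (F 0%N) (cgrad (F 0%N)) by exact: test_weak_gradient.
have h1 j : `|\int[mu]_(x in Omega) (u x * partial i psi x) -
    \int[mu]_(x in Omega) (F j x * partial i psi x)| <= B' * M0 * j.+1%:R^-1.
  have [FjL _] := test_weak_gradient oO (tF j).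
  have i1 := L1loc_test oO uL tp; have i2 := L1loc_test oO FjL tp.
  apply: (@dist_Rintegral _ _ _ mu Omega (fun x => u x * partial i psi x)
    (fun x => F j x * partial i psi x) _ mO i1 i2).
  apply: (@le_trans _ _ (\int[mu]_(x in Omega) (B' * j.+1%:R^-1)%:E)%E).
    apply: ge0_le_integral.
    - exact: mO.
    - by move=> x _; rewrite lee_fin.
    - apply/measurable_EFinP; apply: measurable_abs.
      by apply: measurable_funB; apply: measurable_funM;
        [exact: limit_measurable|exact: test_fun_measurable tp|
         exact: test_fun_measurable (tF j)|exact: test_fun_measurable tp].
    - exact: measurable_cst.
    - move=> x Ox; rewrite lee_fin -mulrBl normrM mulrC; apply: ler_pM => //.
      by rewrite distrC; apply: Fu; exact: subset_closure.
  rewrite (integral_cst mu mO); rewrite [X in (_ * X)%E](_ : _ = M0%:E); last exact: M0E.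
  by rewrite -EFinM lee_fin mulrAC.
have h2 j : `|\int[mu]_(x in Omega) (partial i (F j) x * psi x) -
    \int[mu]_(x in Omega) (G x ord0 i * psi x)| <= B * b j.
  have [FjL _] := test_weak_gradient oO (test_fun_partial i (tF j)).
  have i1 := L1loc_test oO FjL tpsi; have i2 := L1loc_test oO (GL i) tpsi.
  apply: (@dist_Rintegral _ _ _ mu Omega (fun x => partial i (F j) x * psi x)
    (fun x => G x ord0 i * psi x) _ mO i1 i2).
  apply: (@le_trans _ _ (\int[mu]_(x in Omega) (B%:E * (enorm (cgrad (F j) x - G x))%:E))%E).
    apply: ge0_le_integral.
    - exact: mO.
    - by move=> x _; rewrite lee_fin.
    - apply/measurable_EFinP; apply: measurable_abs.
      by apply: measurable_funB; apply: measurable_funM;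
        [exact: test_fun_measurable (test_fun_partial i (tF j))|exact: test_fun_measurable tpsi|
         exact: mG|exact: test_fun_measurable tpsi].
    - apply/measurable_EFinP; apply: measurable_funM; first exact: measurable_cst.
      exact: mFG.
    - move=> x Ox; rewrite -EFinM lee_fin -mulrBl normrM mulrC; apply: ler_pM => //.
      by have := coord_le_enorm (cgrad (F j) x - G x) i; rewrite !mxE.
  have mE : measurable_fun Omega (fun x => (enorm (cgrad (F j) x - G x))%:E).
    by apply/measurable_EFinP; exact: mFG.
  have e0' x : Omega x -> (0 <= (enorm (cgrad (F j) x - G x))%:E)%E.
    by move=> _; rewrite lee_fin enorm_ge0.
  rewrite (@ge0_integralZl_EFin _ _ _ mu _ mO _ e0' mE _ (ltW B0)) EFinM.
  by apply: lee_wpmul2l; [rewrite lee_fin ltW|exact: limit_gradient_L1].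
have cv : B' * M0 * j.+1%:R^-1 + B * b j @[j --> \oo] --> B' * M0 * 0 + B * 0.
  apply: cvgD; apply: cvgMr; [exact: cvg_harmonic|exact: b_cvg].
rewrite !mulr0 addr0 in cv.
have [j _ hj] := cvgr_lt _ cv _ e0.
apply: le_trans (ltW (hj j _)) => //=.
have E := integration_by_parts i oO (tF j) tpsi.
apply: le_trans (lerD (h1 j) (h2 j)); apply: le_trans (ler_normB _ _).
by rewrite le_eqVlt; apply/orP; left; apply/eqP; congr (`| _ |); rewrite E; ring.
Qed.

Hypothesis n1 : (1 <= n)%N.
Variable Lp : R.
Hypothesis Lp0 : 0 <= Lp.
Hypothesis GLp : {ae leb n, forall x, Omega x -> enorm (G x) <= Lp}.

(** The excess of |grad F_j| over [Lp]. Since |G| <= Lp almost everywhere, it is at most |grad F_j -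
    G|, hence small in L^1. *)
Let W j (y : 'rV[R]_n) : R := Num.max (enorm (cgrad (F j) y) - Lp) 0.

Let W_ge0 j y : 0 <= W j y.
Proof. by rewrite le_max lexx orbT. Qed.

Let measurable_W j (D : set 'rV[R]_n) : measurable_fun D (W j).
Proof.
apply: measurable_maxr; last exact: measurable_cst.
apply: measurable_funB; last exact: measurable_cst.
apply: measurable_funTS; apply: continuous_measurable_rV.
exact: (cgrad_continuous (test_fun_ck 1 (tF j))).
Qed.

Let measurable_W_affine j (c : 'rV[R]_n) (eps : R) (D : set 'rV[R]_n) :
  measurable_fun D (fun h => W j (c + eps *: h)).
Proof.
apply: measurable_maxr; last exact: measurable_cst.
apply: measurable_funB; last exact: measurable_cst.
exact: (measurable_cgrad_affine (test_fun_ck 1 (tF j))).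
Qed.

Let integral_W j : (\int[mu]_y (W j y)%:E <= (b j)%:E)%E.
Proof.
apply: le_trans (limit_gradient_L1 j).
rewrite (_ : (\int[mu]_y (W j y)%:E)%E = (\int[mu]_(y in Omega) (W j y)%:E)%E); last first.
  rewrite [RHS]integral_mkcond; apply: eq_integral => x _.
  rewrite /patch; case: ifPn => //; rewrite notin_setE => nx.
  rewrite /W (cgrad_out (tF j) nx) enorm0 sub0r; congr EFin.
  by apply/max_idPr; rewrite oppr_le0.
apply: ae_ge0_le_integral.
- exact: mO.
- by move=> x _; rewrite lee_fin.
- by apply/measurable_EFinP; exact: measurable_W.
- by move=> x _; rewrite lee_fin enorm_ge0.
- by apply/measurable_EFinP; exact: mFG.
- move: GLp; apply: filterS => x hx Ox; rewrite lee_fin ge_max enorm_ge0 andbT.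
  rewrite lerBlDr; apply: le_trans (_ : _ <= enorm (cgrad (F j) x - G x) + enorm (G x)) _.
    by rewrite -[X in enorm X <= _](subrK (G x)); exact: enormD.
  by rewrite lerD2l; exact: hx.
Qed.

(** Averaging over a cube of side [eps] divides the integral of the excess by eps^n, which is
    harmless once [eps] is fixed and [j] is large. *)
Let cube_bound j (c : 'rV[R]_n) (eps : R) : 0 < eps ->
  (\int[mu]_(h in ucube) (enorm (cgrad (F j) (c + eps *: h)))%:E <= (Lp + (eps ^+ n)^-1 * b j)%:E)%E.
Proof.
move=> e0; have en : 0 < eps ^+ n by rewrite exprn_gt0.
have mc : measurable_fun ucube (fun h : 'rV[R]_n => (W j (c + eps *: h))%:E).
  by apply/measurable_EFinP; exact: measurable_W_affine.
have c0 (h : 'rV[R]_n) : ucube h -> (0 <= (W j (c + eps *: h))%:E)%E by move=> _; rewrite lee_fin.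
apply: (@le_trans _ _ (\int[mu]_(h in ucube) (Lp%:E + (W j (c + eps *: h))%:E))%E).
  apply: ge0_le_integral.
  - exact: measurable_ucube.
  - by move=> x _; rewrite lee_fin enorm_ge0.
  - by apply/measurable_EFinP; exact: (measurable_cgrad_affine (test_fun_ck 1 (tF j))).
  - by apply: emeasurable_funD => //; exact: measurable_cst.
  - move=> x _; rewrite -EFinD lee_fin -lerBlDl /W le_max lexx //.
have l0 (h : 'rV[R]_n) : ucube h -> (0 <= (cst Lp%:E h : \bar R))%E by move=> _; rewrite lee_fin.
rewrite (@ge0_integralD _ _ _ mu ucube (@measurable_ucube R n) _ _ l0 (measurable_cst _) c0 mc).
rewrite EFinD; apply: leeD.
  rewrite (integral_cst mu (@measurable_ucube R n)).
  rewrite [X in (_ * X)%E](_ : _ = 1%E); last exact: leb_ucube.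
  by rewrite mule1.
have mWT : measurable_fun [set: 'rV[R]_n] (fun x => (W j x)%:E).
  by apply/measurable_EFinP; exact: measurable_W.
have WT0 x : (0 <= (W j x)%:E)%E by rewrite lee_fin.
have eqA := @ge0_integral_affine R n c eps (fun x => (W j x)%:E) e0 mWT WT0.
rewrite EFinM lee_pdivlMl//.
apply: le_trans (integral_W j); rewrite eqA.
apply: lee_wpmul2l; first by rewrite lee_fin ltW.
apply: ge0_subset_integral => //.
- exact: measurable_ucube.
- by apply/measurable_EFinP; exact: measurable_W_affine.
Qed.

(** The path of Morrey's estimate with two different bounds: the translation uses the cube average
    close to [Lp], the ends a cruder L^(n + 1) bound uniform in [j]. Taking [mrate] at distance 0
    isolates the contribution of the ends. *)
Let diff_bound j (x z : 'rV[R]_n) (eps : R) : 0 < eps -> ~ Omega z ->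
  `|F j x| <= (M0 + 1) * (L + 1) * @mrate R n n.+1%:R eps 0 +
              enorm (x - z) * (Lp + (eps ^+ n)^-1 * b j).
Proof.
move=> e0 nz; have en : 0 < eps ^+ n by rewrite exprn_gt0.
(* Bounds the L^(n + 1) norm of the gradient for all [j], as |Omega| <= (|Omega| + 1)^(n + 1) and 1
   / (j + 1) <= 1. *)
pose K := (M0 + 1) * (L + 1).
have K0 : 0 < K by apply: mulr_gt0; [exact: ltr_wpDl|exact: addr_gt0].
have p1 : 1 <= n.+1%:R :> R by rewrite ler1n.
have cv := test_fun_ck 1 (tF j).
have [B [vB gB]] := test_fun_bounds (tF j).
have hp : (\int[mu]_x (enorm (cgrad (F j) x) `^ n.+1%:R)%:E <= (K `^ n.+1%:R)%:E)%E.
  have -> : (\int[mu]_x (enorm (cgrad (F j) x) `^ n.+1%:R)%:E =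
             \int[mu]_(x in Omega) (enorm (cgrad (F j) x) ^+ n.+1)%:E)%E.
    rewrite [RHS]integral_mkcond; apply: eq_integral => y _.
    rewrite powR_mulrn ?enorm_ge0// /patch; case: ifPn => //; rewrite notin_setE => ny.
    by rewrite (cgrad_out (tF j) ny) enorm0 expr0n.
  have q1 : (n.+1 <= j + n + 2)%N by rewrite addn2 ltnS leqW// leq_addl.
  apply: (@le_trans _ _ (M0 * (L + j.+1%:R^-1) ^+ n.+1)%:E); first exact: Fq.
  rewrite lee_fin powR_mulrn ?(ltW K0)// /K exprMn; apply: ler_pM => //.
  - by rewrite exprn_ge0// addr_ge0// ltW.
  - apply: le_trans (_ : _ <= M0 + 1) _; first by rewrite lerDl.
    by apply: ler_eXnr => //; rewrite lerDr.
  - apply: lerXn2r; rewrite ?nnegrE.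
    + by rewrite addr_ge0// ltW.
    + by rewrite addr_ge0// ltW.
    + by rewrite lerD2l invf_le1// ler1n.
have al1 : n%:R / n.+1%:R < 1 :> R by rewrite ltr_pdivrMr// mul1r ltr_nat.
have hend c : `|F j c - avg (F j) c eps| <=
    Num.sqrt n%:R * K * (eps `^ (1 - n%:R / n.+1%:R) / (1 - n%:R / n.+1%:R)).
  apply: (avg_end cv vB gB) => //; first exact: ltW.
  by move=> s s0 _; exact: mean_grad.
have hmid : `|avg (F j) x eps - avg (F j) z eps| <= enorm (x - z) * (Lp + (eps ^+ n)^-1 * b j).
  apply: (avg_lip cv vB gB).
    by rewrite addr_ge0// mulr_ge0 ?invr_ge0 ?(ltW en)// divr_ge0.
  by move=> c; exact: cube_bound.
have -> : F j x = (F j x - avg (F j) x eps) + (avg (F j) x eps - avg (F j) z eps) - (F j z - avg (F j) z eps).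
  by rewrite (test_fun_out (tF j) nz); ring.
apply: le_trans (ler_normB _ _) _.
apply: le_trans (lerD (ler_normD _ _) (hend z)) _.
apply: le_trans (lerD (lerD (hend x) hmid) (lexx _)) _.
by rewrite le_eqVlt; apply/orP; left; apply/eqP; rewrite /mrate -/K; ring.
Qed.

(** [eps] is fixed so that the ends are small, and only afterwards [j], because the excess comes
    divided by eps^n. *)
Lemma limit_bdist_bound x : Omega x -> `|u x| <= Lp * bdist Omega x.
Proof.
move=> Ox.
have hz z : ~ Omega z -> `|u x| <= Lp * enorm (x - z).
  move=> nz; apply/ler_addgt0Pr => e e0.
  pose K := (M0 + 1) * (L + 1).
  have K0 : 0 < K by apply: mulr_gt0; [exact: ltr_wpDl|exact: addr_gt0].
  have np : n%:R < n.+1%:R :> R by rewrite ltr_nat.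
  have r0 : 0 < e / 2 / K by rewrite !divr_gt0.
  have [eps [s [eps0 s0 hs]]] := mrate_small n1 np r0.
  have h1 : K * @mrate R n n.+1%:R eps 0 <= e / 2.
    by rewrite mulrC -ler_pdivlMr//; apply: hs; exact: ltW.
  have cv : enorm (x - z) * ((eps ^+ n)^-1 * b j) + j.+1%:R^-1 @[j --> \oo] -->
      enorm (x - z) * ((eps ^+ n)^-1 * 0) + 0.
    apply: cvgD; last exact: cvg_harmonic.
    by apply: cvgMr; apply: cvgMr; exact: b_cvg.
  rewrite !mulr0 addr0 in cv.
  have e2 : 0 < e / 2 by rewrite divr_gt0.
  have [j _ hj] := cvgr_lt _ cv _ e2.
  have {}hj := hj j (leqnn j); rewrite /= in hj.
  have h2 := @diff_bound j x z eps eps0 nz.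
  have h3 : `|u x| <= `|F j x| + j.+1%:R^-1.
    rewrite (_ : u x = F j x - (F j x - u x)); last by ring.
    by apply: le_trans (ler_normB _ _) _; rewrite lerD2l Fu//; exact: subset_closure.
  apply: le_trans h3 _; apply: le_trans (lerD h2 (lexx _)) _.
  rewrite -/K (mulrDr (enorm _)) (mulrC (enorm _) Lp).
  rewrite -addrA -addrA addrCA lerD2l [e]splitr; exact: lerD h1 (ltW hj).
(* For Lp > 0 one divides by [Lp] to compare with the infimum over the boundary. *)
have [Lp00|Lpn0] := eqVneq Lp 0.
  have [y /(boundaryP oO)[_ ny]] := boundary_nonempty oO bO n1 Ox.
  by have := hz y ny; rewrite Lp00 !mul0r.
have Lp_gt0 : 0 < Lp by rewrite lt_neqAle eq_sym Lpn0.
rewrite mulrC -ler_pdivrMr//; apply: lb_le_inf.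
  by have [y hy] := boundary_nonempty oO bO n1 Ox; exists (enorm (x - y)); exists y.
move=> _ [y /(boundaryP oO)[_ ny] <-]; rewrite ler_pdivrMr// mulrC; exact: hz.
Qed.

End limit_gradient.





(** * The L^oo norm and the limit as an element of W^{1,oo} *)

Lemma LpNy_leP (R : realType) (n : nat) (Omega : set 'rV[R]_n) (f : 'rV[R]_n -> R) (c : R) :
  0 <= c ->
  (LpN Omega +oo f <= c%:E)%E <-> {ae leb n, forall x, Omega x -> `|f x| <= c}.
Proof.
(* The norm at [+oo] branches on whether the whole space has positive measure. *)
move=> c0; rewrite /LpN unlock ifT; last by apply: open_leb_gt0; [exact: openT|exists 0].
split.
  move/ess_sup_inf.ess_supP; apply: filterS => x /= hx Ox.
  by move: hx; rewrite /patch mem_set// lee_fin.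
move=> h; apply/ess_sup_inf.ess_supP; move: h; apply: filterS => x /= hx.
by rewrite /patch lee_fin; case: ifPn => [/set_mem/hx//|_]; rewrite normr0.
Qed.

(** If |v| > c at one point of [Omega], continuity makes it so on a nonempty open set, which is not
    null. *)
Lemma LpNy_continuous_le (R : realType) (n : nat) (Omega : set 'rV[R]_n)
    (v : 'rV[R]_n -> R) (c : R) : open Omega -> 0 <= c ->
  {within closure Omega, continuous v} -> (LpN Omega +oo v <= c%:E)%E ->
  forall x, Omega x -> `|v x| <= c.
Proof.
move=> oO c0 cv /(LpNy_leP _ _ c0)[N [mN N0 hN]] x Ox.
rewrite leNgt; apply/negP => vx.
have cx := within_closure_continuous oO cv Ox.
have h1 : \forall y \near x, Omega y /\ c < `|v y|.
  apply: filterI; first exact: open_nbhs_nbhs.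
  have cn : {for x, continuous (fun y => `|v y|)}.
    by apply: continuous_comp => //; exact: norm_continuous.
  exact: (cvgr_gt _ cn _ vx).
pose A := interior [set y | Omega y /\ c < `|v y|].
have A0 : A !=set0 by exists x.
have oA : open A by exact: open_interior.
have := open_leb_gt0 oA A0; apply/negP; rewrite -leNgt -N0.
apply: le_measure; rewrite ?inE//; first exact: open_measurable_rV.
move=> y /interior_subset[Oy vy]; apply: hN => /= h.
by have := h Oy; rewrite leNgt vy.
Qed.

(** The last conclusion is meant for [K] equal to the gradient norm itself, where it becomes a lower
    bound on that norm. *)
Lemma limit_sobolev (R : realType) (n : nat) (Omega : set 'rV[R]_n) (L : R) (u : 'rV[R]_n -> R) :
  open Omega -> bounded_set Omega -> (1 <= n)%N -> Omega !=set0 -> 0 < L ->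
  (forall e Q : R, 0 < e -> exists (phi : 'rV[R]_n -> R) (p : R),
    [/\ test_fun Omega phi, (forall y, closure Omega y -> `|phi y - u y| <= e), Q <= p &
      (\int[leb n]_x (enorm (cgrad phi x) `^ p)%:E <= ((L + e) `^ p)%:E)%E]) ->
  [/\ W1p Omega +oo u, (gradN Omega +oo u <= L%:E)%E &
      forall K x, 0 <= K -> (gradN Omega +oo u <= K%:E)%E -> Omega x ->
        `|u x| <= K * bdist Omega x].
Proof.
move=> oO bO n1 O0 L0 approx.
have [F [tF Fu Fq FF]] := gradient_sequence oO bO O0 L0 approx.
have [G [mG FG]] := limit_gradient_exists oO tF FF.
have GL := limit_gradient_bound oO bO L0 tF Fq mG FG.
have wG := limit_weak_gradient oO bO tF Fu FF mG FG.
have wg := weak_gradient_grad wG.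
have gG := weak_gradient_unique oO wg wG.
(* Norms are defined with [grad], while the estimates concern [G]; uniqueness of weak gradients
   identifies them almost everywhere. *)
have hgrad K : {ae leb n, forall x, Omega x -> enorm (grad Omega u x) <= K} <->
    {ae leb n, forall x, Omega x -> enorm (G x) <= K}.
  by split; apply: filterS2 gG => x gx hx Ox; have := hx Ox; rewrite gx.
have gradK K : 0 <= K -> (gradN Omega +oo u <= K%:E)%E <->
    {ae leb n, forall x, Omega x -> enorm (G x) <= K}.
  move=> K0; rewrite /gradN LpNy_leP// -hgrad.
  by split; apply: filterS => x hx Ox; have := hx Ox; rewrite ger0_norm ?enorm_ge0.
have gu : (gradN Omega +oo u <= L%:E)%E by apply/gradK => //; exact: ltW.
have [B B0 hB] := limit_bounded tF Fu.
split => //.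
- split => //.
    split; first exact: (limit_measurable tF Fu).
    apply: (@le_lt_trans _ _ B%:E); last exact: ltry.
    by apply/LpNy_leP; [exact: ltW|apply: nearW => x Ox; apply: hB; exact: subset_closure].
  move=> i; split; first by have [_ /(_ i)[[]]] := wg.
  apply: (@le_lt_trans _ _ L%:E); last exact: ltry.
  apply/LpNy_leP; first exact: ltW.
  have := (hgrad L).2 GL; apply: filterS => x hx Ox.
  exact: le_trans (coord_le_enorm _ _) (hx Ox).
- move=> K x K0 /(gradK _ K0) GK Ox.
  exact: (limit_bdist_bound oO bO L0 tF Fu Fq FF mG FG n1 K0 GK).
Qed.

Lemma bounded_closure_compact (R : realType) (n : nat) (A : set 'rV[R]_n) :
  bounded_set A -> compact (closure A).
Proof.
move=> /bounded_setP[M M0 hM]; apply: bounded_closed_compact; last exact: closed_closure.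
suff cM : closure A `<=` [set x | `|x| <= M].
  exists M; split; first exact: num_real.
  by move=> r Mr x /cM xM; exact: le_trans xM (ltW Mr).
rewrite closureE; apply: smallest_sub; last by move=> x /hM /ltW.
apply: (@preimage_closed _ _ (fun x : 'rV[R]_n => `|x|) [set t | t <= M]); last exact: closed_le.
by move=> x _; exact: norm_continuous.
Qed.

Lemma uniform_cvgP (U : choiceType) (R : realType) (A : set U) (f : nat -> U -> R) (g : U -> R) :
  (forall e, 0 < e -> \forall j \near \oo, forall y, A y -> `|f j y - g y| <= e) ->
  {uniform A, f @ \oo --> g}.
Proof.
move=> h P /uniform_nbhs[E [+ EP]].
rewrite -entourage_from_ballE => -[e /= e0 eE].
have e2 : 0 < e / 2 by rewrite divr_gt0.
have := h _ e2; apply: filterS => j hj; apply: EP => y Ay; apply: eE.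
rewrite /ball /= distrC; apply: le_lt_trans (hj y Ay) _.
by rewrite ltr_pdivrMr// mulr_natr mulr2n ltrDl.
Qed.

(** * The extremal functions u_p and their limit *)

Section extremal_functions.
Context {R : realType} {n : nat}.
Variable Omega : set 'rV[R]_n.
Hypothesis oO : open Omega.
Hypothesis bO : bounded_set Omega.
Hypothesis n1 : (1 <= n)%N.
Variables (x : 'rV[R]_n) (u : R -> 'rV[R]_n -> R).
Hypothesis Ox : Omega x.
Hypothesis hu : forall p : R, n%:R < p ->
  [/\ Mp Omega p x (u p),
      forall y, Omega y -> 0 < u p y &
      sp Omega p x = ((fine (gradN Omega p%:E (u p)))^-1)%:E].

Let p1 (p : R) : n%:R < p -> 1 <= p.
Proof. by move=> np; apply: le_trans (ltW np); rewrite ler1n. Qed.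

(** The gradient norm is the inverse of s_p(x), which tends to d_Omega(x). *)
Lemma extremal_grad (K : R) : (bdist Omega x)^-1 < K ->
  \forall p \near +oo, n%:R < p -> (gradN Omega p%:E (u p) < K%:E)%E.
Proof.
move=> dK; have d0 := bdist_gt0 oO bO n1 Ox.
have K0 : 0 < K by apply: lt_trans dK; rewrite invr_gt0.
have cv := sp_cvg oO bO n1 (subset_closure Ox).
have cvf : (fine (sp Omega p x)) @[p --> +oo] --> bdist Omega x by exact: fine_cvg cv.
have Kd : K^-1 < bdist Omega x by rewrite invf_plt ?posrE.
have [P [_ hP]] := cvgr_gt _ cvf _ Kd.
exists P; split; first exact: num_real.
move=> p /hP hp np.
have [[[[W _] _] _ _] _ sE] := hu np.
have gl := gradN_lty oO (p1 np) W.
have g0 : (0 <= gradN Omega p%:E (u p))%E by exact: LpN_ge0.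
have gf : gradN Omega p%:E (u p) \is a fin_num by rewrite ge0_fin_numE.
rewrite -(fineK gf) lte_fin; move: hp; rewrite /= sE /=.
set g := fine _ => hp; have gg : 0 <= g by exact: fine_ge0.
have [g00|gn0] := eqVneq g 0; first by rewrite g00.
have g_gt0 : 0 < g by rewrite lt_neqAle eq_sym gn0.
by move: hp; rewrite ltf_pV2// ?posrE.
Qed.

Lemma extremal_bounds (p : R) : n%:R < p ->
  u p x = 1 /\ forall y, closure Omega y -> 0 <= u p y <= 1.
Proof.
move=> np; have [[[_ [cu bu]] ux uN] up _] := hu np.
split; first by rewrite -ux gtr0_norm// up.
move=> y cy; have [Oy|nOy] := pselect (Omega y); last first.
  by rewrite bu ?lexx ?ler01//; apply/(boundaryP oO).
have uN1 : (LpN Omega +oo (u p) <= 1%:E)%E by rewrite uN.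
have := LpNy_continuous_le oO ler01 cu uN1 Oy.
by rewrite gtr0_norm ?up// => ->; rewrite ltW// up.
Qed.

Variable pn : nat -> R.
Hypothesis pnn : forall k, n%:R < pn k.
Hypothesis pny : pn k @[k --> \oo] --> +oo.

Lemma extremal_equicontinuous (e : R) : 0 < e ->
  exists2 d : R, 0 < d & \forall k \near \oo, forall a b,
    closure Omega a -> closure Omega b -> `|a - b| < d -> `|u (pn k) a - u (pn k) b| <= e.
Proof.
move=> e0; have d0 := bdist_gt0 oO bO n1 Ox.
pose K := (bdist Omega x)^-1 + 1.
have K0 : 0 < K by rewrite addr_gt0// invr_gt0.
have dK : (bdist Omega x)^-1 < K by rewrite ltrDl.
(* Passes from the sup norm to the Euclidean one, the added 1 making it positive. *)
pose q := Num.sqrt n%:R + 1 : R.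
have q0 : 0 < q by rewrite ltr_wpDl.
(* A quarter of e / K: the limit of [mrate] at distance [t] is at most 3 t, which leaves room below
   4 t. *)
pose t := e / K / 4; have t0 : 0 < t by rewrite !divr_gt0.
pose eps := t / q; have eps0 : 0 < eps by rewrite divr_gt0.
have lim : t + 2 * (Num.sqrt n%:R * eps) < e / K.
  apply: (@le_lt_trans _ _ (t + 2 * t)).
    rewrite lerD2l ler_pM2l// /eps mulrA ler_pdivrMr// mulrC ler_pM2l//.
    by rewrite lerDl.
  have -> : e / K = 4 * t by rewrite /t; field; exact: lt0r_neq0.
  by move: t0; lra.
have h1 : \forall p \near +oo, @mrate R n p eps t < e / K.
  exact: cvgr_lt _ (@mrate_cvg R n eps t eps0) _ lim.
have h2 := extremal_grad dK.
exists (t / q); first by rewrite divr_gt0.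
have [k0 _ hk0] := pny (filterI h1 h2).
exists k0 => // k /hk0[/= hk1 hk2] a b ca cb ab.
have [[W _ _] _ _] := hu (pnn k).
apply: le_trans (morrey_w1p0 oO bO n1 (pnn k) W K0 eps0 (hk2 (pnn k)) ca cb) _.
rewrite mulrC -ler_pdivlMr//; apply: le_trans (ltW hk1); apply: mrateS.
apply: le_trans (enorm_le_norm _) _.
apply: (@le_trans _ _ (q * `|a - b|)); first by rewrite ler_wpM2r// lerDl.
by rewrite mulrC -ler_pdivlMr// ltW.
Qed.

Lemma extremal_limit : exists sigma : nat -> nat, {homo sigma : i j / (i < j)%N} /\
  exists uoo : 'rV[R]_n -> R,
    {uniform closure Omega, (fun j => u (pn (sigma j))) @ \oo --> uoo} /\
    [/\ forall y, closure Omega y -> 0 <= uoo y,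
        W1p Omega +oo uoo /\ C0 Omega uoo,
        uoo x = 1, LpN Omega +oo uoo = 1%E &
        gradN Omega +oo uoo = ((bdist Omega x)^-1)%:E].
Proof.
have d0 := bdist_gt0 oO bO n1 Ox.
have u1 k y : closure Omega y -> `|u (pn k) y| <= 1.
  by move=> cy; have [_ /(_ y cy)/andP[h1 h2]] := extremal_bounds (pnn k); rewrite ger0_norm.
have [sigma [hs [g hg]]] := ascoli_sequence (bounded_closure_compact bO) u1 extremal_equicontinuous.
have sj j : (j <= sigma j)%N.
  by elim: j => // j IH; apply: leq_ltn_trans IH _; exact: hs.
have unif : {uniform closure Omega, (fun j => u (pn (sigma j))) @ \oo --> g}.
  exact: uniform_cvgP.
have lim y : closure Omega y -> u (pn (sigma j)) y @[j --> \oo] --> g y.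
  move=> cy; apply/cvgrPdist_le => e e0; have := hg e e0; apply: filterS => j hj.
  by rewrite distrC; exact: hj.
have cx : closure Omega x := subset_closure Ox.
have g01 y : closure Omega y -> 0 <= g y <= 1.
  move=> cy; apply/andP; split.
    apply: (cvgr_to_ge (lim y cy)); apply: nearW => j.
    by have [_ /(_ y cy)/andP[]] := extremal_bounds (pnn (sigma j)).
  apply: (cvgr_to_le (lim y cy)); apply: nearW => j.
  by have [_ /(_ y cy)/andP[]] := extremal_bounds (pnn (sigma j)).
have gx : g x = 1.
  have := lim x cx; rewrite (_ : (fun j => u (pn (sigma j)) x) = fun=> 1).
    by move=> /cvg_lim; rewrite lim_cst// => <-.
  by apply/funext => j; have [] := extremal_bounds (pnn (sigma j)).
have gC : {within closure Omega, continuous g}.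
  apply: (uniform_limit_continuous_subspace _ _ unif); exists 0%N => // j _ /=.
  by have [[[_ []]]] := hu (pnn (sigma j)).
have g0 y : boundary Omega y -> g y = 0.
  move=> by0; have cy : closure Omega y by case/(boundaryP oO): by0.
  have := lim y cy; rewrite (_ : (fun j => u (pn (sigma j)) y) = fun=> 0).
    by move=> /cvg_lim; rewrite lim_cst// => <-.
  by apply/funext => j; have [[[_ [_ bu]] _ _] _ _] := hu (pnn (sigma j)); exact: bu.
have L0 : 0 < (bdist Omega x)^-1 by rewrite invr_gt0.
(* A test function within e / 2 of some u_p, itself within e / 2 of [g], with [p] at least [Q] and
   large enough for the gradient norm of u_p to be below 1 / d_Omega(x) + e. *)
have approx (e Q : R) : 0 < e -> exists (phi : 'rV[R]_n -> R) (p : R),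
    [/\ test_fun Omega phi, (forall y, closure Omega y -> `|phi y - g y| <= e), Q <= p &
      (\int[leb n]_x (enorm (cgrad phi x) `^ p)%:E <= (((bdist Omega x)^-1 + e) `^ p)%:E)%E].
  move=> e0; have e2 : 0 < e / 2 by rewrite divr_gt0.
  pose K := (bdist Omega x)^-1 + e.
  have K0 : 0 < K by rewrite addr_gt0.
  have dK : (bdist Omega x)^-1 < K by rewrite ltrDl.
  have hQ : \forall p \near +oo, Q <= p by apply: nbhs_pinfty_ge; exact: num_real.
  have [N1 _ hN1] := pny (filterI (extremal_grad dK) hQ).
  have [N2 _ hN2] := hg _ e2.
  pose j := maxn N1 N2.
  have [hK Qp] := hN1 (sigma j) (leq_trans (leq_maxl _ _) (sj j)).
  have ug := hN2 j (leq_maxr _ _).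
  have [[W _ _] _ _] := hu (pnn (sigma j)).
  have [phi [tphi phiu phip]] := w1p0_approx oO bO n1 (pnn (sigma j)) W K0 (hK (pnn _)) e2.
  exists phi, (pn (sigma j)); split => // y cy.
  rewrite (_ : phi y - g y = (phi y - u (pn (sigma j)) y) + (u (pn (sigma j)) y - g y)); last by ring.
  by apply: le_trans (ler_normD _ _) _; rewrite [e]splitr; exact: lerD (phiu y cy) (ug y cy).
have [gW gL gb] := limit_sobolev oO bO n1 (ex_intro _ x Ox) L0 approx.
exists sigma; split => //; exists g; split => //; split => //.
- by move=> y /g01/andP[].
- apply/eqP; rewrite eq_le; apply/andP; split.
    apply/LpNy_leP => //; apply: nearW => y Oy.
    by have /andP[h0 h1] := g01 y (subset_closure Oy); rewrite ger0_norm.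
  (* A norm below 1 would bound the continuous [g] below 1 at [x]. *)
  rewrite leNgt; apply/negP => lt1.
  have N0 : (0 <= LpN Omega +oo g)%E by exact: LpN_ge0.
  have Nf : LpN Omega +oo g \is a fin_num by rewrite ge0_fin_numE// (lt_trans lt1)// ltry.
  have c0 := fine_ge0 N0.
  have := LpNy_continuous_le oO c0 gC _ Ox; rewrite fineK// lexx => /(_ isT).
  by rewrite gx normr1 leNgt -lte_fin fineK// lt1.
- have N0 : (0 <= gradN Omega +oo g)%E by exact: LpN_ge0.
  have Nf : gradN Omega +oo g \is a fin_num by rewrite ge0_fin_numE// (le_lt_trans gL)// ltry.
  apply/eqP; rewrite eq_le gL /=.
  have c0 := fine_ge0 N0.
  (* With [K] the gradient norm itself, 1 = g x <= K d_Omega(x). *)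
  have := gb _ x c0; rewrite fineK// lexx gx normr1 => /(_ isT Ox) h.
  by rewrite -[leRHS]fineK// lee_fin -[leLHS]mul1r ler_pdivrMr.
Qed.

End extremal_functions.

Theorem proposition3p2 (R : realType) (N : nat) (hN : (1 <= N)%N)
    (Omega : set 'rV[R]_N) (hOmega : smooth_bounded_domain Omega) :
  (forall (x : 'rV[R]_N), Omega x ->
   forall u : R -> 'rV[R]_N -> R,
   (forall p : R, N%:R < p ->
      [/\ Mp Omega p x (u p),
          forall y, Omega y -> 0 < u p y &
          sp Omega p x = ((fine (gradN Omega p%:E (u p)))^-1)%:E]) ->
   forall pn : nat -> R,
   (forall k, N%:R < pn k) -> pn k @[k --> \oo] --> +oo ->
   exists sigma : nat -> nat, {homo sigma : i j / (i < j)%N} /\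
   exists uoo : 'rV[R]_N -> R,
     {uniform closure Omega, (fun j => u (pn (sigma j))) @ \oo --> uoo} /\
     [/\ forall y, closure Omega y -> 0 <= uoo y,
         W1p Omega +oo uoo /\ C0 Omega uoo,
         uoo x = 1, LpN Omega +oo uoo = 1%E &
         gradN Omega +oo uoo = ((bdist Omega x)^-1)%:E]) /\
  (forall y, closure Omega y ->
     sp Omega p y @[p --> +oo] --> (bdist Omega y)%:E).
Proof.
have [oO _ _ bO _] := hOmega; split.
  move=> x Ox u hu pn pnn pny; exact: (extremal_limit oO bO hN Ox hu pnn pny).
by move=> y cy; exact: sp_cvg.
Qed.
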